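(* Let $f$ belong to the class $C$ of normalized convex univalent functions and let $\beta$ be its lower order. Then $f'\in H^p$ for all $0<p<\frac{1}{1+\beta}$ and $f\in H^q$ for all $0<q<\frac1\beta$.
   Context: $\mathbb{D}$ is the open unit disk. $S$ is the class of univalent (injective holomorphic) functions $f(z)=z+\sum_{n=2}^\infty a_nz^n$ in $\mathbb{D}$. $C\subset S$ consists of those $f\in S$ whose range $f(\mathbb{D})$ is a convex set. The lower order of $f$ is $$\beta=\inf_{\zeta\in\mathbb{D}}|A_f(\zeta)|,\qquad A_f(\zeta)=\frac12(1-|\zeta|^2)\frac{f''(\zeta)}{f'(\zeta)}-\overline{\zeta}.$$ For $0<p<\infty$ the Hardy space $H^p$ is the set of holomorphic $f$ in $\mathbb{D}$ with $\sup_{r<1}\int_0^{2\pi}|f(re^{i\theta})|^p\,d\theta<\infty$. Convention: $1/0=\infty$. *)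

(* Defs.v *)
From Stdlib Require Import Reals.
From Coquelicot Require Import Coquelicot.

Open Scope R_scope.

(* Functions on the unit disk are total functions C -> C of which only the
   values on the disk matter: it is open, so derivatives at its points depend
   only on these values. *)
Definition disk (z : C) : Prop := Cmod z < 1.

Definition holomorphic_on_disk (f : C -> C) : Prop :=
  forall z : C, disk z -> ex_derive (K := C_AbsRing) (V := C_NormedModule) f z.

Definition injective_on_disk (f : C -> C) : Prop :=
  forall z w : C, disk z -> disk w -> f z = f w -> z = w.

Definition class_S (f : C -> C) : Prop :=
  holomorphic_on_disk f /\ injective_on_disk f /\
  exists a : nat -> C, a 0%nat = RtoC 0 /\ a 1%nat = RtoC 1 /\
    forall z : C, disk z ->
      is_pseries (K := C_AbsRing) (V := C_NormedModule) a z (f z).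

Definition convex_set (E : C -> Prop) : Prop :=
  forall (z w : C) (t : R), E z -> E w -> 0 <= t <= 1 ->
    E (RtoC (1 - t) * z + RtoC t * w)%C.

Definition image_of_disk (f : C -> C) (w : C) : Prop :=
  exists z : C, disk z /\ f z = w.

Definition class_C (f : C -> C) : Prop :=
  class_S f /\ convex_set (image_of_disk f).

Definition A_op (f : C -> C) (zeta : C) : C :=
  (RtoC (/ 2) * RtoC (1 - Cmod zeta ^ 2)
     * (C_derive (C_derive f) zeta / C_derive f zeta) - Cconj zeta)%C.

(* The infimum is over a nonempty set of nonnegative reals, hence finite, so
   [real] loses nothing. *)
Definition lower_order (f : C -> C) : R :=
  real (Glb_Rbar (fun x : R =>
    exists zeta : C, disk zeta /\ x = Cmod (A_op f zeta))).

(* [Rpower 0 p] is 1, whereas Hardy integrals need 0 ^ p = 0 for p > 0. *)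
Definition nnpow (x p : R) : R :=
  if Req_EM_T x 0 then 0 else Rpower x p.

(* For p > 0 and f holomorphic the integrand is continuous in theta, so the
   total operator [RInt] is the genuine integral. *)
Definition hardy_mean (p : R) (f : C -> C) (r : R) : R :=
  RInt (fun theta : R => nnpow (Cmod (f (r * cos theta, r * sin theta))) p)
       0 (2 * PI).

Definition Hardy (p : R) (f : C -> C) : Prop :=
  holomorphic_on_disk f /\
  bound (fun I : R => exists r : R, 0 <= r < 1 /\ I = hardy_mean p f r).

(* [Rbar_inv 0] is 0 in Coquelicot; here 1/0 = +oo. *)
Definition recip (x : R) : Rbar :=
  if Req_EM_T x 0 then p_infty else Finite (1 / x).

(* Main.v *)
Require Import Defs.
From Stdlib Require Import Reals Lra Lia Psatz Arith ClassicalEpsilon.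
From Coquelicot Require Import Coquelicot.

Open Scope R_scope.

(** The lower order enters only through its approximate minimizers. Let [c] be
    a point of the disk with [a = Cmod (A_op f c)]. The Koebe transform
    [g = f o mobius c] is again a convex map, and [g'' / g' = 2 * A_op f c] at
    the origin.

    Convexity is used through subordination. For [Cmod w <= 1] the function
    [G = g^-1 ((1 - t) * g z + t * g (w * z))] maps the disk to itself and
    fixes the origin, so [Cmod (G z) <= Cmod z] by Schwarz's lemma. The
    derivative at [t = 0] is a two-point inequality ([convex_two_point]); with
    [w = 0] it says that [Re (z g' / g)] is nonnegative when [g 0 = 0], and its
    second variation along [w = exp (i eta)] that [Re (1 + z g'' / g')] is
    nonnegative.

    A harmonic function [u >= 0] with [u 0 = 1] and gradient of norm [2 * a] at
    the origin satisfies [u z <= (1 + 2 a r + r^2) / (1 - r^2)] with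
    [r = Cmod z]: bound the Poisson kernel, a convex function of a cosine, by
    its chord ([harnack_gradient]). For [u = Re (1 + z g'' / g')] this
    integrates to [g' = O((1 - r)^-(1 + a))], and the same estimate follows for
    [f'] ([convex_derivative_growth]); one more integration gives
    [f = O((1 - r)^-a)] for [a > 0].

    Growth is turned into integral means by Prawitz's argument
    ([starlike_integral_means]). If [Re (z h' / h) >= 0] then
    [r d/dr int |h|^p = p int |h|^p Re (z h' / h)], at most [2 pi p] times the
    maximum of [|h|^p] on the circle because [Re (z h' / h)] has mean value
    [1]. It is applied to [h = f] and to [h = z f'], with [z h' / h] equal to
    [1 + z f'' / f'] in the second case.

    The complex analysis behind this is developed from Cauchy's formula for
    functions with a continuous complex derivative, proved by shrinking the
    circle ([cauchy_formula]). The mean value bound it implies shows that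
    injective functions have a continuous inverse and a derivative without
    zeros, which makes the functions [G] above holomorphic. *)

(** * Continuity of complex-valued functions *)

(** The carrier of an equation may be displayed as a uniform space, which
    [ring] and [field] do not recognize as [C]. *)
Ltac cring :=
  cbv beta; match goal with |- @eq _ ?a ?b => change (@eq C a b) end; ring.

Ltac cfield :=
  cbv beta; match goal with |- @eq _ ?a ?b => change (@eq C a b) end; field.

Section ContinuousC.
Context {U : UniformSpace}.
Implicit Types (F G : U -> C) (x : U).

Lemma continuous_C_pair (a b : U -> R) x :
  continuous a x -> continuous b x -> continuous (fun y => (a y, b y) : C) x.
Proof.
  intros Ha Hb.
  apply (continuous_comp_2 (W := R_UniformSpace) (X := C_UniformSpace) a b (fun u v => (u, v)));
    try assumption.
  apply (continuous_ext (fun p : R * R => p)); [now intros []|apply continuous_id].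
Qed.

Lemma continuous_Re F x : continuous F x -> continuous (fun y => Re (F y)) x.
Proof.
  intros HF. apply (continuous_comp F fst); [assumption|].
  destruct (F x). apply continuous_fst.
Qed.

Lemma continuous_Im F x : continuous F x -> continuous (fun y => Im (F y)) x.
Proof.
  intros HF. apply (continuous_comp F snd); [assumption|].
  destruct (F x). apply continuous_snd.
Qed.

Lemma continuous_RtoC (a : U -> R) x :
  continuous a x -> continuous (fun y => RtoC (a y)) x.
Proof. intros Ha. apply continuous_C_pair; [assumption|apply continuous_const]. Qed.

Lemma continuous_Cplus F G x :
  continuous F x -> continuous G x -> continuous (fun y => (F y + G y)%C) x.
Proof.
  intros HF HG. apply continuous_C_pair.
  - apply (continuous_plus (V := R_NormedModule)); now apply continuous_Re.
  - apply (continuous_plus (V := R_NormedModule)); now apply continuous_Im.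
Qed.

Lemma continuous_Copp F x : continuous F x -> continuous (fun y => (- F y)%C) x.
Proof.
  intros HF. apply continuous_C_pair.
  - apply (continuous_opp (V := R_NormedModule)); now apply continuous_Re.
  - apply (continuous_opp (V := R_NormedModule)); now apply continuous_Im.
Qed.

Lemma continuous_Cminus F G x :
  continuous F x -> continuous G x -> continuous (fun y => (F y - G y)%C) x.
Proof. intros. apply continuous_Cplus; [assumption|now apply continuous_Copp]. Qed.

Lemma continuous_Cmult F G x :
  continuous F x -> continuous G x -> continuous (fun y => (F y * G y)%C) x.
Proof.
  intros HF HG. apply continuous_C_pair.
  - apply (continuous_minus (V := R_NormedModule)); apply (continuous_mult (K := R_AbsRing));
      (apply (continuous_Re F x HF) || apply (continuous_Re G x HG)
       || apply (continuous_Im F x HF) || apply (continuous_Im G x HG)).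
  - apply (continuous_plus (V := R_NormedModule)); apply (continuous_mult (K := R_AbsRing));
      (apply (continuous_Re F x HF) || apply (continuous_Re G x HG)
       || apply (continuous_Im F x HF) || apply (continuous_Im G x HG)).
Qed.

Lemma continuous_Cmod F x : continuous F x -> continuous (fun y => Cmod (F y)) x.
Proof.
  intros HF. unfold Cmod.
  apply (continuous_comp (fun y => fst (F y) ^ 2 + snd (F y) ^ 2) sqrt);
    [|apply continuous_sqrt].
  apply (continuous_plus (V := R_NormedModule)).
  - apply (continuous_mult (K := R_AbsRing)); [apply (continuous_Re F x HF)|].
    apply (continuous_mult (K := R_AbsRing)); [apply (continuous_Re F x HF)|apply continuous_const].
  - apply (continuous_mult (K := R_AbsRing)); [apply (continuous_Im F x HF)|].
    apply (continuous_mult (K := R_AbsRing)); [apply (continuous_Im F x HF)|apply continuous_const].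
Qed.

Lemma Cnorm2_neq_0 (z : C) : z <> 0%C -> fst z ^ 2 + snd z ^ 2 <> 0.
Proof.
  intros Hz E. apply Hz. apply Cmod_eq_0. unfold Cmod. now rewrite E, sqrt_0.
Qed.

Lemma continuous_Rinv_along (a : U -> R) x :
  continuous a x -> a x <> 0 -> continuous (fun y => / a y) x.
Proof.
  intros Ha H0. apply (continuous_comp a Rinv); [assumption|].
  now apply continuous_Rinv.
Qed.

Lemma continuous_Cinv F x :
  continuous F x -> F x <> 0%C -> continuous (fun y => (/ F y)%C) x.
Proof.
  intros HF H0.
  assert (Hn : continuous (fun y => / (fst (F y) ^ 2 + snd (F y) ^ 2)) x).
  { apply continuous_Rinv_along; [|now apply Cnorm2_neq_0].
    apply (continuous_plus (V := R_NormedModule)).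
    - apply (continuous_mult (K := R_AbsRing)); [apply (continuous_Re F x HF)|].
      apply (continuous_mult (K := R_AbsRing)); [apply (continuous_Re F x HF)|apply continuous_const].
    - apply (continuous_mult (K := R_AbsRing)); [apply (continuous_Im F x HF)|].
      apply (continuous_mult (K := R_AbsRing)); [apply (continuous_Im F x HF)|apply continuous_const]. }
  apply continuous_C_pair.
  - apply (continuous_mult (K := R_AbsRing)); [apply (continuous_Re F x HF)|apply Hn].
  - apply (continuous_mult (K := R_AbsRing)); [|apply Hn].
    apply (continuous_opp (V := R_NormedModule)). apply (continuous_Im F x HF).
Qed.

Lemma continuous_Cdiv F G x :
  continuous F x -> continuous G x -> G x <> 0%C ->
  continuous (fun y => (F y / G y)%C) x.
Proof. intros. apply continuous_Cmult; [assumption|now apply continuous_Cinv]. Qed.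

Lemma locally_neq_0 F x :
  continuous F x -> F x <> 0%C -> locally x (fun y => F y <> 0%C).
Proof.
  intros HF H0.
  assert (HM := continuous_Cmod F x HF).
  assert (Hp : 0 < Cmod (F x)) by now apply Cmod_gt_0.
  generalize (HM _ (open_gt 0 _ Hp)). unfold filtermap.
  apply filter_imp. intros y Hy E. rewrite E, Cmod_0 in Hy. lra.
Qed.

End ContinuousC.

(** * Derivatives of complex-valued functions of a real or complex variable *)

(** Caratheodory's form of the derivative with respect to an embedding [e] of
    the source into the complex plane: with the identity it is the complex
    derivative, with [RtoC] the velocity of a curve, so that the rules of
    calculus are proved once for both. *)
Definition deriv_along {U : UniformSpace} (e F : U -> C) (x : U) (l : C) : Prop :=
  exists q : U -> C, continuous q x /\ q x = l /\
    locally x (fun y => (F y - F x = (e y - e x) * q y)%C).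

Notation Cderiv := (deriv_along (U := C_UniformSpace) (fun z : C => z)).
Notation curve_deriv := (deriv_along (U := R_UniformSpace) RtoC).

Section DerivRules.
Context {U : UniformSpace} (e : U -> C).
Implicit Types (F G : U -> C) (x : U) (l m : C).

Lemma deriv_along_const (c : C) x : deriv_along e (fun _ => c) x 0.
Proof.
  exists (fun _ => 0%C). split; [apply continuous_const|split; [easy|]].
  apply filter_forall. intros y. cbv beta. ring.
Qed.

Lemma deriv_along_embedding x : deriv_along e e x 1.
Proof.
  exists (fun _ => 1%C). split; [apply continuous_const|split; [easy|]].
  apply filter_forall. intros y. cbv beta. ring.
Qed.

Lemma deriv_along_continuous F x l :
  continuous e x -> deriv_along e F x l -> continuous F x.
Proof.
  intros He (q & Hq & _ & E).
  apply (continuous_ext_loc F (fun y => (F x + (e y - e x) * q y)%C)).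
  - revert E. apply filter_imp. intros y A. rewrite <- A. cring.
  - apply continuous_Cplus; [apply continuous_const|].
    apply continuous_Cmult; [|assumption].
    apply continuous_Cminus; [assumption|apply continuous_const].
Qed.

Lemma deriv_along_plus F G x l m :
  deriv_along e F x l -> deriv_along e G x m ->
  deriv_along e (fun y => (F y + G y)%C) x (l + m).
Proof.
  intros (q & Hq & <- & E) (r & Hr & <- & E').
  exists (fun y => (q y + r y)%C).
  split; [now apply continuous_Cplus|split; [easy|]].
  generalize (filter_and _ _ E E'). apply filter_imp. intros y [A B].
  replace (F y + G y - (F x + G x))%C with ((F y - F x) + (G y - G x))%C by ring.
  rewrite A, B. ring.
Qed.

Lemma deriv_along_mult F G x l m :
  continuous e x -> deriv_along e F x l -> deriv_along e G x m ->
  deriv_along e (fun y => (F y * G y)%C) x (l * G x + F x * m).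
Proof.
  intros He HF HG.
  assert (HGc := deriv_along_continuous G x m He HG).
  destruct HF as (q & Hq & <- & E), HG as (r & Hr & <- & E').
  exists (fun y => (q y * G y + F x * r y)%C).
  split; [|split; [easy|]].
  - apply continuous_Cplus; apply continuous_Cmult; try assumption. apply continuous_const.
  - generalize (filter_and _ _ E E'). apply filter_imp. intros y [A B].
    replace (F y * G y - F x * G x)%C with ((F y - F x) * G y + F x * (G y - G x))%C by ring.
    rewrite A, B. ring.
Qed.

Lemma deriv_along_scal (c : C) F x l :
  deriv_along e F x l -> deriv_along e (fun y => (c * F y)%C) x (c * l).
Proof.
  intros (q & Hq & <- & E). exists (fun y => (c * q y)%C).
  split; [apply continuous_Cmult; [apply continuous_const|assumption]|split; [easy|]].
  revert E. apply filter_imp. intros y A.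
  replace (c * F y - c * F x)%C with (c * (F y - F x))%C by ring. rewrite A. ring.
Qed.

Lemma deriv_along_minus F G x l m :
  deriv_along e F x l -> deriv_along e G x m ->
  deriv_along e (fun y => (F y - G y)%C) x (l - m).
Proof.
  intros HF HG.
  destruct (deriv_along_plus F (fun y => (- (1) * G y)%C) x l (- (1) * m) HF
              (deriv_along_scal _ _ _ _ HG)) as (q & Hq & Hl & E).
  exists q. split; [assumption|split].
  - rewrite Hl. ring.
  - revert E. apply filter_imp. intros y A. rewrite <- A. ring.
Qed.

Lemma deriv_along_inv F x l :
  continuous e x -> deriv_along e F x l -> F x <> 0%C ->
  deriv_along e (fun y => (/ F y)%C) x (- l / (F x * F x)).
Proof.
  intros He HF H0.
  assert (HFc := deriv_along_continuous F x l He HF).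
  destruct HF as (q & Hq & <- & E).
  exists (fun y => (- q y / (F x * F y))%C).
  split; [|split; [easy|]].
  - apply continuous_Cdiv; [now apply continuous_Copp| |now apply Cmult_neq_0].
    apply continuous_Cmult; [apply continuous_const|assumption].
  - generalize (filter_and _ _ E (locally_neq_0 F x HFc H0)).
    apply filter_imp. intros y [A B].
    replace (/ F y - / F x)%C with (- (F y - F x) / (F x * F y))%C by (field; now split).
    rewrite A. field. now split.
Qed.

Lemma deriv_along_div F G x l m :
  continuous e x -> deriv_along e F x l -> deriv_along e G x m -> G x <> 0%C ->
  deriv_along e (fun y => (F y / G y)%C) x ((l * G x - F x * m) / (G x * G x)).
Proof.
  intros He HF HG H0.
  replace ((l * G x - F x * m) / (G x * G x))%C
    with (l * / G x + F x * (- m / (G x * G x)))%C by (field; assumption).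
  apply deriv_along_mult; try assumption. now apply deriv_along_inv.
Qed.

Lemma deriv_along_comp F (P : C -> C) x l m :
  continuous e x -> deriv_along e F x l -> Cderiv P (F x) m ->
  deriv_along e (fun y => P (F y)) x (m * l).
Proof.
  intros He HF HP.
  assert (HFc := deriv_along_continuous F x l He HF).
  destruct HF as (q & Hq & <- & E), HP as (r & Hr & <- & E').
  exists (fun y => (r (F y) * q y)%C).
  split; [|split; [easy|]].
  - apply continuous_Cmult; [|assumption].
    now apply (continuous_comp F r).
  - generalize (filter_and _ _ E (HFc _ E')). unfold filtermap.
    apply filter_imp. intros y [A B]. rewrite B, A. ring.
Qed.

Lemma deriv_along_ext_loc F G x l :
  locally x (fun y => F y = G y) -> deriv_along e F x l -> deriv_along e G x l.
Proof.
  intros EL (q & Hq & <- & E). exists q. split; [assumption|split; [easy|]].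
  generalize (filter_and _ _ EL E). apply filter_imp. intros y [A B].
  rewrite <- A, <- (locally_singleton _ _ EL). assumption.
Qed.

End DerivRules.

Lemma continuous_RtoC_id (t : R) : continuous RtoC t.
Proof. apply (continuous_RtoC (fun t => t)). apply continuous_id. Qed.

Lemma deriv_along_eq {U : UniformSpace} (e F : U -> C) x (l m : C) :
  deriv_along e F x l -> l = m -> deriv_along e F x m.
Proof. now intros H <-. Qed.

(** * Neighbourhoods, curves and polar coordinates *)

Lemma locally_Cmod_lt (z : C) (S : R) :
  Cmod z < S -> locally (T := C_UniformSpace) z (fun w => Cmod w < S).
Proof.
  intros Hz.
  apply (continuous_Cmod (U := C_UniformSpace) (fun w => w) z (continuous_id z)
           (fun r => r < S)).
  now apply open_lt.
Qed.

Lemma continuous_C_small {U : UniformSpace} (F : U -> C) x (eps : R) :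
  continuous F x -> 0 < eps -> locally x (fun y => Cmod (F y - F x) < eps).
Proof.
  intros HF He.
  assert (H : continuous (fun y => Cmod (F y - F x)) x).
  { apply continuous_Cmod, continuous_Cminus; [assumption|apply continuous_const]. }
  apply (H (fun r => r < eps)). apply open_lt.
  replace (F x - F x)%C with (RtoC 0) by ring. now rewrite Cmod_0.
Qed.

Lemma locally_C_ball (z : C) (P : C -> Prop) :
  locally (T := C_UniformSpace) z P ->
  exists d, 0 < d /\ forall w, Cmod (w - z) < d -> P w.
Proof.
  intros H. apply locally_C in H. destruct H as [d Hd].
  exists d. split; [apply cond_pos|]. intros w Hw. apply Hd. exact Hw.
Qed.

Lemma locally_of_C_ball (z : C) (P : C -> Prop) (d : R) :
  0 < d -> (forall w, Cmod (w - z) < d -> P w) -> locally (T := C_UniformSpace) z P.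
Proof.
  intros Hd H. apply locally_C. exists (mkposreal d Hd). intros w Hw. apply H. exact Hw.
Qed.

Lemma continuous_C_eps (F : C -> C) (z : C) :
  (forall eps, 0 < eps -> exists d, 0 < d /\
     forall w, Cmod (w - z) < d -> Cmod (F w - F z) < eps) ->
  continuous F z.
Proof.
  intros H P HP. apply locally_C_ball in HP. destruct HP as (eps & He & HP).
  destruct (H eps He) as (d & Hd & Hw).
  apply (locally_of_C_ball z _ d Hd). intros w Hwd. apply HP, Hw, Hwd.
Qed.

Lemma is_derive_difference_quotient (a : R -> R) (t l : R) :
  is_derive a t l ->
  exists q : R -> R, continuous q t /\ q t = l /\
    forall s, a s - a t = (s - t) * q s.
Proof.
  intros Ha.
  exists (fun s => if Req_EM_T s t then l else (a s - a t) / (s - t)).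
  split; [|split].
  - apply is_derive_Reals in Ha. apply continuity_pt_filterlim.
    intros eps He. destruct (Ha eps He) as [d Hd].
    exists d. split; [apply cond_pos|]. intros s [_ Hs]. simpl in *. unfold R_dist in *.
    destruct (Req_EM_T t t) as [_|C]; [|easy].
    destruct (Req_EM_T s t) as [->|Hst].
    + now rewrite Rminus_diag, Rabs_R0.
    + specialize (Hd (s - t)). replace (t + (s - t)) with s in Hd by ring.
      apply Hd; [lra|exact Hs].
  - destruct (Req_EM_T t t); [easy|lra].
  - intros s. destruct (Req_EM_T s t) as [->|Hst]; [ring|field; lra].
Qed.

Lemma is_derive_eq (a : R -> R) (t l m : R) : l = m -> is_derive a t l -> is_derive a t m.
Proof. now intros <-. Qed.

Lemma curve_deriv_pair (a b : R -> R) (t la lb : R) :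
  is_derive a t la -> is_derive b t lb ->
  curve_deriv (fun s => (a s, b s) : C) t ((la, lb) : C).
Proof.
  intros Ha Hb.
  destruct (is_derive_difference_quotient a t la Ha) as (q & Hq & <- & E).
  destruct (is_derive_difference_quotient b t lb Hb) as (r & Hr & <- & E').
  exists (fun s => (q s, r s) : C).
  split; [now apply continuous_C_pair|split; [easy|]].
  apply filter_forall. intros s. unfold Cminus, Cplus, Copp, Cmult, RtoC. simpl.
  f_equal.
  - replace (a s + - a t) with (a s - a t) by ring. rewrite E. ring.
  - replace (b s + - b t) with (b s - b t) by ring. rewrite E'. ring.
Qed.

Lemma is_derive_of_difference_quotient (a q : R -> R) (t : R) :
  continuous q t -> locally t (fun s => a s - a t = (s - t) * q s) ->
  is_derive a t (q t).
Proof.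
  intros Hq [d Hd]. apply is_derive_Reals. intros eps He.
  apply continuity_pt_filterlim in Hq. destruct (Hq eps He) as (d' & Hd' & H).
  assert (Hm : 0 < Rmin d d') by (apply Rmin_pos; [apply cond_pos|exact Hd']).
  exists (mkposreal _ Hm). simpl. intros h Hh Hhd.
  replace (a (t + h) - a t) with (h * q (t + h)).
  - replace (h * q (t + h) / h) with (q (t + h)) by (field; exact Hh).
    apply (H (t + h)). simpl. unfold D_x, no_cond, R_dist.
    replace (t + h - t) with h by ring.
    repeat split; [lra|]. apply Rlt_le_trans with (1 := Hhd), Rmin_r.
  - rewrite (Hd (t + h)); [ring|].
    change (Rabs ((t + h) - t) < d). replace (t + h - t) with h by ring.
    apply Rlt_le_trans with (1 := Hhd), Rmin_l.
Qed.

Lemma curve_deriv_Re (g : R -> C) (t : R) (l : C) :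
  curve_deriv g t l -> is_derive (fun s => Re (g s)) t (Re l).
Proof.
  intros (q & Hq & <- & E).
  apply (is_derive_of_difference_quotient _ (fun s => Re (q s))); [now apply continuous_Re|].
  revert E. apply filter_imp. intros s Es.
  apply (f_equal Re) in Es. revert Es. unfold Re, Cminus, Cplus, Copp, Cmult, RtoC. simpl.
  intros Es. transitivity (fst (g s) + - fst (g t)); [ring|rewrite Es; ring].
Qed.

Lemma curve_deriv_Im (g : R -> C) (t : R) (l : C) :
  curve_deriv g t l -> is_derive (fun s => Im (g s)) t (Im l).
Proof.
  intros (q & Hq & <- & E).
  apply (is_derive_of_difference_quotient _ (fun s => Im (q s))); [now apply continuous_Im|].
  revert E. apply filter_imp. intros s Es.
  apply (f_equal Im) in Es. revert Es. unfold Im, Cminus, Cplus, Copp, Cmult, RtoC. simpl.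
  intros Es. transitivity (snd (g s) + - snd (g t)); [ring|rewrite Es; ring].
Qed.

Lemma Cmod2_alt' (z : C) : Cmod z ^ 2 = fst z ^ 2 + snd z ^ 2.
Proof. exact (Cmod2_alt z). Qed.

Lemma curve_deriv_ln_Cmod (g : R -> C) (t : R) (l : C) :
  curve_deriv g t l -> g t <> 0%C ->
  is_derive (fun s => ln (Cmod (g s))) t (Re (l / g t)).
Proof.
  intros Hg H0.
  assert (Hc : continuous g t)
    by (apply (deriv_along_continuous RtoC g t l); [apply continuous_RtoC_id|exact Hg]).
  apply (is_derive_ext_loc (fun s => / 2 * ln (Re (g s) ^ 2 + Im (g s) ^ 2))).
  - generalize (locally_neq_0 g t Hc H0). apply filter_imp. intros s Hs.
    rewrite <- Cmod2_alt. apply Cmod_gt_0 in Hs.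
    replace (Cmod (g s) ^ 2) with (Cmod (g s) * Cmod (g s)) by ring.
    rewrite ln_mult by assumption. change (/ 2 * (ln (Cmod (g s)) + ln (Cmod (g s))) = ln (Cmod (g s))).
    field.
  - assert (HR := curve_deriv_Re g t l Hg). assert (HI := curve_deriv_Im g t l Hg).
    assert (Hp : 0 < Re (g t) ^ 2 + Im (g t) ^ 2).
    { rewrite <- Cmod2_alt. apply pow_lt. now apply Cmod_gt_0. }
    assert (Q : forall a b : R -> R, is_derive a t (Re l) -> is_derive b t (Im l) ->
       0 < a t ^ 2 + b t ^ 2 ->
       is_derive (fun s => / 2 * ln (a s ^ 2 + b s ^ 2)) t
         (Re l * (a t / (a t ^ 2 + b t ^ 2)) + Im l * (b t / (a t ^ 2 + b t ^ 2)))).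
    { clear. intros a b Ha Hb Hp. auto_derive.
      - repeat split; [eexists; exact Ha|eexists; exact Hb|].
        replace (a t * (a t * 1) + b t * (b t * 1)) with (a t ^ 2 + b t ^ 2) by ring.
        exact Hp.
      - assert (Da := is_derive_unique a t _ Ha). assert (Db := is_derive_unique b t _ Hb).
        change (Derive (fun x => a x) t) with (Derive a t). change (Derive (fun x => b x) t) with (Derive b t). rewrite Da, Db.
        field. revert Hp. simpl. lra. }
    apply (fun E => is_derive_eq _ _ _ _ E (Q _ _ HR HI Hp)).
    destruct (g t) as [x y], l as [u v].
    revert Hp. unfold Re, Im, Cdiv, Cmult, Cinv. simpl. intros Hp. field. lra.
Qed.

Definition cis (th : R) : C := (cos th, sin th).

Lemma Cmod_cis th : Cmod (cis th) = 1.
Proof.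
  unfold Cmod, cis. simpl.
  replace (cos th * (cos th * 1) + sin th * (sin th * 1)) with 1; [apply sqrt_1|].
  generalize (sin2_cos2 th). unfold Rsqr. lra.
Qed.

Lemma cis_0 : cis 0 = 1%C.
Proof. unfold cis. now rewrite cos_0, sin_0. Qed.

Lemma cis_2PI : cis (2 * PI) = cis 0.
Proof. unfold cis. now rewrite cos_2PI, sin_2PI, cos_0, sin_0. Qed.

Lemma curve_deriv_cis th : curve_deriv cis th (Ci * cis th).
Proof.
  replace (Ci * cis th)%C with ((- sin th, cos th) : C).
  - apply curve_deriv_pair; [apply is_derive_cos|apply is_derive_sin].
  - unfold Ci, cis, Cmult. simpl. f_equal; ring.
Qed.

Lemma continuous_cis th : continuous cis th.
Proof. apply continuous_C_pair; [apply continuous_cos|apply continuous_sin]. Qed.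

(** * Integrals over a circle that depend on a parameter *)

Section ParametricIntegral.
Variables (P Pt : R -> R -> R) (a b : R).
Hypothesis P_deriv : forall t th, a < t < b -> is_derive (fun u => P u th) t (Pt t th).
Hypothesis P_cont : forall t th, a < t < b -> continuous (P t) th.
Hypothesis Pt_cont : forall t th, a < t < b ->
  continuous (fun p : R * R => Pt (fst p) (snd p)) (t, th).

Lemma locally_open_interval t : a < t < b -> locally t (fun u => a < u < b).
Proof.
  intros Ht. apply filter_and; [apply (open_gt a t)|apply (open_lt b t)]; apply Ht.
Qed.

Lemma is_derive_circle_integral t :
  a < t < b ->
  is_derive (fun u => RInt (P u) 0 (2 * PI)) t (RInt (Pt t) 0 (2 * PI)).
Proof.
  intros Ht.
  replace (RInt (Pt t) 0 (2 * PI))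
    with (RInt (fun th => Derive (fun u => P u th) t) 0 (2 * PI)).
  - apply (is_derive_RInt_param P 0 (2 * PI) t).
    + generalize (locally_open_interval t Ht). apply filter_imp. intros u Hu th _.
      eexists. now apply P_deriv.
    + intros th _. apply (continuity_2d_pt_ext_loc Pt).
      * destruct (locally_open_interval t Ht) as [d Hd].
        exists d. intros u v Hu _. symmetry. apply is_derive_unique, P_deriv, Hd, Hu.
      * apply continuity_2d_pt_filterlim. now apply Pt_cont.
    + generalize (locally_open_interval t Ht). apply filter_imp. intros u Hu.
      apply (ex_RInt_continuous (V := R_CompleteNormedModule)). intros th _. now apply P_cont.
  - apply RInt_ext. intros th _. now apply is_derive_unique, P_deriv.
Qed.

(** The velocity of the integral is the integral of a derivative over a period,
    hence zero. *)
Lemma circle_integral_deformation :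
  (forall t, a < t < b -> exists V : R -> R,
      (forall th, is_derive V th (Pt t th)) /\ V (2 * PI) = V 0) ->
  forall t1 t2, a < t1 < b -> a < t2 < b ->
  RInt (P t1) 0 (2 * PI) = RInt (P t2) 0 (2 * PI).
Proof.
  intros HV t1 t2 H1 H2.
  assert (H0 : forall t, a < t < b -> is_derive (fun u => RInt (P u) 0 (2 * PI)) t 0).
  { intros t Ht. apply (fun E => is_derive_eq _ _ _ _ E (is_derive_circle_integral t Ht)).
    destruct (HV t Ht) as (V & HVd & HVp).
    rewrite (RInt_ext (Pt t) (Derive V)).
    - rewrite RInt_Derive; [lra| |].
      + intros x _. eexists. apply HVd.
      + intros x _. apply (continuous_ext (Pt t)).
        * intros y. symmetry. apply is_derive_unique, HVd.
        * apply (continuous_comp_2 (fun _ => t) (fun y => y) Pt);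
            [apply continuous_const|apply continuous_id|now apply Pt_cont].
    - intros x _. symmetry. apply is_derive_unique, HVd. }
  assert (Hin : forall x, Rmin t1 t2 <= x <= Rmax t1 t2 -> a < x < b).
  { intros x. unfold Rmin, Rmax. destruct (Rle_dec t1 t2); lra. }
  destruct (MVT_gen (fun u => RInt (P u) 0 (2 * PI)) t1 t2 (fun _ => 0)) as (c & _ & E).
  - intros x Hx. apply H0, Hin. lra.
  - intros x Hx. apply continuity_pt_filterlim.
    apply (ex_derive_continuous (V := R_NormedModule) (fun u => RInt (P u) 0 (2 * PI))).
    exists 0. apply H0, Hin, Hx.
  - lra.
Qed.

End ParametricIntegral.

(** * Cauchy's and Poisson's integral formulas *)

Definition circ (s th : R) : C := (RtoC s * cis th)%C.

Lemma Cmod_circ s th : 0 <= s -> Cmod (circ s th) = s.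
Proof.
  intros Hs. unfold circ. rewrite Cmod_mult, Cmod_cis, Cmod_R, Rabs_pos_eq; lra.
Qed.

Lemma curve_deriv_circ s th : curve_deriv (circ s) th (Ci * circ s th).
Proof.
  apply (deriv_along_eq _ _ _ (RtoC s * (Ci * cis th))%C).
  - apply deriv_along_scal, curve_deriv_cis.
  - unfold circ. cring.
Qed.

Lemma circ_2PI s : circ s (2 * PI) = circ s 0.
Proof. unfold circ. now rewrite cis_2PI. Qed.

Lemma continuous_circ s th : continuous (circ s) th.
Proof. apply continuous_Cmult; [apply continuous_const|apply continuous_cis]. Qed.

Lemma circ_minus_neq_0 (s th : R) (z : C) : Cmod z < s -> (circ s th - z)%C <> 0%C.
Proof.
  intros Hz E. assert (H := Cmod_ge_0 z).
  assert (E' : circ s th = z) by (replace z with (z + 0)%C by ring; rewrite <- E; ring).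
  assert (Hs : 0 <= s) by lra. rewrite <- E', Cmod_circ in Hz; lra.
Qed.

Lemma curve_deriv_Re_eq (g : R -> C) (t : R) (l : C) (r : R) :
  curve_deriv g t l -> Re l = r -> is_derive (fun s => Re (g s)) t r.
Proof. intros H <-. now apply curve_deriv_Re. Qed.

Lemma curve_deriv_Im_eq (g : R -> C) (t : R) (l : C) (r : R) :
  curve_deriv g t l -> Im l = r -> is_derive (fun s => Im (g s)) t r.
Proof. intros H <-. now apply curve_deriv_Im. Qed.

Lemma RInt_circle_const (c : R) : RInt (fun _ => c) 0 (2 * PI) = 2 * PI * c.
Proof. rewrite RInt_const. unfold scal. simpl. unfold mult. simpl. ring. Qed.

Lemma Cmod_RtoC_mult (t : R) (z : C) : Cmod (RtoC t * z) = Rabs t * Cmod z.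
Proof. now rewrite Cmod_mult, Cmod_R. Qed.

Lemma continuous_snd_along (F : R -> C) (p : R * R) :
  continuous F (snd p) -> continuous (fun q : R * R => F (snd q)) p.
Proof.
  intros HF. apply (continuous_comp snd F); [|assumption].
  destruct p. apply continuous_snd.
Qed.

Lemma continuous_fst_along (F : R -> C) (p : R * R) :
  continuous F (fst p) -> continuous (fun q : R * R => F (fst q)) p.
Proof.
  intros HF. apply (continuous_comp fst F); [|assumption].
  destruct p. apply continuous_fst.
Qed.

(** The pole is moved from [z0] to the origin, where the kernel is constant. *)
Lemma cauchy_kernel_integral (s : R) (z0 c : C) :
  Cmod z0 < s ->
  RInt (fun th => Re (c * (circ s th / (circ s th - z0)))) 0 (2 * PI) = 2 * PI * Re c.
Proof.
  intros Hz0. assert (Hm := Cmod_ge_0 z0).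
  (* The pole [u * z0] stays inside the circle for [u] in an open interval
     that contains both [0] and [1]. *)
  set (b := 2 * s / (s + Cmod z0)).
  assert (Hb1 : 1 < b).
  { unfold b. apply (Rmult_lt_reg_r (s + Cmod z0)); [lra|].
    replace (2 * s / (s + Cmod z0) * (s + Cmod z0)) with (2 * s) by (field; lra). lra. }
  assert (Hb : b * Cmod z0 < s).
  { unfold b. apply (Rmult_lt_reg_r (s + Cmod z0)); [lra|].
    replace (2 * s / (s + Cmod z0) * Cmod z0 * (s + Cmod z0)) with (2 * s * Cmod z0)
      by (field; lra). nra. }
  assert (Hu : forall u, - 1 < u < b -> Cmod (RtoC u * z0) < s).
  { intros u Hu. rewrite Cmod_RtoC_mult.
    apply Rle_lt_trans with (2 := Hb). apply Rmult_le_compat_r; [assumption|].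
    apply Rabs_le. lra. }
  assert (Hn : forall u th, - 1 < u < b -> (circ s th - RtoC u * z0)%C <> 0%C).
  { intros u th H. now apply circ_minus_neq_0, Hu. }
  pose (P := fun u th => Re (c * (circ s th / (circ s th - RtoC u * z0)))).
  pose (Pt := fun u th => Re (c * (circ s th * z0
      / ((circ s th - RtoC u * z0) * (circ s th - RtoC u * z0))))).
  transitivity (RInt (P 1) 0 (2 * PI)); [|transitivity (RInt (P 0) 0 (2 * PI))].
  - apply RInt_ext. intros th _. unfold P. f_equal. f_equal. f_equal. f_equal. cring.
  - apply (circle_integral_deformation P Pt (-1) b); try lra.
    + intros u th H. unfold P, Pt.
      eapply curve_deriv_Re_eq.
      * apply deriv_along_scal. apply deriv_along_div; [apply continuous_RtoC_id| | |now apply Hn].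
        -- apply deriv_along_const.
        -- apply deriv_along_minus; [apply deriv_along_const|].
           apply deriv_along_mult; [apply continuous_RtoC_id|apply deriv_along_embedding|
             apply deriv_along_const].
      * f_equal. cfield. now apply Hn.
    + intros u th H. unfold P. apply continuous_Re.
      apply continuous_Cmult; [apply continuous_const|].
      apply continuous_Cdiv; [apply continuous_circ| |now apply Hn].
      apply continuous_Cminus; [apply continuous_circ|apply continuous_const].
    + intros u th H. unfold Pt. apply continuous_Re.
      assert (Hc : continuous (fun p : R * R => circ s (snd p)) (u, th))
        by apply continuous_snd_along, continuous_circ.
      assert (Hd : continuous (fun p : R * R => circ s (snd p) - RtoC (fst p) * z0)%C (u, th)).
      { apply continuous_Cminus; [exact Hc|].
        apply continuous_Cmult; [apply continuous_fst_along, continuous_RtoC_id|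
          apply continuous_const]. }
      apply continuous_Cmult; [apply continuous_const|].
      apply continuous_Cdiv.
      * apply continuous_Cmult; [exact Hc|apply continuous_const].
      * now apply continuous_Cmult.
      * apply Cmult_neq_0; now apply Hn.
    + intros u H. exists (fun th => Re (c * (Ci * z0 / (circ s th - RtoC u * z0)))). split.
      * intros th. unfold Pt. eapply curve_deriv_Re_eq.
        -- apply deriv_along_scal. apply deriv_along_div; [apply continuous_RtoC_id| | |now apply Hn].
           ++ apply deriv_along_const.
           ++ apply deriv_along_minus; [apply curve_deriv_circ|apply deriv_along_const].
        -- f_equal.
           transitivity (c * (- (Ci * Ci) * (circ s th * z0) /
              ((circ s th - RtoC u * z0) * (circ s th - RtoC u * z0))))%C.
           ++ cfield. now apply Hn.
           ++ replace (- (Ci * Ci))%C with (RtoC 1).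
              ** cfield. now apply Hn.
              ** unfold Ci, RtoC, Copp, Cmult. simpl. f_equal; ring.
      * now rewrite circ_2PI.
  - rewrite <- (RInt_circle_const (Re c)). apply RInt_ext. intros th _. unfold P. f_equal.
    field. intros E. apply (Hn 0 th); [lra|]. rewrite E. cring.
Qed.

Definition hol_at (F F1 : C -> C) (z : C) : Prop := Cderiv F z (F1 z) /\ continuous F1 z.

Lemma hol_at_continuous F F1 z : hol_at F F1 z -> continuous F z.
Proof.
  intros [H _]. apply (deriv_along_continuous (U := C_UniformSpace) (fun z => z) F z (F1 z));
    [apply continuous_id|exact H].
Qed.

Lemma Re_mult_Ci (w : C) : Im (Ci * w) = Re w.
Proof. destruct w. unfold Ci, Cmult, Im, Re. simpl. ring. Qed.

Lemma Re_minus a b : Re (a - b) = Re a - Re b.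
Proof. reflexivity. Qed.

Lemma Re_le_Cmod z : Re z <= Cmod z.
Proof. apply Rle_trans with (2 := re_le_Cmod z), Rle_abs. Qed.

(** The circle is shrunk to [z0] by homotheties. In the limit only the value at
    [z0] remains, so that continuity there is enough: this also covers
    quotients whose singularity at [z0] is removable. *)
Lemma cauchy_formula (F F1 : C -> C) (S s : R) (z0 : C) :
  Cmod z0 < s -> s < S ->
  (forall z, Cmod z < S -> z <> z0 -> hol_at F F1 z) -> continuous F z0 ->
  RInt (fun th => Re (F (circ s th) * (circ s th / (circ s th - z0)))) 0 (2 * PI)
  = 2 * PI * Re (F z0).
Proof.
  intros Hz0 HsS HF HF0. assert (Hm := Cmod_ge_0 z0).
  (* Homotheties of ratio up to [b > 1] keep the circle in the disk of radius
     [S], so that the full circle is interior to the deformation. *)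
  set (b := (S / s + 1) / 2).
  assert (Hb1 : 1 < b).
  { assert (1 < S / s) by (apply (Rmult_lt_reg_r s); [lra|]; field_simplify; lra).
    unfold b. lra. }
  assert (Hb : 2 * b * s - s = S) by (unfold b; field; lra).
  pose (path := fun (u th : R) => (z0 + RtoC u * (circ s th - z0))%C).
  assert (Hne : forall th, (circ s th - z0)%C <> 0%C)
    by (intros th; now apply circ_minus_neq_0).
  assert (Hpath : forall u th, 0 < u < b -> hol_at F F1 (path u th)).
  { intros u th Hu. apply HF.
    - assert (A : Cmod (path u th) <= Rabs (1 - u) * Cmod z0 + u * s).
      { replace (path u th) with (RtoC (1 - u) * z0 + RtoC u * circ s th)%C
          by (unfold path; rewrite RtoC_minus; ring).
        apply Rle_trans with (1 := Cmod_triangle _ _).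
        rewrite !Cmod_RtoC_mult, Cmod_circ by lra. rewrite (Rabs_pos_eq u) by lra. lra. }
      apply Rle_lt_trans with (1 := A). unfold Rabs.
      destruct (Rcase_abs (1 - u)); nra.
    - unfold path. intros E. apply (Cmult_neq_0 (RtoC u) (circ s th - z0)); [|apply Hne|].
      + intros E'. apply RtoC_inj in E'. lra.
      + transitivity (z0 + RtoC u * (circ s th - z0) - z0)%C; [ring|rewrite E; ring]. }
  pose (K := fun th => (circ s th / (circ s th - z0))%C).
  assert (HKc : forall th, continuous K th).
  { intros th. apply continuous_Cdiv; [apply continuous_circ| |apply Hne].
    apply continuous_Cminus; [apply continuous_circ|apply continuous_const]. }
  pose (P := fun u th => Re (F (path u th) * K th)).
  pose (Pt := fun u th => Re (F1 (path u th) * circ s th)).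
  assert (HPc : forall u th, 0 < u < b -> continuous (P u) th).
  { intros u th Hu. apply continuous_Re, continuous_Cmult; [|apply HKc].
    apply (continuous_comp (path u) F).
    - unfold path. apply continuous_Cplus; [apply continuous_const|].
      apply continuous_Cmult; [apply continuous_const|].
      apply continuous_Cminus; [apply continuous_circ|apply continuous_const].
    - now apply (hol_at_continuous F F1), Hpath. }
  assert (Hdef : forall u, 0 < u < b -> RInt (P u) 0 (2 * PI) = RInt (P 1) 0 (2 * PI)).
  { intros u0 Hu0. apply (circle_integral_deformation P Pt 0 b); try lra; try assumption.
    - intros u th Hu. unfold P, Pt. eapply curve_deriv_Re_eq.
      + apply deriv_along_mult; [apply continuous_RtoC_id| |apply deriv_along_const].
        apply (deriv_along_comp RtoC (fun u => path u th)); [apply continuous_RtoC_id| |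
          apply Hpath, Hu].
        unfold path. apply deriv_along_plus; [apply deriv_along_const|].
        apply deriv_along_mult; [apply continuous_RtoC_id|apply deriv_along_embedding|
          apply deriv_along_const].
      + f_equal. unfold K. cfield. apply Hne.
    - intros u th Hu. unfold Pt. apply continuous_Re.
      assert (Hc : continuous (fun p : R * R => circ s (snd p)) (u, th))
        by apply continuous_snd_along, continuous_circ.
      apply continuous_Cmult; [|exact Hc].
      apply (continuous_comp (fun p : R * R => path (fst p) (snd p)) F1); [|apply Hpath, Hu].
      unfold path. apply continuous_Cplus; [apply continuous_const|].
      apply continuous_Cmult; [apply continuous_fst_along, continuous_RtoC_id|].
      apply continuous_Cminus; [exact Hc|apply continuous_const].
    - intros u Hu. exists (fun th => Im (RtoC (/ u) * F (path u th))). split.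
      + intros th. unfold Pt.
        apply (curve_deriv_Im_eq _ _ (RtoC (/ u) * (F1 (path u th) * (RtoC u * (Ci * circ s th))))%C).
        * apply deriv_along_scal.
          apply (deriv_along_comp RtoC (path u)); [apply continuous_RtoC_id| |
            apply Hpath, Hu].
          unfold path.
          apply (deriv_along_eq _ _ _ (0 + RtoC u * (Ci * circ s th - 0))%C); [|cring].
          apply deriv_along_plus; [apply deriv_along_const|].
          apply deriv_along_scal.
          apply deriv_along_minus; [apply curve_deriv_circ|apply deriv_along_const].
        * rewrite <- (Re_mult_Ci (F1 (path u th) * circ s th)). f_equal.
          rewrite RtoC_inv by lra. cfield. intros E. apply RtoC_inj in E. lra.
      + unfold path. now rewrite circ_2PI. }
  transitivity (RInt (P 1) 0 (2 * PI)).
  { apply RInt_ext. intros th _. unfold P, K. f_equal. f_equal. f_equal. unfold path. cring. }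
  rewrite <- (cauchy_kernel_integral s z0 (F z0) Hz0). change (RInt (P 1) 0 (2 * PI) = RInt (fun th => Re (F z0 * K th)) 0 (2 * PI)).
  set (B := s / (s - Cmod z0)).
  assert (HB0 : 0 < B) by (apply Rdiv_lt_0_compat; lra).
  assert (HB : forall th, Cmod (K th) <= B).
  { intros th. unfold K. rewrite Cmod_div, Cmod_circ by (try apply Hne; lra). unfold B.
    apply Rmult_le_compat_l; [lra|]. apply Rinv_le_contravar; [lra|].
    assert (T := Cmod_triangle (circ s th - z0) z0).
    replace (circ s th - z0 + z0)%C with (circ s th) in T by cring.
    rewrite Cmod_circ in T; lra. }
  assert (HPI := PI_RGT_0).
  apply Rminus_diag_uniq, Rabs_eq_0.
  destruct (Rle_lt_or_eq_dec 0 (Rabs (RInt (P 1) 0 (2 * PI) - RInt (fun th => Re (F z0 * K th)) 0 (2 * PI))) (Rabs_pos _)) as [Hpos|]; [exfalso|easy].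
  set (D := Rabs _) in Hpos.
  set (eps := D / (4 * PI * B)).
  assert (Heps : 0 < eps) by (apply Rdiv_lt_0_compat; nra).
  destruct (locally_C_ball z0 _ (continuous_C_small F z0 eps HF0 Heps)) as (d & Hd & Hsm).
  set (u := Rmin 1 (d / (4 * s))).
  assert (Hu : 0 < u <= 1).
  { unfold u. split; [apply Rmin_pos; [lra|apply Rdiv_lt_0_compat; lra]|apply Rmin_l]. }
  assert (Hud : u * (2 * s) < d).
  { assert (u <= d / (4 * s)) by apply Rmin_r.
    apply Rle_lt_trans with (d / (4 * s) * (2 * s)); [nra|].
    replace (d / (4 * s) * (2 * s)) with (d / 2) by (field; lra). lra. }
  assert (HI0 : ex_RInt (fun th => Re (F z0 * K th)) 0 (2 * PI)).
  { apply (ex_RInt_continuous (V := R_CompleteNormedModule)). intros th _.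
    apply continuous_Re, continuous_Cmult; [apply continuous_const|apply HKc]. }
  assert (HI1 : ex_RInt (P u) 0 (2 * PI)).
  { apply (ex_RInt_continuous (V := R_CompleteNormedModule)). intros th _. apply HPc. lra. }
  assert (Hle : D <= (2 * PI - 0) * (eps * B)).
  { unfold D. rewrite <- (Hdef u) by lra.
    rewrite <- (RInt_minus (V := R_CompleteNormedModule)) by assumption.
    apply (abs_RInt_le_const); [lra| |].
    - now apply (ex_RInt_minus (V := R_NormedModule)).
    - intros th _. unfold P.
      change (Rabs (Re (F (path u th) * K th) - Re (F z0 * K th)) <= eps * B).
      rewrite <- Re_minus.
      replace (F (path u th) * K th - F z0 * K th)%C with ((F (path u th) - F z0) * K th)%C by cring.
      apply Rle_trans with (1 := re_le_Cmod _). rewrite Cmod_mult.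
      apply Rmult_le_compat; try apply Cmod_ge_0; [|apply HB].
      left. apply Hsm. unfold path.
      replace (z0 + RtoC u * (circ s th - z0) - z0)%C with (RtoC u * (circ s th - z0))%C by cring.
      rewrite Cmod_RtoC_mult, Rabs_pos_eq by lra.
      apply Rle_lt_trans with (2 := Hud). apply Rmult_le_compat_l; [lra|].
      unfold Cminus. apply Rle_trans with (1 := Cmod_triangle _ _).
      rewrite Cmod_circ, Cmod_opp; lra. }
  replace ((2 * PI - 0) * (eps * B)) with (D / 2) in Hle by (unfold eps; field; lra).
  lra.
Qed.

(** * Rules for holomorphic functions, mean values and the Schwarz lemma *)

Lemma hol_at_const (c z : C) : hol_at (fun _ => c) (fun _ => 0%C) z.
Proof. split; [apply deriv_along_const|apply continuous_const]. Qed.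

Lemma hol_at_id (z : C) : hol_at (fun w => w) (fun _ => 1%C) z.
Proof.
  split; [|apply continuous_const].
  apply (deriv_along_embedding (U := C_UniformSpace) (fun w => w)).
Qed.

Lemma hol_at_plus F F1 G G1 z :
  hol_at F F1 z -> hol_at G G1 z ->
  hol_at (fun w => F w + G w)%C (fun w => F1 w + G1 w)%C z.
Proof.
  intros [HF HF1] [HG HG1]. split; [now apply deriv_along_plus|now apply continuous_Cplus].
Qed.

Lemma hol_at_minus F F1 G G1 z :
  hol_at F F1 z -> hol_at G G1 z ->
  hol_at (fun w => F w - G w)%C (fun w => F1 w - G1 w)%C z.
Proof.
  intros [HF HF1] [HG HG1]. split; [now apply deriv_along_minus|now apply continuous_Cminus].
Qed.

Lemma hol_at_scal c F F1 z :
  hol_at F F1 z -> hol_at (fun w => c * F w)%C (fun w => c * F1 w)%C z.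
Proof.
  intros [HF HF1]. split; [now apply deriv_along_scal|].
  apply continuous_Cmult; [apply continuous_const|assumption].
Qed.

Lemma hol_at_mult F F1 G G1 z :
  hol_at F F1 z -> hol_at G G1 z ->
  hol_at (fun w => F w * G w)%C (fun w => F1 w * G w + F w * G1 w)%C z.
Proof.
  intros HF HG.
  assert (HFc := hol_at_continuous _ _ _ HF). assert (HGc := hol_at_continuous _ _ _ HG).
  destruct HF as [HF HF1], HG as [HG HG1]. split.
  - apply deriv_along_mult; try assumption. apply continuous_id.
  - apply continuous_Cplus; now apply continuous_Cmult.
Qed.

Lemma hol_at_div F F1 G G1 z :
  hol_at F F1 z -> hol_at G G1 z -> G z <> 0%C ->
  hol_at (fun w => F w / G w)%C
    (fun w => (F1 w * G w - F w * G1 w) / (G w * G w))%C z.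
Proof.
  intros HF HG H0.
  assert (HFc := hol_at_continuous _ _ _ HF). assert (HGc := hol_at_continuous _ _ _ HG).
  destruct HF as [HF HF1], HG as [HG HG1]. split.
  - apply deriv_along_div; try assumption. apply continuous_id.
  - apply continuous_Cdiv; [|now apply continuous_Cmult|now apply Cmult_neq_0].
    apply continuous_Cminus; now apply continuous_Cmult.
Qed.

Lemma hol_at_comp F F1 T T1 z :
  hol_at T T1 z -> hol_at F F1 (T z) ->
  hol_at (fun w => F (T w)) (fun w => F1 (T w) * T1 w)%C z.
Proof.
  intros HT HF. assert (HTc := hol_at_continuous _ _ _ HT).
  destruct HF as [HF HF1], HT as [HT HT1]. split.
  - apply (deriv_along_comp (U := C_UniformSpace) (fun w => w) T F);
      [apply continuous_id|assumption|assumption].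
  - apply continuous_Cmult; [|assumption]. now apply (continuous_comp T F1).
Qed.

Lemma hol_at_shift F F1 c z :
  hol_at F F1 (c + z)%C -> hol_at (fun w => F (c + w)%C) (fun w => F1 (c + w)%C) z.
Proof.
  intros H.
  destruct (hol_at_comp F F1 (fun w => c + w)%C (fun w => 0 + 1)%C z) as [A B].
  - apply hol_at_plus; [apply hol_at_const|apply hol_at_id].
  - exact H.
  - split.
    + apply (deriv_along_eq _ _ _ _ _ A). cring.
    + apply (continuous_ext (fun w => F1 (c + w) * (0 + 1))%C); [|exact B].
      intros w. cring.
Qed.

Lemma continuous_along_circ (F : C -> C) (s th : R) :
  continuous F (circ s th) -> continuous (fun th => F (circ s th)) th.
Proof. intros H. apply (continuous_comp (circ s) F); [apply continuous_circ|exact H]. Qed.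

Lemma mean_value (F F1 : C -> C) (S s : R) :
  0 < s -> s < S -> (forall z, Cmod z < S -> z <> 0%C -> hol_at F F1 z) ->
  continuous F (RtoC 0) ->
  RInt (fun th => Re (F (circ s th))) 0 (2 * PI) = 2 * PI * Re (F 0%C).
Proof.
  intros Hs HS HF HF0.
  rewrite <- (cauchy_formula F F1 S s 0); try assumption; [|now rewrite Cmod_0].
  apply RInt_ext. intros th _. f_equal.
  replace (circ s th - 0)%C with (circ s th) by ring. field.
  apply Cmod_gt_0. now rewrite Cmod_circ; lra.
Qed.

(** Reduces bounds on a modulus to bounds on a real part. *)
Lemma rotate_to_modulus (z : C) : exists c, Cmod c = 1 /\ (c * z)%C = RtoC (Cmod z).
Proof.
  destruct (Req_dec (Cmod z) 0) as [H|H].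
  - exists 1%C. split; [apply Cmod_1|]. rewrite (Cmod_eq_0 _ H), Cmod_0. ring.
  - assert (Hc : RtoC (Cmod z) <> 0%C) by (intros E; now apply RtoC_inj in E).
    exists (Cconj z / RtoC (Cmod z))%C. split.
    + rewrite Cmod_div, Cmod_conj, Cmod_R, Rabs_pos_eq by (assumption || apply Cmod_ge_0).
      now field.
    + transitivity ((z * Cconj z) / RtoC (Cmod z))%C; [now field|].
      rewrite <- Cmod2_conj, RtoC_pow. now field.
Qed.

Lemma ex_RInt_circle (h : R -> R) :
  (forall th, continuous h th) -> ex_RInt h 0 (2 * PI).
Proof.
  intros H. apply (ex_RInt_continuous (V := R_CompleteNormedModule)). intros th _. apply H.
Qed.

Lemma RInt_circle_le (g h : R -> R) :
  (forall th, continuous g th) -> (forall th, continuous h th) ->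
  (forall th, 0 <= th <= 2 * PI -> g th <= h th) -> RInt g 0 (2 * PI) <= RInt h 0 (2 * PI).
Proof.
  intros Hg Hh H. assert (HPI := PI_RGT_0).
  apply RInt_le; [lra|now apply ex_RInt_circle|now apply ex_RInt_circle|].
  intros th Hth. apply H. lra.
Qed.

Lemma mean_value_bound (F F1 : C -> C) (S s B : R) :
  0 < s -> s < S -> (forall z, Cmod z < S -> z <> 0%C -> hol_at F F1 z) ->
  continuous F (RtoC 0) ->
  (forall th, 0 <= th <= 2 * PI -> Cmod (F (circ s th)) <= B) -> Cmod (F 0%C) <= B.
Proof.
  intros Hs HS HF HF0 HB. assert (HPI := PI_RGT_0).
  destruct (rotate_to_modulus (F 0%C)) as (c & Hc & E).
  assert (A : RInt (fun th => Re (c * F (circ s th))) 0 (2 * PI) = 2 * PI * Cmod (F 0%C)).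
  { rewrite (mean_value (fun z => c * F z)%C (fun z => c * F1 z)%C S s); try assumption.
    - now rewrite E.
    - intros z Hz Hz0. now apply hol_at_scal, HF.
    - apply continuous_Cmult; [apply continuous_const|exact HF0]. }
  apply (Rmult_le_reg_l (2 * PI)); [lra|]. rewrite <- A, <- (RInt_circle_const B).
  apply RInt_circle_le.
  - intros th. apply continuous_Re, continuous_Cmult; [apply continuous_const|].
    apply continuous_along_circ, (hol_at_continuous F F1), HF.
    + rewrite Cmod_circ; lra.
    + apply Cmod_gt_0. rewrite Cmod_circ; lra.
  - intros th. apply continuous_const.
  - intros th Hth. apply Rle_trans with (1 := Re_le_Cmod _).
    rewrite Cmod_mult, Hc, Rmult_1_l. now apply HB.
Qed.

Definition poisson_kernel (s : R) (z : C) (th : R) : R :=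
  (s ^ 2 - Cmod z ^ 2) / Cmod (circ s th - z) ^ 2.

(** Cauchy's formula for [F w * (s ^ 2 - Cmod z0 ^ 2) / (s ^ 2 - conj z0 * w)],
    a function with the value [F z0] at [z0]; on the circle the added factor
    turns the Cauchy kernel into the Poisson kernel. *)
Lemma poisson_formula (F F1 : C -> C) (S s : R) (z0 : C) :
  Cmod z0 < s -> s < S -> (forall z, Cmod z < S -> hol_at F F1 z) ->
  RInt (fun th => Re (F (circ s th)) * poisson_kernel s z0 th) 0 (2 * PI)
  = 2 * PI * Re (F z0).
Proof.
  intros Hz0 HS HF. assert (Hm := Cmod_ge_0 z0).
  (* A radius above [s] below which [s ^ 2 - conj z0 * w] does not vanish. *)
  set (S' := Rmin S (2 * s ^ 2 / (s + Cmod z0))).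
  assert (HsS' : s < S').
  { apply Rmin_glb_lt; [assumption|]. apply (Rmult_lt_reg_r (s + Cmod z0)); [lra|].
    replace (2 * s ^ 2 / (s + Cmod z0) * (s + Cmod z0)) with (2 * s ^ 2) by (field; lra). nra. }
  assert (HS'1 : S' * Cmod z0 < s ^ 2).
  { apply Rle_lt_trans with (2 * s ^ 2 / (s + Cmod z0) * Cmod z0).
    - apply Rmult_le_compat_r; [assumption|apply Rmin_r].
    - apply (Rmult_lt_reg_r (s + Cmod z0)); [lra|].
      replace (2 * s ^ 2 / (s + Cmod z0) * Cmod z0 * (s + Cmod z0))
        with (2 * s ^ 2 * Cmod z0) by (field; lra).
      assert (0 < s ^ 2) by (apply pow_lt; lra). nra. }
  pose (k := RtoC (s ^ 2 - Cmod z0 ^ 2)).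
  pose (D := fun z => (RtoC (s ^ 2) - Cconj z0 * z)%C).
  assert (HD : forall z, Cmod z < S' -> D z <> 0%C).
  { intros z Hz E. assert (E' : (Cconj z0 * z)%C = RtoC (s ^ 2))
      by (transitivity (RtoC (s ^ 2) - D z)%C; [unfold D; ring|rewrite E; ring]).
    apply (f_equal Cmod) in E'. rewrite Cmod_mult, Cmod_conj, Cmod_R, Rabs_pos_eq in E'
      by apply pow2_ge_0.
    assert (Cmod z0 * Cmod z <= Cmod z0 * S') by (apply Rmult_le_compat_l; lra). lra. }
  assert (HDh : forall z, hol_at D (fun _ => 0 - Cconj z0 * 1)%C z).
  { intros z. apply hol_at_minus; [apply hol_at_const|]. apply hol_at_scal, hol_at_id. }
  eassert (HG : forall z, Cmod z < S' ->
    hol_at (fun w => F w * (k / D w))%C _ z).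
  { intros z Hz. apply hol_at_mult.
    - apply HF. apply Rlt_le_trans with (1 := Hz), Rmin_l.
    - apply hol_at_div; [apply hol_at_const|apply HDh|now apply HD]. }
  replace (Re (F z0)) with (Re (F z0 * (k / D z0))).
  - rewrite <- (cauchy_formula _ _ S' s z0 Hz0 HsS' (fun z Hz _ => HG z Hz)).
    + apply RInt_ext. intros th _. cbv beta.
      assert (H1 := circ_minus_neq_0 s th z0 Hz0).
      assert (H2 : D (circ s th) <> 0%C) by (apply HD; rewrite Cmod_circ; lra).
      assert (H3 : Cmod (circ s th - z0) ^ 2 <> 0)
        by (apply pow_nonzero, Rgt_not_eq, Cmod_gt_0, H1).
      assert (H4 : RtoC (Cmod (circ s th - z0) ^ 2) <> 0%C)
        by (intros X; now apply RtoC_inj in X).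
      replace (F (circ s th) * (k / D (circ s th)) * (circ s th / (circ s th - z0)))%C
        with (F (circ s th) * RtoC (poisson_kernel s z0 th))%C.
      * destruct (F (circ s th)) as [x y]. unfold Re, Cmult, RtoC. simpl. ring.
      * unfold poisson_kernel. rewrite RtoC_div by exact H3. fold k.
        (* On the circle [s ^ 2 = zeta * conj zeta]. *)
        assert (E : D (circ s th) = (circ s th * Cconj (circ s th - z0))%C).
        { unfold D. rewrite <- (Cmod_circ s th) at 1 by lra. rewrite Cmod2_conj.
          rewrite Cminus_conj. ring. }
        rewrite Cmod2_conj in H4 |- *. rewrite E in H2 |- *.
        assert (H5 : Cconj (circ s th - z0) <> 0%C)
          by (intros X; apply H2; rewrite X; ring).
        assert (H6 : circ s th <> 0%C) by (intros X; apply H2; rewrite X at 1; ring).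
        field. repeat split; assumption.
    + apply (hol_at_continuous _ _ _ (HG z0 (Rlt_trans _ _ _ Hz0 HsS'))).
  - f_equal. replace (D z0) with k.
    + field. unfold k. intros X. apply RtoC_inj in X. nra.
    + unfold k, D. rewrite RtoC_minus, Cmod2_conj. ring.
Qed.

Lemma Cmod2_minus (z w : C) :
  Cmod (z - w) ^ 2 = Cmod z ^ 2 + Cmod w ^ 2 - 2 * Re (z * Cconj w).
Proof. rewrite !Cmod2_alt. destruct z, w. unfold Re, Im, Cconj. simpl. ring. Qed.

Lemma continuous_poisson_kernel s z th :
  Cmod z < s -> continuous (poisson_kernel s z) th.
Proof.
  intros Hz. unfold poisson_kernel.
  assert (H : continuous (fun th => Cmod (circ s th - z)) th).
  { apply continuous_Cmod, continuous_Cminus; [apply continuous_circ|apply continuous_const]. }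
  apply (continuous_mult (K := R_AbsRing)); [apply continuous_const|].
  apply continuous_Rinv_along.
  - apply (continuous_mult (K := R_AbsRing)); [exact H|].
    apply (continuous_mult (K := R_AbsRing)); [exact H|apply continuous_const].
  - apply pow_nonzero, Rgt_not_eq, Cmod_gt_0, circ_minus_neq_0, Hz.
Qed.

Lemma circ_conj_bound s th z :
  0 <= s -> Rabs (Re (circ s th * Cconj z)) <= s * Cmod z.
Proof.
  intros Hs. apply Rle_trans with (1 := re_le_Cmod _).
  rewrite Cmod_mult, Cmod_conj, Cmod_circ by assumption. lra.
Qed.

Lemma poisson_kernel_le s z th :
  Cmod z < s -> poisson_kernel s z th <= (s + Cmod z) / (s - Cmod z).
Proof.
  intros Hz. assert (Hm := Cmod_ge_0 z).
  assert (Hb := circ_conj_bound s th z ltac:(lra)). apply Rabs_le_between in Hb.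
  unfold poisson_kernel. rewrite Cmod2_minus, Cmod_circ by lra.
  set (x := Re _) in *. set (r := Cmod z) in *.
  assert (0 < s ^ 2 + r ^ 2 - 2 * x) by nra.
  apply (Rmult_le_reg_r ((s ^ 2 + r ^ 2 - 2 * x) * (s - r))); [nra|].
  replace ((s ^ 2 - r ^ 2) / (s ^ 2 + r ^ 2 - 2 * x) * ((s ^ 2 + r ^ 2 - 2 * x) * (s - r)))
    with ((s ^ 2 - r ^ 2) * (s - r)) by (field; lra).
  replace ((s + r) / (s - r) * ((s ^ 2 + r ^ 2 - 2 * x) * (s - r)))
    with ((s + r) * (s ^ 2 + r ^ 2 - 2 * x)) by (field; lra).
  nra.
Qed.

(** The Poisson kernel is a convex function of the cosine of the angle; the
    right-hand side is its chord. *)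
Lemma poisson_kernel_chord s z th :
  Cmod z < s ->
  poisson_kernel s z th
  <= (s ^ 2 + Cmod z ^ 2 + 2 * Re (circ s th * Cconj z)) / (s ^ 2 - Cmod z ^ 2).
Proof.
  intros Hz. assert (Hm := Cmod_ge_0 z).
  assert (Hb := circ_conj_bound s th z ltac:(lra)). apply Rabs_le_between in Hb.
  unfold poisson_kernel. rewrite Cmod2_minus, Cmod_circ by lra.
  set (x := Re _) in *. set (r := Cmod z) in *.
  assert (0 < s ^ 2 + r ^ 2 - 2 * x) by nra.
  assert (0 < s ^ 2 - r ^ 2) by nra.
  apply (Rmult_le_reg_r ((s ^ 2 + r ^ 2 - 2 * x) * (s ^ 2 - r ^ 2))); [nra|].
  replace ((s ^ 2 - r ^ 2) / (s ^ 2 + r ^ 2 - 2 * x) * ((s ^ 2 + r ^ 2 - 2 * x) * (s ^ 2 - r ^ 2)))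
    with ((s ^ 2 - r ^ 2) * (s ^ 2 - r ^ 2)) by (field; lra).
  replace ((s ^ 2 + r ^ 2 + 2 * x) / (s ^ 2 - r ^ 2) * ((s ^ 2 + r ^ 2 - 2 * x) * (s ^ 2 - r ^ 2)))
    with ((s ^ 2 + r ^ 2 + 2 * x) * (s ^ 2 + r ^ 2 - 2 * x)) by (field; lra).
  assert (x * x <= (s * r) * (s * r)) by nra. nra.
Qed.

Lemma harnack (F F1 : C -> C) (s : R) (z : C) :
  Cmod z < s -> s < 1 -> (forall w, Cmod w < 1 -> hol_at F F1 w) ->
  (forall w, Cmod w < 1 -> 0 <= Re (F w)) ->
  Re (F z) <= (s + Cmod z) / (s - Cmod z) * Re (F 0%C).
Proof.
  intros Hz Hs HF Hpos. assert (Hm := Cmod_ge_0 z). assert (HPI := PI_RGT_0).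
  set (q := (s + Cmod z) / (s - Cmod z)).
  assert (HFc : forall th, continuous (fun th => F (circ s th)) th).
  { intros th. apply continuous_along_circ, (hol_at_continuous F F1), HF.
    rewrite Cmod_circ; lra. }
  apply (Rmult_le_reg_l (2 * PI)); [lra|].
  rewrite <- (poisson_formula F F1 1 s z) by assumption.
  replace (2 * PI * (q * Re (F 0%C))) with (2 * PI * Re (RtoC q * F 0%C)).
  2: { destruct (F 0%C). unfold Re, Cmult, RtoC. simpl. ring. }
  rewrite <- (mean_value (fun w => RtoC q * F w)%C (fun w => RtoC q * F1 w)%C 1 s).
  - apply RInt_circle_le.
    + intros th. apply (continuous_mult (K := R_AbsRing));
        [now apply continuous_Re|now apply continuous_poisson_kernel].
    + intros th. apply continuous_Re, continuous_Cmult; [apply continuous_const|apply HFc].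
    + intros th _. replace (Re (RtoC q * F (circ s th))) with (Re (F (circ s th)) * q).
      * apply Rmult_le_compat_l; [apply Hpos; rewrite Cmod_circ; lra|].
        now apply poisson_kernel_le.
      * destruct (F (circ s th)). unfold Re, Cmult, RtoC. simpl. ring.
  - lra.
  - lra.
  - intros w Hw _. now apply hol_at_scal, HF.
  - apply continuous_Cmult; [apply continuous_const|].
    apply (hol_at_continuous F F1), HF. rewrite Cmod_0. lra.
Qed.

(** Harnack's inequality for the real part of [(1 + c * G) / (1 - c * G)], with
    [c] chosen such that [c * G z] is nonnegative. *)
Lemma schwarz_lemma (G G1 : C -> C) (z : C) :
  (forall w, Cmod w < 1 -> hol_at G G1 w) -> (forall w, Cmod w < 1 -> Cmod (G w) < 1) ->
  G 0%C = 0%C -> Cmod z < 1 -> Cmod (G z) <= Cmod z.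
Proof.
  intros HG Hlt HG0 Hz. assert (Hm := Cmod_ge_0 z).
  destruct (Rle_lt_dec (Cmod (G z)) (Cmod z)) as [|Hgt]; [assumption|exfalso].
  assert (Hg1 := Hlt z Hz).
  destruct (rotate_to_modulus (G z)) as (c & Hc & E).
  set (m := Cmod (G z)) in *. set (r := Cmod z) in *.
  assert (Hne : forall w, Cmod w < 1 -> (1 - c * G w)%C <> 0%C).
  { intros w Hw X. assert (X' : (c * G w)%C = 1%C)
      by (transitivity (1 - (1 - c * G w))%C; [ring|rewrite X; ring]).
    apply (f_equal Cmod) in X'. rewrite Cmod_mult, Hc, Cmod_1 in X'.
    generalize (Hlt w Hw). lra. }
  set (s := (1 + r / m) / 2).
  assert (Hrm : r / m < 1) by (apply (Rmult_lt_reg_r m); [lra|]; field_simplify; lra).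
  assert (Hrr : r <= r / m).
  { apply (Rmult_le_reg_r m); [lra|]. replace (r / m * m) with r by (field; lra). nra. }
  assert (H := harnack (fun w => (1 + c * G w) / (1 - c * G w))%C _ s z
     ltac:(unfold s; fold r; lra) ltac:(unfold s; lra)
     (fun w Hw => hol_at_div _ _ _ _ w
        (hol_at_plus _ _ _ _ w (hol_at_const 1 w) (hol_at_scal c _ _ w (HG w Hw)))
        (hol_at_minus _ _ _ _ w (hol_at_const 1 w) (hol_at_scal c _ _ w (HG w Hw)))
        (Hne w Hw))).
  cbv beta in H. rewrite HG0, E in H.
  assert (Hsm : s * m <= r).
  { assert (P : (1 + m) / (1 - m) <= (s + r) / (s - r)).
    { replace ((1 + m) / (1 - m)) with (Re ((1 + RtoC m) / (1 - RtoC m))).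
      - replace (Re ((1 + c * 0) / (1 - c * 0))) with 1 in H.
        + rewrite Rmult_1_r in H. apply H. intros w Hw. specialize (Hlt w Hw). specialize (Hne w Hw).
          assert (B : Cmod (c * G w) < 1) by (rewrite Cmod_mult, Hc; lra).
          revert B Hne. generalize (c * G w)%C. intros [x y] B Hne.
          assert (B2 : Cmod (x, y) ^ 2 < 1)
            by (assert (B0 := Cmod_ge_0 (x, y)); nra).
          rewrite Cmod2_alt' in B2. simpl in B2.
          apply Cnorm2_neq_0 in Hne. simpl in Hne.
          unfold Re, Cdiv, Cmult, Cinv, Cminus, Cplus, Copp, RtoC. simpl.
          replace ((1 + x) * ((1 + - x) / ((1 + - x) * ((1 + - x) * 1) + (0 + - y) * ((0 + - y) * 1))) -
             (0 + y) * (- (0 + - y) / ((1 + - x) * ((1 + - x) * 1) + (0 + - y) * ((0 + - y) * 1))))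
            with ((1 - (x ^ 2 + y ^ 2)) / ((1 + - x) * ((1 + - x) * 1) + (0 + - y) * ((0 + - y) * 1)))
            by (field; intros X; apply Hne; lra).
          apply Rmult_le_pos; [simpl; lra|]. left. apply Rinv_0_lt_compat. nra.
        + replace ((1 + c * 0) / (1 - c * 0))%C with (RtoC 1); [reflexivity|].
          field.
      - rewrite <- RtoC_plus, <- RtoC_minus, <- RtoC_div by lra. reflexivity. }
    assert (Hs : r < s) by (unfold s; lra).
    apply (Rmult_le_compat_r ((1 - m) * (s - r))) in P; [|nra].
    replace ((1 + m) / (1 - m) * ((1 - m) * (s - r))) with ((1 + m) * (s - r)) in P by (field; lra).
    replace ((s + r) / (s - r) * ((1 - m) * (s - r))) with ((s + r) * (1 - m)) in P by (field; lra).
    nra. }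
  assert (s * m = (m + r) / 2) by (unfold s; field; lra). lra.
Qed.

(** Poisson's formula with the chord of the kernel: [Re F * Re (zeta * conj z)]
    is on the circle the real part of a holomorphic function, so that the
    integral of the chord is a value at the centre. *)
Lemma harnack_gradient (Q Q1 : C -> C) (z : C) :
  (forall w, Cmod w < 1 -> hol_at Q Q1 w) ->
  (forall w, Cmod w < 1 -> 0 <= Re (1 + w * Q w)) -> Cmod z < 1 ->
  Re (1 + z * Q z) * (1 - Cmod z ^ 2) <= 1 + Cmod z ^ 2 + Cmod (Q 0%C) * Cmod z.
Proof.
  intros HQ Hpos Hz. assert (Hm := Cmod_ge_0 z). assert (HPI := PI_RGT_0).
  pose (F := fun w => (1 + w * Q w)%C).
  set (r := Cmod z) in *. set (b := Cmod (Q 0%C)). assert (Hb : 0 <= b) by apply Cmod_ge_0.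
  assert (HF : forall w, Cmod w < 1 -> hol_at F (fun w => 0 + (1 * Q w + w * Q1 w))%C w).
  { intros w Hw. apply hol_at_plus; [apply hol_at_const|].
    apply hol_at_mult; [apply hol_at_id|now apply HQ]. }
  assert (Hs : forall s, r < s < 1 ->
    Re (F z) * (s ^ 2 - r ^ 2) <= s ^ 2 + r ^ 2 + s ^ 2 * b * r).
  { intros s Hs.
    assert (HFc : forall th, continuous (fun th => F (circ s th)) th).
    { intros th. eapply continuous_along_circ, hol_at_continuous, HF. rewrite Cmod_circ; lra. }
    assert (Hd : 0 < s ^ 2 - r ^ 2) by nra.
    (* On the circle [F * conj zeta * z] is [conj zeta * z + s ^ 2 * z * Q], and
       [conj zeta * z] has the real part of [conj z * zeta]. *)
    pose (M := fun w => (RtoC (/ (s ^ 2 - r ^ 2)) * (RtoC (s ^ 2 + r ^ 2) * F w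
       + (Cconj z * (w * F w) + (Cconj z * w + RtoC (s ^ 2) * z * Q w))))%C).
    eassert (HM : forall w, Cmod w < 1 -> hol_at M _ w).
    { intros w Hw. apply hol_at_scal, hol_at_plus; [apply hol_at_scal, HF, Hw|].
      apply hol_at_plus.
      - apply hol_at_scal, hol_at_mult; [apply hol_at_id|apply HF, Hw].
      - apply hol_at_plus; [apply hol_at_scal, hol_at_id|apply hol_at_scal, HQ, Hw]. }
    apply (Rmult_le_reg_r (/ (s ^ 2 - r ^ 2))); [now apply Rinv_0_lt_compat|].
    rewrite Rmult_assoc, Rinv_r, Rmult_1_r by lra.
    apply Rle_trans with (Re (M 0%C)).
    - apply (Rmult_le_reg_l (2 * PI)); [lra|].
      rewrite <- (poisson_formula F _ 1 s z) by (try exact HF; fold r; lra).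
      rewrite <- (mean_value M _ 1 s ltac:(lra) ltac:(lra) (fun w Hw _ => HM w Hw)).
      + apply RInt_circle_le.
        * intros th. apply (continuous_mult (K := R_AbsRing));
            [now apply continuous_Re|apply continuous_poisson_kernel; fold r; lra].
        * intros th. apply continuous_Re.
          eapply continuous_along_circ, hol_at_continuous, HM. rewrite Cmod_circ; lra.
        * intros th _.
          apply Rle_trans with (Re (F (circ s th)) *
            ((s ^ 2 + r ^ 2 + 2 * Re (circ s th * Cconj z)) / (s ^ 2 - r ^ 2))).
          -- apply Rmult_le_compat_l; [apply Hpos; rewrite Cmod_circ; lra|].
             apply poisson_kernel_chord. fold r. lra.
          -- right.
             assert (Es : Cmod (circ s th) ^ 2 = s ^ 2) by (rewrite Cmod_circ; lra).
             rewrite Cmod2_alt' in Es.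
             unfold M, F. rewrite <- Es in Hd |- *. revert Hd.
             destruct (circ s th) as [x y], (Q (x, y)) as [p q], z as [u v].
             unfold Re, Cconj, Cmult, Cplus, RtoC. simpl. intros Hd. field. lra.
      + eapply hol_at_continuous, HM. rewrite Cmod_0. lra.
    - rewrite Rmult_comm.
      replace (Re (M 0%C)) with (/ (s ^ 2 - r ^ 2) * (s ^ 2 + r ^ 2 + s ^ 2 * Re (z * Q 0%C))).
      + apply Rmult_le_compat_l; [left; now apply Rinv_0_lt_compat|].
        assert (Re (z * Q 0%C) <= b * r).
        { apply Rle_trans with (1 := Re_le_Cmod _). rewrite Cmod_mult. unfold b, r. lra. }
        assert (0 < s ^ 2) by nra. nra.
      + unfold M, F. destruct (Q 0%C) as [p q], z as [u v].
        unfold Re, Cconj, Cmult, Cplus, RtoC. simpl. ring. }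
  change (Re (F z) * (1 - r ^ 2) <= 1 + r ^ 2 + b * r).
  (* The two sides are affine in [s ^ 2], so [s] may be replaced by [1]. *)
  destruct (Rle_lt_dec (Re (F z) * (1 - r ^ 2)) (1 + r ^ 2 + b * r)) as [|Hgt];
    [assumption|exfalso].
  set (x := Re (F z)) in *.
  set (d := x * (1 - r ^ 2) - (1 + r ^ 2 + b * r)) in *.
  assert (Hd : 0 < d) by (unfold d; lra).
  assert (Hx : 0 <= x) by now apply Hpos.
  set (e := Rmin ((1 - r) / 2) (d / (4 * (1 + x)))).
  assert (He0 : 0 < e) by (apply Rmin_pos; [lra|apply Rdiv_lt_0_compat; lra]).
  assert (He1 : e <= (1 - r) / 2) by apply Rmin_l.
  assert (He2 : e * (4 * (1 + x)) <= d).
  { apply Rle_trans with (d / (4 * (1 + x)) * (4 * (1 + x))).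
    - apply Rmult_le_compat_r; [lra|apply Rmin_r].
    - right. field. lra. }
  specialize (Hs (1 - e) ltac:(lra)).
  assert (0 <= b * r) by nra.
  assert (He3 : 0 <= (1 - e) ^ 2 <= 1) by (simpl; nra).
  assert (T : (1 - e) ^ 2 * b * r <= b * r).
  { rewrite Rmult_assoc. rewrite <- (Rmult_1_l (b * r)) at 2.
    apply Rmult_le_compat_r; lra. }
  assert (V : x * (2 * e - e ^ 2) <= x * (2 * e)).
  { apply Rmult_le_compat_l; [assumption|]. assert (0 <= e ^ 2) by apply pow2_ge_0. lra. }
  assert (0 <= x * e) by (apply Rmult_le_pos; lra).
  assert (U : x * ((1 - e) ^ 2 - r ^ 2) = d + (1 + r ^ 2 + b * r) - x * (2 * e - e ^ 2))
    by (unfold d; ring).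
  lra.
Qed.

(** * Injective holomorphic functions *)

Definition hol_on_disk (F F1 : C -> C) : Prop := forall z, disk z -> hol_at F F1 z.

Lemma hol_at_ext_loc F G F1 z :
  locally (T := C_UniformSpace) z (fun w => F w = G w) -> hol_at F F1 z -> hol_at G F1 z.
Proof.
  intros E [H H1]. split; [|assumption]. now apply (deriv_along_ext_loc _ F).
Qed.

Lemma circle_min (F : C -> C) (s : R) :
  (forall th, continuous (fun th => F (circ s th)) th) ->
  (forall th, F (circ s th) <> 0%C) ->
  exists m, 0 < m /\ forall th, 0 <= th <= 2 * PI -> m <= Cmod (F (circ s th)).
Proof.
  intros Hc H0. assert (HPI := PI_RGT_0).
  destruct (continuity_ab_min (fun th => Cmod (F (circ s th))) 0 (2 * PI)) as (x & Hx & _).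
  - lra.
  - intros th _. apply continuity_pt_filterlim.
    apply (continuous_Cmod (fun th => F (circ s th))), Hc.
  - exists (Cmod (F (circ s x))). split; [apply Cmod_gt_0, H0|assumption].
Qed.

(** If [w = f z] is much closer to [f z0] than the image of a small circle
    around [z0] while [z] is outside that circle, then [1 / (f - w)] violates
    the mean value bound inside it. *)
Lemma injective_inverse_continuous (f f1 : C -> C) :
  hol_on_disk f f1 -> injective_on_disk f ->
  forall z0 eps, disk z0 -> 0 < eps ->
  exists d, 0 < d /\ forall z, disk z -> Cmod (f z - f z0) < d -> Cmod (z - z0) < eps.
Proof.
  unfold disk. intros Hf Hinj z0 eps Hz0 Heps.
  set (e := Rmin eps (1 - Cmod z0)).
  assert (He : 0 < e) by (apply Rmin_pos; lra).
  assert (Hin : forall h, Cmod h < e -> Cmod (z0 + h) < 1).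
  { intros h Hh. apply Rle_lt_trans with (1 := Cmod_triangle _ _).
    assert (e <= 1 - Cmod z0) by apply Rmin_r. lra. }
  pose (s := e / 2).
  assert (Hs : forall th, Cmod (circ s th) = s) by (intros; apply Cmod_circ; unfold s; lra).
  destruct (circle_min (fun h => f (z0 + h) - f z0)%C s) as (m & Hm & Hmin).
  - intros th. apply (continuous_along_circ (fun h => f (z0 + h) - f z0)%C).
    apply continuous_Cminus; [|apply continuous_const].
    apply (hol_at_continuous _ (fun h => f1 (z0 + h)%C)), hol_at_shift, Hf, Hin.
    rewrite Hs. unfold s. lra.
  - intros th E. assert (E' : (z0 + circ s th)%C = z0).
    { apply Hinj; [apply Hin; rewrite Hs; unfold s; lra|exact Hz0|].
      transitivity (f (z0 + circ s th) - f z0 + f z0)%C; [ring|rewrite E; ring]. }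
    assert (E2 : circ s th = 0%C)
      by (transitivity (z0 + circ s th - z0)%C; [ring|rewrite E'; ring]).
    apply (f_equal Cmod) in E2. rewrite Hs, Cmod_0 in E2. unfold s in E2. lra.
  - exists (m / 2). split; [lra|]. intros z Hz Hd.
    destruct (Rlt_le_dec (Cmod (z - z0)) eps) as [|Hfar]; [assumption|exfalso].
    assert (He2 : e <= eps) by apply Rmin_l.
    assert (Hne : forall h, Cmod h < e -> (f (z0 + h) - f z)%C <> 0%C).
    { intros h Hh E. assert (E' : (z0 + h)%C = z).
      { apply Hinj; [now apply Hin|exact Hz|].
        transitivity (f (z0 + h) - f z + f z)%C; [ring|rewrite E; ring]. }
      rewrite <- E' in Hfar. replace (z0 + h - z0)%C with h in Hfar by ring. lra. }
    assert (B := mean_value_bound (fun h => 1 / (f (z0 + h) - f z))%C _ e s (2 / m)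
       ltac:(unfold s; lra) ltac:(unfold s; lra)
       (fun h Hh _ => hol_at_div _ _ _ _ h (hol_at_const 1 h)
          (hol_at_minus _ _ _ _ h (hol_at_shift f f1 z0 h (Hf _ (Hin h Hh)))
             (hol_at_const (f z) h)) (Hne h Hh))).
    cbv beta in B.
    assert (H0 : Cmod 0 < e) by (rewrite Cmod_0; exact He).
    assert (P : Cmod (1 / (f (z0 + 0) - f z))%C <= 2 / m).
    { apply B.
      - apply continuous_Cdiv; [apply continuous_const| |now apply Hne].
        apply continuous_Cminus; [|apply continuous_const].
        now apply (hol_at_continuous _ (fun h => f1 (z0 + h)%C)), hol_at_shift, Hf, Hin.
      - intros th Hth.
        assert (Hc : Cmod (circ s th) < e) by (rewrite Hs; unfold s; lra).
        rewrite Cmod_div, Cmod_1 by now apply Hne.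
        replace (2 / m) with (1 * / (m / 2)) by (field; lra).
        apply Rmult_le_compat_l; [lra|]. apply Rinv_le_contravar; [lra|].
        specialize (Hmin th Hth).
        assert (T := Cmod_triangle (f (z0 + circ s th) - f z)%C (f z - f z0)%C).
        replace (f (z0 + circ s th) - f z + (f z - f z0))%C
          with (f (z0 + circ s th) - f z0)%C in T by ring.
        lra. }
    assert (Hn0 := Hne 0%C H0).
    rewrite Cmod_div, Cmod_1 in P by exact Hn0.
    apply Cmod_gt_0 in Hn0.
    replace (z0 + 0)%C with z0 in * by ring.
    replace (f z0 - f z)%C with (- (f z - f z0))%C in * by ring.
    rewrite Cmod_opp in *.
    apply (Rmult_le_compat_r (m * Cmod (f z - f z0))) in P; [|nra].
    replace (1 / Cmod (f z - f z0) * (m * Cmod (f z - f z0))) with m in P by (field; lra).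
    replace (2 / m * (m * Cmod (f z - f z0))) with (2 * Cmod (f z - f z0)) in P by (field; lra).
    lra.
Qed.

(** [(f (c + h) - f (c - h)) / h] has no zero [h <> 0] and the value [2 * f1 c]
    at [h = 0]; the mean value bound for its inverse bounds [f1 c] from below. *)
Lemma injective_derivative_lower_bound (f f1 : C -> C) (c : C) (e s m : R) :
  hol_on_disk f f1 -> injective_on_disk f ->
  0 < s -> s < e -> Cmod c + e <= 1 -> 0 < m -> f1 c <> 0%C ->
  (forall th, 0 <= th <= 2 * PI -> m <= Cmod (f (c + circ s th) - f (c - circ s th))%C) ->
  m <= 2 * s * Cmod (f1 c).
Proof.
  unfold hol_on_disk, disk. intros Hf Hinj Hs Hse Hce Hm H1 Hmin.
  assert (Hin : forall h, Cmod h < e -> Cmod (c + h) < 1 /\ Cmod (c - h) < 1).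
  { intros h Hh. split.
    - apply Rle_lt_trans with (1 := Cmod_triangle _ _). lra.
    - unfold Cminus. apply Rle_lt_trans with (1 := Cmod_triangle _ _).
      rewrite Cmod_opp. lra. }
  pose (D := fun h => (f (c + h) - f (c - h))%C).
  pose (D1 := fun h => (f1 (c + h) - f1 (c - h) * (0 - 1))%C).
  assert (HD : forall h, Cmod h < e -> hol_at D D1 h).
  { intros h Hh. destruct (Hin h Hh) as [A B]. apply hol_at_minus.
    - now apply hol_at_shift, Hf.
    - apply (hol_at_comp f f1 (fun h => c - h)%C (fun _ => 0 - 1)%C).
      + apply hol_at_minus; [apply hol_at_const|apply hol_at_id].
      + now apply Hf. }
  assert (HD0 : forall h, Cmod h < e -> h <> 0%C -> D h <> 0%C).
  { intros h Hh Hh0 E. destruct (Hin h Hh) as [A B]. apply Hh0.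
    assert (E' : (c + h)%C = (c - h)%C).
    { apply Hinj; [exact A|exact B|].
      transitivity (D h + f (c - h))%C; [unfold D; ring|rewrite E; ring]. }
    transitivity (/ RtoC 2 * ((c + h) - (c - h)))%C.
    - field.
    - rewrite E'. ring. }
  pose (H := fun h : C => if excluded_middle_informative (h = 0%C) then (/ (f1 c + f1 c))%C
                      else (h / D h)%C).
  assert (H2 : (f1 c + f1 c)%C <> 0%C).
  { replace (f1 c + f1 c)%C with (RtoC 2 * f1 c)%C by (replace (RtoC 2) with (1 + 1)%C; [ring|rewrite <- RtoC_plus; f_equal; ring]).
    apply Cmult_neq_0; [|exact H1]. intros E. apply RtoC_inj in E. lra. }
  assert (B : Cmod (H 0%C) <= s / m).
  { apply (mean_value_bound H (fun h => (1 * D h - h * D1 h) / (D h * D h))%C e s); try assumption.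
    - intros h Hh Hh0.
      apply (hol_at_ext_loc (fun h => h / D h)%C).
      + generalize (locally_neq_0 (U := C_UniformSpace) (fun w => w) h (continuous_id h) Hh0).
        apply filter_imp. intros w Hw. unfold H.
        now destruct (excluded_middle_informative _).
      + apply (hol_at_div (fun h => h) (fun _ => 1%C) D D1);
          [apply hol_at_id|now apply HD|now apply HD0].
    - destruct (Hf c) as [(q & Hq & Eq & E) _].
      { assert (T := Hin 0%C ltac:(rewrite Cmod_0; lra)).
        replace (c + 0)%C with c in T by ring. apply T. }
      assert (Ep : continuous (fun h : C => c + h)%C (RtoC 0))
        by (apply continuous_Cplus; [apply continuous_const|apply continuous_id]).
      assert (Em : continuous (fun h : C => c - h)%C (RtoC 0))
        by (apply continuous_Cminus; [apply continuous_const|apply continuous_id]).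
      assert (Zp : (c + 0)%C = c) by ring. assert (Zm : (c - 0)%C = c) by ring.
      apply (continuous_ext_loc H (fun h => / (q (c + h) + q (c - h)))%C).
      + assert (Lp : locally (T := C_UniformSpace) (RtoC 0)
           (fun h : C => f (c + h) - f c = (c + h - c) * q (c + h))%C)
          by (apply (Ep (fun w => f w - f c = (w - c) * q w)%C); rewrite Zp; exact E).
        assert (Lm : locally (T := C_UniformSpace) (RtoC 0)
           (fun h : C => f (c - h) - f c = (c - h - c) * q (c - h))%C)
          by (apply (Em (fun w => f w - f c = (w - c) * q w)%C); rewrite Zm; exact E).
        generalize (filter_and _ _ (filter_and _ _ Lp Lm)
          (locally_Cmod_lt 0%C e ltac:(rewrite Cmod_0; lra))).
        apply filter_imp. intros h [[A A'] Ah]. unfold H.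
        destruct (excluded_middle_informative _) as [->|Hh0].
        * rewrite Zp, Zm, Eq. reflexivity.
        * assert (ED : D h = (h * (q (c + h) + q (c - h)))%C).
          { unfold D. transitivity ((f (c + h) - f c) - (f (c - h) - f c))%C; [ring|].
            rewrite A, A'. ring. }
          assert (N := HD0 h Ah Hh0). rewrite ED in N |- *.
          assert (N' : (q (c + h) + q (c - h))%C <> 0%C)
            by (intros X; apply N; rewrite X; ring).
          cfield. now split.
      + apply continuous_Cinv.
        * apply continuous_Cplus.
          -- apply (continuous_comp (fun h => c + h)%C q); [exact Ep|]. now rewrite Zp.
          -- apply (continuous_comp (fun h => c - h)%C q); [exact Em|]. now rewrite Zm.
        * now rewrite Zp, Zm, Eq.
    - intros th Hth. unfold H.
      assert (Hc : Cmod (circ s th) = s) by (apply Cmod_circ; lra).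
      destruct (excluded_middle_informative (circ s th = 0%C)) as [X|Hh0].
      { rewrite X, Cmod_0 in Hc. lra. }
      rewrite Cmod_div, Hc by (apply HD0; [lra|assumption]).
      apply Rmult_le_compat_l; [lra|]. apply Rinv_le_contravar; [exact Hm|now apply Hmin]. }
  unfold H in B. destruct (excluded_middle_informative _) as [_|X] in B; [|easy].
  rewrite Cmod_inv in B by exact H2.
  assert (T : Cmod (f1 c + f1 c) <= 2 * Cmod (f1 c))
    by (apply Rle_trans with (1 := Cmod_triangle _ _); lra).
  apply Cmod_gt_0 in H2.
  apply (Rmult_le_compat_r (m * Cmod (f1 c + f1 c))) in B; [|nra].
  replace (/ Cmod (f1 c + f1 c) * (m * Cmod (f1 c + f1 c))) with m in B by (field; lra).
  replace (s / m * (m * Cmod (f1 c + f1 c))) with (s * Cmod (f1 c + f1 c)) in B by (field; lra).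
  nra.
Qed.

Lemma continuous_RtoC_mult (z : C) (t : R) : continuous (fun t => RtoC t * z)%C t.
Proof. apply continuous_Cmult; [apply continuous_RtoC_id|apply continuous_const]. Qed.

Lemma first_zero (phi : R -> C) :
  (forall t, 0 <= t <= 1 -> continuous phi t) -> phi 0 <> 0%C -> phi 1 = 0%C ->
  exists T, 0 < T <= 1 /\ phi T = 0%C /\ forall t, 0 <= t < T -> phi t <> 0%C.
Proof.
  intros Hc H0 H1.
  pose (E := fun t => 0 <= t <= 1 /\ forall s, 0 <= s <= t -> phi s <> 0%C).
  assert (E0 : E 0) by (split; [lra|intros s Hs; now replace s with 0 by lra]).
  destruct (completeness E) as [T [HT1 HT2]].
  - exists 1. intros t [Ht _]. lra.
  - now exists 0.
  - assert (HT : 0 <= T <= 1).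
    { split; [now apply HT1|]. apply HT2. intros t [Ht _]. lra. }
    assert (Hlt : forall t, 0 <= t < T -> phi t <> 0%C).
    { intros t Ht.
      destruct (classic (exists u, E u /\ t < u)) as [(u & [_ Hu] & Htu)|N].
      - apply Hu. lra.
      - assert (T <= t); [|lra]. apply HT2. intros u Hu.
        destruct (Rle_lt_dec u t); [assumption|]. exfalso. apply N. now exists u. }
    assert (HTz : phi T = 0%C).
    { destruct (classic (phi T = 0%C)) as [|N]; [assumption|exfalso].
      destruct (locally_neq_0 phi T (Hc T HT) N) as [d Hd].
      assert (Hd0 := cond_pos d).
      destruct (Rle_lt_dec (T + d / 2) 1) as [Hle|Hgt].
      - assert (T + d / 2 <= T); [|lra]. apply HT1. split; [lra|].
        intros s Hs. destruct (Rlt_le_dec s T); [apply Hlt; lra|].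
        apply Hd. change (Rabs (s - T) < d). rewrite Rabs_pos_eq; lra.
      - apply (Hd 1); [|assumption]. change (Rabs (1 - T) < d). rewrite Rabs_pos_eq; lra. }
    exists T. split; [|now split]. destruct (Req_dec T 0) as [X|]; [|lra].
    now rewrite X in HTz.
Qed.

(** On the segment from the centre to a zero of the derivative, the derivative
    is bounded away from zero just before its first zero. *)
Lemma injective_derivative_neq_0 (f f1 : C -> C) :
  hol_on_disk f f1 -> injective_on_disk f -> f1 0%C <> 0%C ->
  forall z, disk z -> f1 z <> 0%C.
Proof.
  intros Hf Hinj H0 z Hz Ez.
  assert (Hm := Cmod_ge_0 z). unfold disk in Hz.
  set (e := (1 - Cmod z) / 2). set (s := e / 2).
  assert (Hseg : forall t, -1 <= t <= 1 -> Cmod (RtoC t * z) <= Cmod z).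
  { intros t Ht. rewrite Cmod_RtoC_mult.
    assert (Rabs t <= 1) by (apply Rabs_le; lra). assert (0 <= Rabs t) by apply Rabs_pos. nra. }
  destruct (first_zero (fun t => f1 (RtoC t * z)%C)) as (T & HT & ET & HTlt).
  - intros t Ht. apply (continuous_comp (fun t => RtoC t * z)%C f1); [apply continuous_RtoC_mult|].
    apply Hf. unfold disk. apply Rle_lt_trans with (2 := Hz), Hseg. lra.
  - now replace (RtoC 0 * z)%C with (RtoC 0) by ring.
  - now replace (RtoC 1 * z)%C with z by ring.
  - set (w := (RtoC T * z)%C) in *.
    assert (Hw : Cmod w <= Cmod z) by (apply Hseg; lra).
    assert (Hcirc : forall th, Cmod (circ s th) = s)
      by (intros; apply Cmod_circ; unfold s, e; lra).
    assert (Hin : forall c th, Cmod c <= Cmod z ->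
       Cmod (c + circ s th) < 1 /\ Cmod (c - circ s th) < 1).
    { intros c th Hc. split.
      - apply Rle_lt_trans with (1 := Cmod_triangle _ _). rewrite Hcirc. unfold s, e. lra.
      - unfold Cminus. apply Rle_lt_trans with (1 := Cmod_triangle _ _).
        rewrite Cmod_opp, Hcirc. unfold s, e. lra. }
    assert (H2d : forall th, continuous (fun p : R * R =>
       f (RtoC (fst p) * z + circ s (snd p)) - f (RtoC (fst p) * z - circ s (snd p)))%C (T, th)).
    { intros th. destruct (Hin w th Hw) as [A B].
      assert (C1 : continuous (fun p : R * R => RtoC (fst p) * z)%C (T, th)).
      { apply continuous_Cmult; [apply continuous_fst_along, continuous_RtoC_id|
          apply continuous_const]. }
      assert (C2 : continuous (fun p : R * R => circ s (snd p)) (T, th))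
        by apply continuous_snd_along, continuous_circ.
      apply continuous_Cminus.
      - apply (continuous_comp (fun p : R * R => RtoC (fst p) * z + circ s (snd p))%C f).
        + now apply continuous_Cplus.
        + apply (hol_at_continuous f f1), Hf, A.
      - apply (continuous_comp (fun p : R * R => RtoC (fst p) * z - circ s (snd p))%C f).
        + now apply continuous_Cminus.
        + apply (hol_at_continuous f f1), Hf, B. }
    destruct (circle_min (fun h => f (w + h) - f (w - h))%C s) as (m & Hm0 & Hmin).
    + intros th. apply (continuous_comp_2 (fun _ => T) (fun th => th)
        (fun t th => f (RtoC t * z + circ s th) - f (RtoC t * z - circ s th))%C);
        [apply continuous_const|apply continuous_id|apply H2d].
    + intros th E. destruct (Hin w th Hw) as [A B].
      assert (E' : (w + circ s th)%C = (w - circ s th)%C).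
      { apply Hinj; [exact A|exact B|].
        transitivity (f (w + circ s th) - f (w - circ s th) + f (w - circ s th))%C;
          [ring|rewrite E; ring]. }
      assert (E2 : circ s th = 0%C).
      { transitivity (/ RtoC 2 * ((w + circ s th) - (w - circ s th)))%C.
        - field.
        - rewrite E'. ring. }
      apply (f_equal Cmod) in E2. rewrite Hcirc, Cmod_0 in E2. unfold s, e in E2. lra.
    + destruct (uniform_continuity_2d_1d' (fun t th =>
         Cmod (f (RtoC t * z + circ s th) - f (RtoC t * z - circ s th))%C) 0 (2 * PI) T)
        with (eps := mkposreal (m / 2) ltac:(lra)) as [d Hd].
      { intros th _. apply continuity_2d_pt_filterlim.
        exact (continuous_Cmod _ _ (H2d th)). }
      simpl in Hd.
      assert (Hk : 0 < m / (4 * s)) by (apply Rdiv_lt_0_compat; unfold s, e; lra).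
      assert (Hc1 : continuous (fun t => f1 (RtoC t * z)%C) T).
      { apply (continuous_comp (fun t => RtoC t * z)%C f1); [apply continuous_RtoC_mult|].
        apply Hf. unfold disk. fold w. lra. }
      destruct (continuous_C_small _ T _ Hc1 Hk) as [d' Hd'].
      set (t := T - Rmin (T / 2) (Rmin (d / 2) (d' / 2))).
      assert (Hr : 0 < Rmin (T / 2) (Rmin (d / 2) (d' / 2)))
        by (destruct d, d'; simpl; repeat apply Rmin_pos; lra).
      assert (R1 : Rmin (T / 2) (Rmin (d / 2) (d' / 2)) <= T / 2) by apply Rmin_l.
      assert (R2 : Rmin (T / 2) (Rmin (d / 2) (d' / 2)) <= d / 2)
        by (eapply Rle_trans; [apply Rmin_r|apply Rmin_l]).
      assert (R3 : Rmin (T / 2) (Rmin (d / 2) (d' / 2)) <= d' / 2)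
        by (eapply Rle_trans; [apply Rmin_r|apply Rmin_r]).
      assert (Hd0 := cond_pos d). assert (Hd'0 := cond_pos d').
      assert (Ht : 0 <= t < T) by (unfold t; lra).
      assert (Hct : Cmod (RtoC t * z) <= Cmod z) by (apply Hseg; lra).
      assert (L : m / 2 <= 2 * s * Cmod (f1 (RtoC t * z)%C)).
      { apply (injective_derivative_lower_bound f f1 _ e); try assumption.
        - unfold s, e. lra.
        - unfold s, e. lra.
        - unfold e. lra.
        - lra.
        - now apply HTlt.
        - intros th Hth. specialize (Hmin th Hth).
          assert (D := Hd th T th t Hth ltac:(lra) Hth ltac:(unfold t in *; lra)).
          rewrite Rminus_diag, Rabs_R0 in D. specialize (D Hd0).
          apply Rabs_def2 in D. fold w in D. lra. }
      assert (L2 : Cmod (f1 (RtoC t * z)%C) < m / (4 * s)).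
      { assert (D := Hd' t). unfold w in ET. rewrite ET in D.
        replace (f1 (RtoC t * z) - 0)%C with (f1 (RtoC t * z)%C) in D by ring.
        apply D. change (Rabs (t - T) < d'). apply Rabs_def1; unfold t; lra. }
      apply (Rmult_lt_compat_l (2 * s)) in L2; [|unfold s, e; lra].
      replace (2 * s * (m / (4 * s))) with (m / 2) in L2 by (field; unfold s, e; lra).
      lra.
Qed.

(** * Convex maps: starlikeness and convexity inequalities *)

Section ConvexMap.
Variables g g1 : C -> C.
Hypothesis g_hol : hol_on_disk g g1.
Hypothesis g_inj : injective_on_disk g.
Hypothesis g1_neq_0 : forall z, disk z -> g1 z <> 0%C.

(** The solution [G] of [g o G = m] is continuous because the inverse of [g] is;
    the difference quotients of [G] are then those of [m] divided by those of
    [g]. *)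
Lemma hol_at_lift (G m m1 : C -> C) :
  hol_on_disk m m1 -> (forall u, disk u -> disk (G u) /\ g (G u) = m u) ->
  hol_on_disk G (fun u => m1 u / g1 (G u))%C.
Proof.
  intros Hm HG.
  assert (Gc : forall u, disk u -> continuous G u).
  { intros u Hu. apply continuous_C_eps. intros eps Heps.
    destruct (HG u Hu) as [A B].
    destruct (injective_inverse_continuous g g1 g_hol g_inj (G u) eps A Heps) as (d & Hd & H).
    destruct (locally_C_ball u _ (filter_and _ _ (locally_Cmod_lt u 1 Hu)
      (continuous_C_small m u d (hol_at_continuous m m1 u (Hm u Hu)) Hd))) as (e & He & K).
    exists e. split; [exact He|]. intros w Hw. destruct (K w Hw) as [W1 W2].
    destruct (HG w W1) as [A' B']. apply H; [exact A'|]. now rewrite B, B'. }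
  intros u Hu. destruct (HG u Hu) as [A B].
  destruct (g_hol (G u) A) as [(q & Hq & Eq & E) Hg1].
  destruct (Hm u Hu) as [(r & Hr & Er & E') Hm1].
  assert (Hqc : continuous (fun v => q (G v)) u)
    by (apply (continuous_comp G q); [now apply Gc|exact Hq]).
  assert (Hq0 : q (G u) <> 0%C) by (rewrite Eq; now apply g1_neq_0).
  split.
  - exists (fun v => r v / q (G v))%C. split; [|split].
    + now apply continuous_Cdiv.
    + now rewrite Eq, Er.
    + assert (EG : locally (T := C_UniformSpace) u
        (fun v => g (G v) - g (G u) = (G v - G u) * q (G v))%C) by exact (Gc u Hu _ E).
      generalize (filter_and _ _ (filter_and _ _ EG E')
        (filter_and _ _ (locally_neq_0 _ u Hqc Hq0) (locally_Cmod_lt u 1 Hu))).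
      apply filter_imp. intros v [[V1 V2] [V3 V4]].
      destruct (HG v V4) as [_ B']. rewrite B, B', V2 in V1.
      transitivity ((G v - G u) * q (G v) / q (G v))%C; [cfield; exact V3|].
      rewrite <- V1. cfield. exact V3.
  - apply continuous_Cdiv; [exact Hm1| |now apply g1_neq_0].
    apply (continuous_comp G g1); [now apply Gc|exact Hg1].
Qed.

Hypothesis g_convex : convex_set (image_of_disk g).

(** The point [v] is [G z] for the holomorphic [G] with
    [g (G u) = (1 - t) * g u + t * g (w * u)], to which the Schwarz lemma
    applies. *)
Lemma convex_subordination (w z : C) (t : R) :
  Cmod w <= 1 -> 0 <= t <= 1 -> disk z ->
  exists v, Cmod v <= Cmod z /\ g v = (RtoC (1 - t) * g z + RtoC t * g (w * z))%C.
Proof.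
  intros Hw Ht Hz.
  assert (Hwu : forall u, disk u -> disk (w * u)).
  { unfold disk. intros u Hu. rewrite Cmod_mult.
    generalize (Cmod_ge_0 u) (Cmod_ge_0 w). nra. }
  pose (m := fun u => (RtoC (1 - t) * g u + RtoC t * g (w * u))%C).
  assert (HE : forall u, exists v, disk u -> disk v /\ g v = m u).
  { intros u. destruct (classic (disk u)) as [Hu|]; [|exists 0%C; tauto].
    destruct (g_convex (g u) (g (w * u)%C) t) as (v & Hv); [now exists u| |exact Ht|].
    - exists (w * u)%C. split; [now apply Hwu|reflexivity].
    - exists v. now intros _. }
  pose (G := fun u => proj1_sig (constructive_indefinite_description _ (HE u))).
  assert (HG : forall u, disk u -> disk (G u) /\ g (G u) = m u).
  { intros u Hu. unfold G. now destruct (constructive_indefinite_description _ (HE u)) as [v Hv]; apply Hv. }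
  exists (G z). split; [|now apply HG].
  eapply schwarz_lemma; [apply (hol_at_lift G m); [|exact HG]| |
    |exact Hz].
  - intros u Hu. apply hol_at_plus; apply hol_at_scal; [now apply g_hol|].
    apply (hol_at_comp g g1); [apply hol_at_scal, hol_at_id|now apply g_hol, Hwu].
  - intros u Hu. now apply HG.
  - assert (D0 : disk 0%C) by (unfold disk; rewrite Cmod_0; lra).
    destruct (HG 0%C D0) as [A B]. apply g_inj; [exact A|exact D0|].
    rewrite B. unfold m. replace (w * 0)%C with (RtoC 0) by ring.
    rewrite RtoC_minus. ring.
Qed.

(** Differentiation at [t = 0] of [Cmod v ^ 2 <= Cmod z ^ 2] along the points
    [v] with [g v = (1 - t) * g z + t * g (w * z)]. *)
Lemma convex_two_point (w z : C) :
  Cmod w <= 1 -> disk z -> 0 <= Re (Cconj z * ((g z - g (w * z)) / g1 z)).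
Proof.
  intros Hw Hz.
  destruct (Rle_lt_dec 0 (Re (Cconj z * ((g z - g (w * z)) / g1 z)))) as [|Hneg];
    [assumption|exfalso].
  set (X := (g (w * z) - g z)%C).
  destruct (g_hol z Hz) as [(q & Hq & Eq & E) _].
  assert (Hq0 : q z <> 0%C) by (rewrite Eq; now apply g1_neq_0).
  assert (Hpos : 0 < Re (Cconj z * (X / q z))).
  { replace (Cconj z * (X / q z))%C with (- (Cconj z * ((g z - g (w * z)) / g1 z)))%C.
    - change (0 < - Re (Cconj z * ((g z - g (w * z)) / g1 z))). lra.
    - rewrite Eq. unfold X. field. now apply g1_neq_0. }
  assert (Hc : continuous (fun v => Re (Cconj z * (X / q v))) z).
  { apply continuous_Re, continuous_Cmult; [apply continuous_const|].
    apply continuous_Cdiv; [apply continuous_const|exact Hq|exact Hq0]. }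
  destruct (locally_C_ball z _ (filter_and _ _ (filter_and _ _ E (locally_neq_0 q z Hq Hq0))
    (Hc _ (open_gt 0 _ Hpos)))) as (e & He & K).
  destruct (injective_inverse_continuous g g1 g_hol g_inj z e Hz He) as (d & Hd & H).
  assert (HX := Cmod_ge_0 X).
  set (t := Rmin 1 (d / (2 * (Cmod X + 1)))).
  assert (Ht : 0 < t <= 1).
  { split; [apply Rmin_pos; [lra|apply Rdiv_lt_0_compat; lra]|apply Rmin_l]. }
  assert (Htd : t * Cmod X < d).
  { assert (T : t <= d / (2 * (Cmod X + 1))) by apply Rmin_r.
    apply (Rmult_le_compat_r (2 * (Cmod X + 1))) in T; [|lra].
    replace (d / (2 * (Cmod X + 1)) * (2 * (Cmod X + 1))) with d in T by (field; lra). nra. }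
  destruct (convex_subordination w z t Hw ltac:(lra) Hz) as (v & Hv & Ev).
  assert (Ev' : (g v - g z)%C = (RtoC t * X)%C).
  { rewrite Ev, RtoC_minus. unfold X. ring. }
  destruct (K v) as [[K1 K2] K3].
  { apply H; [unfold disk in *; lra|]. rewrite Ev', Cmod_RtoC_mult, Rabs_pos_eq; lra. }
  rewrite Ev' in K1.
  set (Y := (X / q v)%C) in K3.
  assert (Evz : v = (z + RtoC t * Y)%C).
  { transitivity (z + (v - z) * q v / q v)%C; [field; exact K2|].
    rewrite <- K1. unfold Y. field. exact K2. }
  assert (F : Cmod z ^ 2 < Cmod v ^ 2).
  { rewrite Evz, !Cmod2_alt. destruct z as [a b], Y as [p s].
    unfold Re, Im, Cconj, Cmult, Cplus, RtoC in *. simpl in *. nra. }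
  generalize (Cmod_ge_0 v). nra.
Qed.

End ConvexMap.

Lemma second_derivative_at_min (k k1 : R -> R) (l : R) :
  (forall x, is_derive k x (k1 x)) -> k1 0 = 0 -> is_derive k1 0 l ->
  (forall x, k 0 <= k x) -> 0 <= l.
Proof.
  intros Hk H0 Hk1 Hmin. destruct (Rle_lt_dec 0 l) as [|Hl]; [assumption|exfalso].
  destruct (is_derive_difference_quotient k1 0 l Hk1) as (q & Hq & <- & E).
  destruct (Hq _ (open_lt 0 _ Hl)) as [d Hd]. assert (Hd0 := cond_pos d).
  destruct (MVT_cor2 k k1 0 (d / 2)) as (c & Ec & Hc).
  - lra.
  - intros x _. apply is_derive_Reals, Hk.
  - assert (k1 c < 0).
    { specialize (E c). rewrite H0 in E. replace (k1 c) with (c * q c) by lra.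
      assert (q c < 0); [|nra].
      apply Hd. change (Rabs (c - 0) < d). rewrite Rabs_pos_eq; lra. }
    specialize (Hmin (d / 2)). nra.
Qed.

Lemma Re_Cconj_mult (z w : C) : z <> 0%C -> Re (Cconj z * w) = Cmod z ^ 2 * Re (w / z).
Proof.
  intros Hz. apply Cnorm2_neq_0 in Hz. rewrite Cmod2_alt'.
  destruct z as [a b], w as [x y]. simpl in Hz.
  unfold Re, Cconj, Cdiv, Cinv, Cmult. simpl. field. lra.
Qed.

(** Along [w = cis eta] the two-point inequality has a minimum at [eta = 0],
    where its second derivative is the left-hand side. *)
Lemma convex_map_criterion (g g1 g2 : C -> C) :
  hol_on_disk g g1 -> hol_on_disk g1 g2 -> injective_on_disk g ->
  (forall z, disk z -> g1 z <> 0%C) -> convex_set (image_of_disk g) ->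
  forall z, disk z -> 0 <= Re (1 + z * (g2 z / g1 z)).
Proof.
  intros Hg Hg1 Hinj H0 Hconv z Hz.
  destruct (classic (z = 0%C)) as [->|Hz0].
  { replace (1 + 0 * (g2 0 / g1 0))%C with (RtoC 1) by ring. simpl. lra. }
  assert (Hrot : forall x, disk (cis x * z)).
  { intros x. unfold disk. rewrite Cmod_mult, Cmod_cis. unfold disk in Hz. lra. }
  pose (c := (/ (z * g1 z))%C).
  assert (Hn := H0 z Hz).
  assert (Hcis : forall x, curve_deriv (fun x => cis x * z)%C x (Ci * cis x * z)).
  { intros x. apply (deriv_along_eq _ _ _ (Ci * cis x * z + cis x * 0)%C); [|cring].
    apply deriv_along_mult; [apply continuous_RtoC_id|apply curve_deriv_cis|apply deriv_along_const]. }
  apply (second_derivative_at_min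
    (fun x => Re (c * (g z - g (cis x * z)%C)))
    (fun x => Re (c * (- (Ci * z) * (cis x * g1 (cis x * z)%C))))).
  - intros x. eapply curve_deriv_Re_eq.
    + apply deriv_along_scal, deriv_along_minus; [apply deriv_along_const|].
      apply (deriv_along_comp RtoC (fun x => cis x * z)%C g);
        [apply continuous_RtoC_id|apply Hcis|apply Hg, Hrot].
    + f_equal. cring.
  - rewrite cis_0. replace (1 * z)%C with z by ring.
    replace (c * (- (Ci * z) * (1 * g1 z)))%C with (- Ci)%C by (unfold c; field; now split).
    simpl. ring.
  - eapply curve_deriv_Re_eq.
    + apply deriv_along_scal, deriv_along_scal, deriv_along_mult;
        [apply continuous_RtoC_id|apply curve_deriv_cis|].
      apply (deriv_along_comp RtoC (fun x => cis x * z)%C g1);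
        [apply continuous_RtoC_id|apply Hcis|apply Hg1, Hrot].
    + cbv beta. rewrite cis_0. replace (1 * z)%C with z by ring.
      f_equal.
      transitivity (- (Ci * Ci) * (1 + z * (g2 z / g1 z)))%C.
      * unfold c. field. now split.
      * replace (- (Ci * Ci))%C with (RtoC 1); [ring|].
        unfold Ci, RtoC, Copp, Cmult. simpl. f_equal; ring.
  - intros x. rewrite cis_0. replace (1 * z)%C with z by ring.
    replace (c * (g z - g z))%C with (RtoC 0) by ring.
    assert (T := convex_two_point g g1 Hg Hinj H0 Hconv (cis x) z
                   ltac:(rewrite Cmod_cis; lra) Hz).
    rewrite Re_Cconj_mult in T by exact Hz0.
    apply Cmod_gt_0 in Hz0. assert (0 < Cmod z ^ 2) by now apply pow_lt.
    replace (c * (g z - g (cis x * z)))%C with ((g z - g (cis x * z)) / g1 z / z)%C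
      by (unfold c; field; split; [exact Hn|now apply Cmod_gt_0]).
    change (0 <= Re ((g z - g (cis x * z)) / g1 z / z)%C). nra.
Qed.

Lemma Re_inv_nonneg (z : C) : z <> 0%C -> 0 <= Re z -> 0 <= Re (/ z).
Proof.
  intros Hz H. apply Cnorm2_neq_0 in Hz. destruct z as [x y].
  unfold Re, Cinv in *. simpl in *. apply Rmult_le_pos; [exact H|].
  left. apply Rinv_0_lt_compat. nra.
Qed.

Lemma convex_map_starlike (g g1 : C -> C) :
  hol_on_disk g g1 -> injective_on_disk g -> (forall z, disk z -> g1 z <> 0%C) ->
  convex_set (image_of_disk g) -> g 0%C = 0%C ->
  forall z, disk z -> z <> 0%C -> 0 <= Re (z * g1 z / g z).
Proof.
  intros Hg Hinj H0 Hconv G0 z Hz Hz0.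
  assert (D0 : disk 0%C) by (unfold disk; rewrite Cmod_0; lra).
  assert (Hgz : g z <> 0%C) by (intros E; apply Hz0, Hinj; congruence).
  assert (Hn := H0 z Hz).
  assert (T := convex_two_point g g1 Hg Hinj H0 Hconv 0%C z ltac:(rewrite Cmod_0; lra) Hz).
  replace (0 * z)%C with (RtoC 0) in T by ring. rewrite G0 in T.
  rewrite Re_Cconj_mult in T by exact Hz0.
  assert (0 < Cmod z ^ 2) by now apply pow_lt, Cmod_gt_0.
  replace (z * g1 z / g z)%C with (/ ((g z - 0) / g1 z / z))%C.
  - apply Re_inv_nonneg; [|nra].
    replace ((g z - 0) / g1 z / z)%C with (g z * (/ g1 z * / z))%C by (field; now split).
    apply Cmult_neq_0; [exact Hgz|]. 
    intros E. apply (f_equal (fun x => x * (g1 z * z))%C) in E.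
    replace (/ g1 z * / z * (g1 z * z))%C with (RtoC 1) in E by (field; now split).
    replace (0 * (g1 z * z))%C with (RtoC 0) in E by ring. apply RtoC_inj in E. lra.
  - field. repeat split; assumption.
Qed.

(** * Growth of convex maps *)

Lemma nonincreasing_of_derive (k k1 : R -> R) (a b : R) :
  a <= b -> (forall t, a <= t <= b -> is_derive k t (k1 t)) ->
  (forall t, a < t < b -> k1 t <= 0) -> k b <= k a.
Proof.
  intros [Hab| ->] Hk Hn; [|lra].
  destruct (MVT_cor2 k k1 a b Hab) as (c & Ec & Hc).
  - intros t Ht. now apply is_derive_Reals, Hk.
  - specialize (Hn c Hc). nra.
Qed.

Lemma is_derive_ln_1_minus (r t : R) :
  t * r < 1 -> is_derive (fun t => ln (1 - t * r)) t (- r / (1 - t * r)).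
Proof. intros H. auto_derive; [lra|field; lra]. Qed.

Lemma ray_in_disk (z : C) (t : R) : disk z -> 0 <= t <= 1 ->
  Cmod (RtoC t * z) = t * Cmod z /\ t * Cmod z <= Cmod z.
Proof.
  intros Hz Ht. rewrite Cmod_RtoC_mult, Rabs_pos_eq by lra.
  split; [reflexivity|]. generalize (Cmod_ge_0 z). nra.
Qed.

Lemma curve_deriv_ray (F F1 : C -> C) (z : C) (t : R) :
  hol_at F F1 (RtoC t * z)%C ->
  curve_deriv (fun t => F (RtoC t * z)%C) t (F1 (RtoC t * z) * z)%C.
Proof.
  intros [H _]. apply (deriv_along_comp RtoC (fun t => RtoC t * z)%C F);
    [apply continuous_RtoC_id| |exact H].
  apply (deriv_along_eq _ _ _ (1 * z + RtoC t * 0)%C); [|cring].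
  apply deriv_along_mult; [apply continuous_RtoC_id|apply deriv_along_embedding|
    apply deriv_along_const].
Qed.

(** Integration of [harnack_gradient] for [Q = g2 / g1] along the radius, by the
    decomposition [2 (a + r) / (1 - r^2) = (1 + a) / (1 - r) - (1 - a) / (1 + r)];
    the last term contributes at most [a]. *)
Lemma derivative_growth (g1 g2 g3 : C -> C) (a : R) :
  hol_on_disk g1 g2 -> hol_on_disk g2 g3 -> (forall z, disk z -> g1 z <> 0%C) ->
  (forall z, disk z -> 0 <= Re (1 + z * (g2 z / g1 z))) ->
  Cmod (g2 0 / g1 0)%C = 2 * a ->
  forall z, disk z ->
  ln (Cmod (g1 z)) <= ln (Cmod (g1 0%C)) - (1 + a) * ln (1 - Cmod z) + a.
Proof.
  intros H1 H2 H0 Hpos Ha z Hz. assert (Hm := Cmod_ge_0 z).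
  assert (Ha0 : 0 <= a) by (generalize (Cmod_ge_0 (g2 0 / g1 0)%C); lra).
  set (r := Cmod z) in *. unfold disk in Hz. fold r in Hz.
  assert (Hray : forall t, 0 <= t <= 1 -> disk (RtoC t * z)).
  { intros t Ht. destruct (ray_in_disk z t Hz Ht) as [E L]. unfold disk. rewrite E. fold r in L |- *. lra. }
  assert (K : forall t, 0 < t < 1 ->
    Re (g2 (RtoC t * z) * z / g1 (RtoC t * z))%C
    <= (1 + a) * (r / (1 - t * r)) + a).
  { intros t Ht. set (w := (RtoC t * z)%C).
    assert (Hw : disk w) by (apply Hray; lra).
    assert (Ew : Cmod w = t * r) by (apply ray_in_disk; [exact Hz|lra]).
    assert (G := harnack_gradient (fun z => g2 z / g1 z)%C _ w
      (fun u Hu => hol_at_div _ _ _ _ u (H2 u Hu) (H1 u Hu) (H0 u Hu)) Hpos Hw).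
    cbv beta in G. rewrite Ha, Ew in G.
    set (x := Re _).
    assert (Ex : Re (1 + w * (g2 w / g1 w)) = 1 + t * x).
    { unfold x. replace (g2 w * z / g1 w)%C with (z * (g2 w / g1 w))%C
        by (field; now apply H0).
      unfold w at 1. destruct (g2 w / g1 w)%C, z. unfold Re, Cplus, Cmult, RtoC. simpl. ring. }
    rewrite Ex in G.
    assert (Htr : 0 <= t * r < 1) by (split; nra).
    assert (D : x * (1 - (t * r) ^ 2) <= r * (2 * (t * r) + 2 * a)).
    { apply (Rmult_le_reg_l t); [lra|]. nra. }
    apply (Rmult_le_reg_r (1 - (t * r) ^ 2)); [nra|].
    apply Rle_trans with (1 := D).
    replace (((1 + a) * (r / (1 - t * r)) + a) * (1 - (t * r) ^ 2))
      with ((1 + a) * r * (1 + t * r) + a * (1 - (t * r) ^ 2)) by (field; lra).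
    assert (0 <= a * (1 - (t * r) ^ 2 - r * (1 - t * r))).
    { apply Rmult_le_pos; [exact Ha0|]. nra. }
    assert (0 <= r * (1 - t * r)) by (apply Rmult_le_pos; lra).
    nra. }
  pose (k := fun t => ln (Cmod (g1 (RtoC t * z)%C)) + ((1 + a) * ln (1 - t * r) - a * t)).
  assert (N : k 1 <= k 0).
  { apply (nonincreasing_of_derive k (fun t => Re (g2 (RtoC t * z) * z / g1 (RtoC t * z))%C
      + ((1 + a) * (- r / (1 - t * r)) - a * 1))); [lra| |].
    - intros t Ht.
      assert (Hw := Hray t Ht).
      apply (is_derive_plus (V := R_NormedModule)).
      + apply (curve_deriv_ln_Cmod (fun t => g1 (RtoC t * z)%C)); [|now apply H0].
        apply curve_deriv_ray, H1, Hw.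
      + apply (is_derive_minus (V := R_NormedModule)).
        * apply is_derive_scal. apply is_derive_ln_1_minus. nra.
        * apply is_derive_scal. apply (is_derive_id (K := R_AbsRing)).
    - intros t Ht. specialize (K t Ht).
      replace ((1 + a) * (- r / (1 - t * r))) with (- ((1 + a) * (r / (1 - t * r))))
        by (field; nra). lra. }
  unfold k in N. replace (RtoC 1 * z)%C with z in N by ring.
  replace (RtoC 0 * z)%C with (RtoC 0) in N by ring.
  replace (1 - 0 * r) with 1 in N by ring. rewrite ln_1 in N.
  replace (1 - 1 * r) with (1 - r) in N by ring. lra.
Qed.

Lemma Rpower_1_minus_derive (c r t : R) :
  t * r < 1 -> is_derive (fun t => Rpower (1 - t * r) c) t
    (- (c * r) * Rpower (1 - t * r) (c - 1)).
Proof.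
  intros H. unfold Rpower.
  apply (is_derive_eq _ _ (c * (- r / (1 - t * r)) * exp (c * ln (1 - t * r)))).
  - replace ((c - 1) * ln (1 - t * r)) with (c * ln (1 - t * r) + - ln (1 - t * r)) by ring.
    rewrite exp_plus, exp_Ropp, exp_ln by lra. field. lra.
  - apply (is_derive_comp exp (fun t => c * ln (1 - t * r))).
    + apply is_derive_Reals, derivable_pt_lim_exp.
    + now apply is_derive_scal, is_derive_ln_1_minus.
Qed.

Lemma function_growth (f f1 : C -> C) (K a : R) :
  hol_on_disk f f1 -> f 0%C = 0%C -> 0 < K -> 0 < a ->
  (forall z, disk z -> Cmod (f1 z) <= K * Rpower (1 - Cmod z) (- (1 + a))) ->
  forall z, disk z -> Cmod (f z) <= K / a * Rpower (1 - Cmod z) (- a).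
Proof.
  intros Hf F0 HK Ha Hgr z Hz. assert (Hm := Cmod_ge_0 z).
  destruct (rotate_to_modulus (f z)) as (c & Hc & E).
  set (r := Cmod z) in *. unfold disk in Hz. fold r in Hz.
  pose (k := fun t => Re (c * f (RtoC t * z))%C - K / a * Rpower (1 - t * r) (- a)).
  assert (N : k 1 <= k 0).
  { apply (nonincreasing_of_derive k (fun t => Re (c * (f1 (RtoC t * z) * z))%C
      - K / a * (- (- a * r) * Rpower (1 - t * r) (- a - 1)))); [lra| |].
    - intros t Ht. destruct (ray_in_disk z t Hz Ht) as [L1 L2].
      apply (is_derive_minus (V := R_NormedModule)).
      + apply (curve_deriv_Re (fun t => c * f (RtoC t * z))%C).
        apply deriv_along_scal, curve_deriv_ray, Hf. unfold disk. fold r in L1, L2. lra.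
      + apply is_derive_scal, Rpower_1_minus_derive. fold r in L2. lra.
    - intros t Ht. destruct (ray_in_disk z t Hz ltac:(lra)) as [L1 L2]. fold r in L1, L2.
      replace (K / a * (- (- a * r) * Rpower (1 - t * r) (- a - 1)))
        with (K * Rpower (1 - t * r) (- a - 1) * r) by (field; lra).
      assert (Re (c * (f1 (RtoC t * z) * z))%C <= K * Rpower (1 - t * r) (- a - 1) * r); [|lra].
      apply Rle_trans with (1 := Re_le_Cmod _).
      rewrite !Cmod_mult, Hc, Rmult_1_l. fold r. apply Rmult_le_compat_r; [exact Hm|].
      rewrite <- L1. replace (- a - 1) with (- (1 + a)) by ring. apply Hgr.
      unfold disk. lra. }
  unfold k in N. replace (RtoC 1 * z)%C with z in N by ring.
  replace (RtoC 0 * z)%C with (RtoC 0) in N by ring. rewrite F0, E in N.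
  replace (c * 0)%C with (RtoC 0) in N by ring. simpl in N.
  replace (1 - 1 * r) with (1 - r) in N by ring.
  assert (0 <= K / a * Rpower (1 - 0 * r) (- a)).
  { apply Rmult_le_pos; [apply Rlt_le, Rdiv_lt_0_compat; lra|left; apply exp_pos]. }
  lra.
Qed.

(** * Integral means of starlike maps *)

Lemma Rpower_le_base (x y p : R) : 0 < x -> x <= y -> 0 < p -> Rpower x p <= Rpower y p.
Proof. intros. apply Rle_Rpower_l; lra. Qed.

(** Prawitz's argument: with [D = z h' / h], the integral mean of [|h| ^ p]
    has derivative [p / t] times that of [|h| ^ p * Re D], where [Re D >= 0]
    has mean value [1]. *)
Lemma starlike_integral_means (h h1 D D1 : C -> C) (K gam p : R) :
  hol_on_disk h h1 -> (forall z, disk z -> z <> 0%C -> h z <> 0%C) ->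
  (forall z, disk z -> z <> 0%C -> hol_at D D1 z) -> continuous D (RtoC 0) -> D 0%C = 1%C ->
  (forall z, disk z -> z <> 0%C -> D z = (z * h1 z / h z)%C /\ 0 <= Re (D z)) ->
  0 < K -> 0 < p -> p * gam < 1 ->
  (forall z, disk z -> Cmod (h z) <= K * Rpower (1 - Cmod z) (- gam)) ->
  exists B, forall r, / 2 <= r < 1 ->
    RInt (fun th => Rpower (Cmod (h (circ r th))) p) 0 (2 * PI) <= B.
Proof.
  intros Hh H0 HD HD0 ED0 HDh HK Hp Hpg Hgr. assert (HPI := PI_RGT_0).
  assert (Hdisk : forall t th, 0 < t < 1 -> disk (circ t th) /\ circ t th <> 0%C).
  { intros t th Ht. split.
    - unfold disk. rewrite Cmod_circ; lra.
    - apply Cmod_gt_0. rewrite Cmod_circ; lra. }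
  pose (P := fun t th => Rpower (Cmod (h (circ t th))) p).
  pose (Pt := fun t th => p * Re (h1 (circ t th) * cis th / h (circ t th))%C * P t th).
  assert (Hc2 : forall t th, continuous (fun q : R * R => circ (fst q) (snd q)) (t, th)).
  { intros t th. unfold circ. apply continuous_Cmult;
      [apply continuous_fst_along, continuous_RtoC_id|apply continuous_snd_along, continuous_cis]. }
  assert (Hpow : forall (U : UniformSpace) (F : U -> C) x, continuous F x -> F x <> 0%C ->
     continuous (fun y => Rpower (Cmod (F y)) p) x).
  { intros U F x HF HF0. unfold Rpower.
    apply (continuous_comp (fun y => p * ln (Cmod (F y))) exp); [|apply continuous_exp].
    apply (continuous_mult (K := R_AbsRing)); [apply continuous_const|].
    apply (continuous_comp (fun y => Cmod (F y)) ln); [now apply continuous_Cmod|].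
    apply continuous_ln. now apply Cmod_gt_0. }
  assert (Phc : forall t th, 0 < t < 1 ->
     continuous (fun q : R * R => h (circ (fst q) (snd q))) (t, th)).
  { intros t th Ht. apply (continuous_comp (fun q : R * R => circ (fst q) (snd q)) h);
      [apply Hc2|]. apply (hol_at_continuous h h1), Hh, Hdisk, Ht. }
  assert (Pder : forall t th, 0 < t < 1 -> is_derive (fun u => P u th) t (Pt t th)).
  { intros t th Ht. destruct (Hdisk t th Ht) as [A A0].
    apply (is_derive_comp exp (fun u => p * ln (Cmod (h (circ u th))))).
    - apply is_derive_Reals, derivable_pt_lim_exp.
    - apply is_derive_scal, (curve_deriv_ln_Cmod (fun u => h (circ u th))); [|now apply H0].
      apply curve_deriv_ray, Hh, A. }
  assert (Pcont : forall t th, 0 < t < 1 -> continuous (P t) th).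
  { intros t th Ht. destruct (Hdisk t th Ht) as [A A0]. apply Hpow; [|now apply H0].
    apply (continuous_along_circ h), (hol_at_continuous h h1), Hh, A. }
  assert (Ptcont : forall t th, 0 < t < 1 ->
     continuous (fun q : R * R => Pt (fst q) (snd q)) (t, th)).
  { intros t th Ht. destruct (Hdisk t th Ht) as [A A0]. unfold Pt.
    apply (continuous_mult (K := R_AbsRing)).
    - apply (continuous_mult (K := R_AbsRing)); [apply continuous_const|].
      apply continuous_Re, continuous_Cdiv; [|now apply Phc|now apply H0].
      apply continuous_Cmult; [|apply continuous_snd_along, continuous_cis].
      apply (continuous_comp (fun q : R * R => circ (fst q) (snd q)) h1);
        [apply Hc2|]. apply Hh, A.
    - apply Hpow; [now apply Phc|now apply H0]. }
  set (b := p * gam) in *.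
  set (A := 4 * PI * p * Rpower K p / (1 - b)).
  pose (k := fun t => RInt (P t) 0 (2 * PI) + A * Rpower (1 - t * 1) (1 - b)).
  assert (Hder : forall t, 0 < t < 1 ->
    is_derive k t (RInt (Pt t) 0 (2 * PI) + A * (- ((1 - b) * 1) * Rpower (1 - t * 1) (1 - b - 1)))).
  { intros t Ht. apply (is_derive_plus (V := R_NormedModule)).
    - now apply (is_derive_circle_integral P Pt 0 1).
    - apply is_derive_scal, Rpower_1_minus_derive. lra. }
  assert (Hneg : forall t, / 2 <= t < 1 ->
    RInt (Pt t) 0 (2 * PI) <= 4 * PI * p * Rpower K p * Rpower (1 - t) (- b)).
  { intros t Ht. assert (Ht' : 0 < t < 1) by lra.
    set (M := p * (2 * (Rpower K p * Rpower (1 - t) (- b)))).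
    replace (4 * PI * p * Rpower K p * Rpower (1 - t) (- b)) with (2 * PI * Re (RtoC M * D 0%C)).
    2: { rewrite ED0. unfold Re, Cmult, RtoC, M. simpl. ring. }
    rewrite <- (mean_value (fun z => RtoC M * D z)%C (fun z => RtoC M * D1 z)%C 1 t).
    - apply RInt_circle_le.
      + intros th. apply (continuous_comp_2 (fun _ => t) (fun y => y) Pt);
          [apply continuous_const|apply continuous_id|now apply Ptcont].
      + intros th. destruct (Hdisk t th Ht') as [A1 A0].
        apply continuous_Re, continuous_Cmult; [apply continuous_const|].
        apply continuous_along_circ, (hol_at_continuous D D1). now apply HD.
      + intros th _. destruct (Hdisk t th Ht') as [A1 A0].
        destruct (HDh _ A1 A0) as [E Hpos]. assert (Hh0 := H0 _ A1 A0).
        replace (Re (RtoC M * D (circ t th))) with (M * Re (D (circ t th)))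
          by (destruct (D (circ t th)); unfold Re, Cmult, RtoC; simpl; ring).
        unfold Pt.
        replace (Re (h1 (circ t th) * cis th / h (circ t th))%C) with (/ t * Re (D (circ t th))).
        * replace (p * (/ t * Re (D (circ t th))) * P t th)
            with (p * (/ t * P t th) * Re (D (circ t th))) by ring.
          apply Rmult_le_compat_r; [exact Hpos|]. unfold M.
          apply Rmult_le_compat_l; [lra|].
          apply Rmult_le_compat.
          -- left. apply Rinv_0_lt_compat. lra.
          -- left. apply exp_pos.
          -- rewrite <- (Rinv_inv 2). apply Rinv_le_contravar; lra.
          -- unfold P.
             replace (Rpower K p * Rpower (1 - t) (- b))
               with (Rpower (K * Rpower (1 - t) (- gam)) p).
             ++ apply Rpower_le_base; [now apply Cmod_gt_0| |exact Hp].
                specialize (Hgr _ A1). rewrite Cmod_circ in Hgr by lra. exact Hgr.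
             ++ rewrite <- Rpower_mult_distr by (try apply exp_pos; exact HK).
                rewrite Rpower_mult. unfold b. do 2 f_equal. ring.
        * rewrite E.
          replace (circ t th * h1 (circ t th) / h (circ t th))%C
            with (RtoC t * (h1 (circ t th) * cis th / h (circ t th)))%C
            by (unfold circ at 3; field; exact Hh0).
          destruct (h1 (circ t th) * cis th / h (circ t th))%C as [x y].
          unfold Re, Cmult, RtoC. simpl. field. lra.
    - lra.
    - lra.
    - intros z Hz Hz0. now apply hol_at_scal, HD.
    - apply continuous_Cmult; [apply continuous_const|exact HD0]. }
  exists (k (/ 2)). intros r Hr.
  apply Rle_trans with (k r).
  - unfold k, P. assert (0 <= A * Rpower (1 - r * 1) (1 - b)); [|lra].
    apply Rmult_le_pos; [|left; apply exp_pos]. apply Rlt_le, Rdiv_lt_0_compat; [|lra].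
    apply Rmult_lt_0_compat; [|apply exp_pos]. nra.
  - eapply nonincreasing_of_derive.
    + apply Hr.
    + intros t Ht. apply Hder. lra.
    + intros t Ht. cbv beta. specialize (Hneg t ltac:(lra)).
      replace (1 - b - 1) with (- b) by ring. replace (1 - t * 1) with (1 - t) by ring.
      replace (A * (- ((1 - b) * 1) * Rpower (1 - t) (- b)))
        with (- (4 * PI * p * Rpower K p * Rpower (1 - t) (- b))) by (unfold A; field; lra).
      lra.
Qed.

(** * Sums of power series in the disk *)

Lemma pow_n_Cpow (z : C) (n : nat) : pow_n (K := C_Ring) z n = (z ^ n)%C.
Proof. induction n as [|n IH]; [reflexivity|]. simpl. now rewrite IH. Qed.

Lemma is_series_C_eps (u : nat -> C) (l : C) (eps : R) :
  is_series (K := C_AbsRing) (V := C_NormedModule) u l -> 0 < eps ->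
  exists N, forall n, (N <= n)%nat ->
    Cmod (sum_n (G := C_AbelianMonoid) u n - l) < eps.
Proof.
  intros H He.
  assert (H' := proj1 (filterlim_locally_ball_norm (U := C_NormedModule) (F := eventually) _ _) H).
  destruct (H' (mkposreal eps He)) as [N HN]. exists N. intros n Hn. exact (HN n Hn).
Qed.

Lemma is_series_C_norm_le (u : nat -> C) (b : nat -> R) (l : C) (B : R) :
  is_series (K := C_AbsRing) (V := C_NormedModule) u l ->
  (forall n, Cmod (u n) <= b n) -> (forall n, sum_n b n <= B) -> Cmod l <= B.
Proof.
  intros Hu Hb HB. apply Rle_plus_epsilon. intros eps He.
  destruct (is_series_C_eps u l eps Hu He) as [N HN]. specialize (HN N (le_n N)).
  assert (S : Cmod (sum_n (G := C_AbelianMonoid) u N) <= B).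
  { apply Rle_trans with (2 := HB N).
    apply Rle_trans with (sum_n (fun n => Cmod (u n)) N).
    - apply (norm_sum_n_m (V := C_NormedModule) u 0 N).
    - apply sum_n_m_le, Hb. }
  set (s := sum_n (G := C_AbelianMonoid) u N) in *.
  assert (T := Cmod_triangle s (- (s - l))).
  replace (s + - (s - l))%C with l in T by ring. rewrite Cmod_opp in T. lra.
Qed.

Lemma eventually_bounded (u : nat -> R) (B : R) (N : nat) :
  (forall n, (N <= n)%nat -> u n <= B) -> exists M, forall n, u n <= M.
Proof.
  intros K.
  assert (G : forall k, exists M', B <= M' /\ forall n, (n <= k)%nat -> u n <= M').
  { induction k as [|k [M' [H1 H2]]].
    - exists (Rmax B (u 0%nat)). split; [apply Rmax_l|]. intros n Hn.
      replace n with 0%nat by lia. apply Rmax_r.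
    - exists (Rmax M' (u (S k))). split; [apply Rle_trans with (1 := H1), Rmax_l|].
      intros n Hn. destruct (Nat.eq_dec n (S k)) as [->|]; [apply Rmax_r|].
      apply Rle_trans with M'; [apply H2; lia|apply Rmax_l]. }
  destruct (G N) as [M' [H1 H2]]. exists M'. intros n.
  destruct (Nat.le_gt_cases n N); [now apply H2|]. apply Rle_trans with B; [apply K; lia|exact H1].
Qed.

(** The terms of a convergent series are bounded, being differences of two
    partial sums close to the limit. *)
Lemma coefficients_bounded (a : nat -> C) (rho : R) (l : C) :
  0 <= rho -> is_pseries (K := C_AbsRing) (V := C_NormedModule) a (RtoC rho) l ->
  exists M, forall n, Cmod (a n) * rho ^ n <= M.
Proof.
  intros Hr H. pose (u := fun k => (pow_n (K := C_Ring) (RtoC rho) k * a k)%C).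
  assert (Hu : forall n, Cmod (u n) = Cmod (a n) * rho ^ n).
  { intros n. unfold u. rewrite pow_n_Cpow, Cmod_mult, Cmod_pow, Cmod_R, Rabs_pos_eq by lra.
    ring. }
  destruct (is_series_C_eps u l 1 H Rlt_0_1) as [N HN].
  destruct (eventually_bounded (fun n => Cmod (u n)) 2 (S N)) as [M HM].
  - intros [|n] Hn; [lia|].
    assert (A := HN n ltac:(lia)). assert (B := HN (S n) ltac:(lia)).
    rewrite sum_Sn in B. set (s := sum_n (G := C_AbelianMonoid) u n) in *.
    change (Cmod (s + u (S n) - l) < 1) in B.
    assert (T := Cmod_triangle (s + u (S n) - l) (- (s - l))).
    replace (s + u (S n) - l + - (s - l))%C with (u (S n)) in T by ring.
    rewrite Cmod_opp in T. lra.
  - exists M. intros n. rewrite <- Hu. apply HM.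
Qed.

(** [n + 1 <= c * (1 + e) ^ n] by Bernoulli's inequality, with [e] so small
    that the geometric decay survives. *)
Lemma ex_series_quadratic_geometric (q : R) :
  0 <= q < 1 -> ex_series (fun n => (INR n + 1) * (INR n + 2) * q ^ n).
Proof.
  intros Hq. set (e := (1 - q) / 4). set (c := / e).
  assert (He : 0 < e <= / 4) by (unfold e; lra).
  assert (Hce : e * c = 1) by (unfold c; field; lra).
  assert (Hc : 1 <= c) by nra.
  assert (Hn : forall n, INR n + 1 <= c * (1 + e) ^ n).
  { intros n. assert (P := poly n e ltac:(lra)). assert (N := pos_INR n).
    apply Rle_trans with (c * (1 + INR n * e)); [nra|]. apply Rmult_le_compat_l; lra. }
  apply (ex_series_le (V := R_CompleteNormedModule) _
     (fun n => 2 * c ^ 2 * (q * (1 + e) ^ 2) ^ n)).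
  - intros n. assert (N := pos_INR n). assert (Hqn : 0 <= q ^ n) by (apply pow_le; lra).
    change (Rabs ((INR n + 1) * (INR n + 2) * q ^ n) <= 2 * c ^ 2 * (q * (1 + e) ^ 2) ^ n).
    rewrite Rabs_pos_eq by (apply Rmult_le_pos; [nra|exact Hqn]).
    rewrite Rpow_mult_distr, <- pow_mult, Nat.mul_comm, pow_mult.
    replace (2 * c ^ 2 * (q ^ n * ((1 + e) ^ n) ^ 2))
      with ((c * (1 + e) ^ n) * (2 * (c * (1 + e) ^ n)) * q ^ n) by ring.
    apply Rmult_le_compat_r; [exact Hqn|]. specialize (Hn n).
    apply Rmult_le_compat; lra.
  - apply (ex_series_scal (V := R_NormedModule)). apply ex_series_geom.
    rewrite Rabs_pos_eq by (apply Rmult_le_pos; [lra|apply pow2_ge_0]).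
    assert (Eq : q = 1 - 4 * e) by (unfold e; field). rewrite Eq. simpl. nra.
Qed.

(** The factor [r] keeps the exponent [n - 1] of the usual bound out of natural
    number subtraction; likewise [r ^ 2] in the next lemma. *)
Lemma power_difference_bound (w z : C) (r : R) (n : nat) :
  0 < r -> Cmod w <= r -> Cmod z <= r ->
  r * Cmod (w ^ n - z ^ n) <= INR n * r ^ n * Cmod (w - z).
Proof.
  intros Hr Hw Hz. assert (Hd := Cmod_ge_0 (w - z)).
  induction n as [|n IH].
  - simpl. replace (1 - 1)%C with (RtoC 0) by ring. rewrite Cmod_0. lra.
  - rewrite S_INR. simpl.
    replace (w * w ^ n - z * z ^ n)%C with (w * (w ^ n - z ^ n) + (w - z) * z ^ n)%C by ring.
    assert (T := Cmod_triangle (w * (w ^ n - z ^ n)) ((w - z) * z ^ n)).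
    rewrite !Cmod_mult, Cmod_pow in T.
    assert (Hp : Cmod z ^ n <= r ^ n) by (apply pow_incr; split; [apply Cmod_ge_0|exact Hz]).
    assert (A : Cmod w * Cmod (w ^ n - z ^ n) <= INR n * r ^ n * Cmod (w - z)).
    { apply Rle_trans with (2 := IH). apply Rmult_le_compat_r; [apply Cmod_ge_0|exact Hw]. }
    assert (B : Cmod (w - z) * Cmod z ^ n <= Cmod (w - z) * r ^ n)
      by (now apply Rmult_le_compat_l).
    apply Rle_trans with (r * (INR n * r ^ n * Cmod (w - z) + Cmod (w - z) * r ^ n)).
    + apply Rmult_le_compat_l; lra.
    + right. ring.
Qed.

Lemma power_taylor_bound (w z : C) (r : R) (n : nat) :
  0 < r -> Cmod w <= r -> Cmod z <= r ->
  r ^ 2 * Cmod (w ^ S n - z ^ S n - (w - z) * (RtoC (INR n + 1) * z ^ n))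
  <= (INR n + 1) * (INR n + 2) * r ^ S n * Cmod (w - z) ^ 2.
Proof.
  intros Hr Hw Hz. assert (Hd := Cmod_ge_0 (w - z)).
  induction n as [|n IH].
  - replace (w ^ 1 - z ^ 1 - (w - z) * (RtoC (INR 0 + 1) * z ^ 0))%C with (RtoC 0).
    + rewrite Cmod_0. simpl. assert (0 <= r * Cmod (w - z) ^ 2); [|simpl in *; nra].
      apply Rmult_le_pos; [lra|apply pow2_ge_0].
    + simpl. replace (0 + 1) with 1 by ring. ring.
  - set (E := (w ^ S n - z ^ S n - (w - z) * (RtoC (INR n + 1) * z ^ n))%C) in IH.
    replace (w ^ S (S n) - z ^ S (S n) - (w - z) * (RtoC (INR (S n) + 1) * z ^ S n))%C
      with (z * E + (w - z) * (w ^ S n - z ^ S n))%C.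
    2: { unfold E. rewrite S_INR, !RtoC_plus. simpl. ring. }
    assert (D := power_difference_bound w z r (S n) Hr Hw Hz).
    assert (T := Cmod_triangle (z * E) ((w - z) * (w ^ S n - z ^ S n))).
    rewrite !Cmod_mult in T. rewrite S_INR in D |- *. set (m := INR n) in *.
    assert (Hm : 0 <= m) by apply pos_INR.
    set (d := Cmod (w - z)) in *. set (x := Cmod E) in *.
    assert (Hx : 0 <= x) by apply Cmod_ge_0.
    set (y := Cmod (w ^ S n - z ^ S n)) in *.
    assert (Hrn : 0 < r ^ S n) by now apply pow_lt.
    apply Rle_trans with (r ^ 2 * (r * x + d * y)).
    + apply Rmult_le_compat_l; [apply pow2_ge_0|].
      apply Rle_trans with (1 := T). apply Rplus_le_compat_r, Rmult_le_compat_r; assumption.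
    + replace (r ^ 2 * (r * x + d * y)) with (r * (r ^ 2 * x) + r * d * (r * y)) by ring.
      apply Rle_trans with (r * ((m + 1) * (m + 2) * r ^ S n * d ^ 2)
         + r * d * ((m + 1) * r ^ S n * d)).
      * apply Rplus_le_compat; apply Rmult_le_compat_l; [lra|exact IH|nra|exact D].
      * replace (r ^ S (S n)) with (r * r ^ S n) by reflexivity.
        assert (0 <= r * r ^ S n * d ^ 2)
          by (apply Rmult_le_pos; [nra|apply pow2_ge_0]).
        replace (r * ((m + 1) * (m + 2) * r ^ S n * d ^ 2) + r * d * ((m + 1) * r ^ S n * d))
          with ((m + 1) * (m + 3) * (r * r ^ S n * d ^ 2)) by ring.
        replace ((m + 1 + 1) * (m + 1 + 2) * (r * r ^ S n) * d ^ 2)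
          with ((m + 2) * (m + 3) * (r * r ^ S n * d ^ 2)) by ring.
        apply Rmult_le_compat_r; [assumption|nra].
Qed.

Lemma sum_n_le_Series (b : nat -> R) (n : nat) :
  (forall k, 0 <= b k) -> ex_series b -> sum_n b n <= Series b.
Proof.
  intros Hb Hex. apply Series_correct in Hex.
  apply (is_lim_seq_incr_compare (sum_n b) (Series b) Hex).
  intros k. rewrite sum_Sn. unfold plus. simpl. specialize (Hb (S k)). lra.
Qed.

Definition sum_on_disk (a : nat -> C) (F : C -> C) : Prop :=
  forall z, disk z -> is_pseries (K := C_AbsRing) (V := C_NormedModule) a z (F z).

Lemma coefficients_bounded_on_disk a F (rho : R) :
  sum_on_disk a F -> 0 <= rho < 1 -> exists M, forall n, Cmod (a n) * rho ^ n <= M.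
Proof.
  intros HF Hr. apply (coefficients_bounded a rho (F (RtoC rho))); [lra|].
  apply HF. unfold disk. rewrite Cmod_R, Rabs_pos_eq; lra.
Qed.

Lemma derived_series_sum a F :
  sum_on_disk a F -> exists F1, sum_on_disk (fun n => RtoC (INR n + 1) * a (S n))%C F1.
Proof.
  intros HF.
  assert (H : forall z : C, exists l : C, disk z ->
    is_pseries (K := C_AbsRing) (V := C_NormedModule) (fun n => RtoC (INR n + 1) * a (S n))%C z l).
  { intros z. destruct (classic (disk z)) as [Hz|]; [|exists (RtoC 0); tauto].
    unfold disk in Hz. assert (Hm := Cmod_ge_0 z).
    set (rho := (1 + Cmod z) / 2).
    destruct (coefficients_bounded_on_disk a F rho HF ltac:(unfold rho; lra)) as [M HM].
    assert (Hq : 0 <= Cmod z / rho < 1).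
    { split; [apply Rdiv_le_0_compat; unfold rho; lra|].
      apply (Rmult_lt_reg_r rho); [unfold rho; lra|].
      replace (Cmod z / rho * rho) with (Cmod z) by (field; unfold rho; lra). unfold rho. lra. }
    assert (HM0 : 0 <= M).
    { apply Rle_trans with (2 := HM 0%nat). simpl. generalize (Cmod_ge_0 (a 0%nat)). lra. }
    assert (Hrho : 0 < rho) by (unfold rho; lra).
    assert (X : ex_series (K := C_AbsRing) (V := C_CompleteNormedModule)
      (fun k => scal (pow_n (K := C_Ring) z k) (RtoC (INR k + 1) * a (S k))%C)).
    { apply (ex_series_le (V := C_CompleteNormedModule) _
        (fun n => M / rho * ((INR n + 1) * (INR n + 2) * (Cmod z / rho) ^ n))).
      - intros n.
        change (Cmod (pow_n (K := C_Ring) z n * (RtoC (INR n + 1) * a (S n)))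
          <= M / rho * ((INR n + 1) * (INR n + 2) * (Cmod z / rho) ^ n)).
        assert (N := pos_INR n).
        rewrite pow_n_Cpow, !Cmod_mult, Cmod_pow, Cmod_R, Rabs_pos_eq by lra.
        specialize (HM (S n)). simpl in HM. set (c := Cmod (a (S n))) in *.
        assert (Hrn : 0 < rho ^ n) by now apply pow_lt.
        assert (Hzn : 0 <= Cmod z ^ n) by now apply pow_le.
        assert (Hc : 0 <= c) by apply Cmod_ge_0.
        assert (HD : c <= M / (rho * rho ^ n)).
        { apply (Rmult_le_reg_r (rho * rho ^ n)); [nra|].
          replace (M / (rho * rho ^ n) * (rho * rho ^ n)) with M by (field; lra). exact HM. }
        apply Rle_trans with (Cmod z ^ n * ((INR n + 1) * (M / (rho * rho ^ n)))).
        + apply Rmult_le_compat_l; [exact Hzn|]. apply Rmult_le_compat_l; lra.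
        + unfold Rdiv at 3. rewrite Rpow_mult_distr, pow_inv by lra.
          set (x := M / rho * ((INR n + 1) * (Cmod z ^ n * / rho ^ n))).
          replace (Cmod z ^ n * ((INR n + 1) * (M / (rho * rho ^ n)))) with (x * 1)
            by (unfold x; field; lra).
          replace (M / rho * ((INR n + 1) * (INR n + 2) * (Cmod z ^ n * / rho ^ n)))
            with (x * (INR n + 2)) by (unfold x; ring).
          apply Rmult_le_compat_l; [|lra]. unfold x.
          apply Rmult_le_pos; [apply Rdiv_le_0_compat; lra|].
          apply Rmult_le_pos; [lra|]. apply Rmult_le_pos; [exact Hzn|].
          left. now apply Rinv_0_lt_compat.
      - apply (ex_series_scal (V := R_NormedModule)), ex_series_quadratic_geometric, Hq. }
    destruct X as [l Hl]. exists l. intros _. exact Hl. }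
  exists (fun z => proj1_sig (constructive_indefinite_description _ (H z))).
  intros z Hz. now destruct (constructive_indefinite_description _ (H z)) as [l Hl]; apply Hl.
Qed.

Lemma Cderiv_of_quadratic_error (F : C -> C) (z l : C) (e L : R) :
  0 < e -> 0 <= L ->
  (forall w, Cmod (w - z) < e -> Cmod (F w - F z - (w - z) * l) <= L * Cmod (w - z) ^ 2) ->
  Cderiv F z l.
Proof.
  intros He HL H.
  pose (q := fun w : C => if excluded_middle_informative (w = z) then l
                          else ((F w - F z) / (w - z))%C).
  assert (Ez : q z = l) by (unfold q; now destruct (excluded_middle_informative (z = z))).
  assert (Hne : forall w, w <> z -> (w - z)%C <> 0%C).
  { intros w Hw E. apply Hw. transitivity (w - z + z)%C; [ring|rewrite E; ring]. }
  exists q. split; [|split; [exact Ez|]].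
  - apply continuous_C_eps. intros eps Heps. rewrite Ez.
    exists (Rmin e (eps / (L + 1))).
    assert (HL1 : 0 < eps / (L + 1)) by (apply Rdiv_lt_0_compat; lra).
    split; [now apply Rmin_pos|]. intros w Hw.
    assert (W1 : Cmod (w - z) < e) by (eapply Rlt_le_trans; [exact Hw|apply Rmin_l]).
    assert (W2 : Cmod (w - z) < eps / (L + 1)) by (eapply Rlt_le_trans; [exact Hw|apply Rmin_r]).
    unfold q. destruct (excluded_middle_informative (w = z)) as [->|Hwz].
    { replace (l - l)%C with (RtoC 0) by ring. now rewrite Cmod_0. }
    specialize (Hne w Hwz). assert (Hd := proj1 (Cmod_gt_0 _) Hne).
    replace ((F w - F z) / (w - z) - l)%C with ((F w - F z - (w - z) * l) / (w - z))%C
      by (field; exact Hne).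
    rewrite Cmod_div by exact Hne. specialize (H w W1).
    set (d := Cmod (w - z)) in *.
    apply (Rmult_lt_compat_r (L + 1)) in W2; [|lra].
    replace (eps / (L + 1) * (L + 1)) with eps in W2 by (field; lra).
    apply (Rmult_lt_reg_r d); [exact Hd|].
    replace (Cmod (F w - F z - (w - z) * l) / d * d) with (Cmod (F w - F z - (w - z) * l))
      by (field; lra). nra.
  - apply filter_forall. intros w. cbv beta. unfold q.
    destruct (excluded_middle_informative _) as [->|Hwz]; [cring|].
    cfield. now apply Hne.
Qed.

(** The Taylor remainder of each power is quadratic in [w - z], with constants
    that are summable against the coefficients on a slightly larger circle. *)
Lemma sum_on_disk_deriv a F F1 :
  sum_on_disk a F -> sum_on_disk (fun n => RtoC (INR n + 1) * a (S n))%C F1 ->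
  forall z, disk z -> Cderiv F z (F1 z).
Proof.
  intros HF HF1 z Hz. unfold disk in Hz. assert (Hm := Cmod_ge_0 z).
  set (r := (1 + 2 * Cmod z) / 3). set (rho := (2 + Cmod z) / 3).
  destruct (coefficients_bounded_on_disk a F rho HF ltac:(unfold rho; lra)) as [M HM].
  assert (HM0 : 0 <= M).
  { apply Rle_trans with (2 := HM 0%nat). simpl. generalize (Cmod_ge_0 (a 0%nat)). lra. }
  assert (Hr : 0 < r < rho) by (unfold r, rho; lra).
  set (q := r / rho).
  assert (Hq : 0 <= q < 1).
  { split; [apply Rdiv_le_0_compat; lra|].
    apply (Rmult_lt_reg_r rho); [lra|]. unfold q.
    replace (r / rho * rho) with r by (field; lra). lra. }
  pose (b := fun n => (INR n + 1) * (INR n + 2) * q ^ n).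
  assert (Hb : forall n, 0 <= b n).
  { intros n. assert (N := pos_INR n). apply Rmult_le_pos; [nra|apply pow_le; lra]. }
  set (L := M / r ^ 2 * Series b).
  assert (HSb : 0 <= Series b).
  { apply Rle_trans with (sum_n b 0).
    - rewrite sum_O. apply Hb.
    - apply sum_n_le_Series; [exact Hb|now apply ex_series_quadratic_geometric]. }
  assert (Hr2 : 0 < r ^ 2) by (apply pow_lt; lra).
  apply (Cderiv_of_quadratic_error F z (F1 z) (r - Cmod z) L).
  - unfold r. lra.
  - apply Rmult_le_pos; [apply Rdiv_le_0_compat; lra|exact HSb].
  - intros w Hwz.
    assert (Hw : Cmod w < r).
    { assert (T := Cmod_triangle z (w - z)). replace (z + (w - z))%C with w in T by ring. lra. }
    assert (Hw1 : disk w) by (unfold disk, r in *; lra).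
    assert (HS : is_series (K := C_AbsRing) (V := C_NormedModule)
       (fun n => (w ^ S n - z ^ S n - (w - z) * (RtoC (INR n + 1) * z ^ n)) * a (S n))%C
       (F w - F z - (w - z) * F1 z)%C).
    { assert (Sw := HF w Hw1). assert (Sz := HF z Hz). assert (S1 := HF1 z Hz).
      unfold is_pseries in *.
      pose (u := fun n => (pow_n (K := C_Ring) w n * a n - pow_n (K := C_Ring) z n * a n)%C).
      assert (D : is_series (K := C_AbsRing) (V := C_NormedModule) u (F w - F z)%C)
        by exact (is_series_minus _ _ _ _ Sw Sz).
      assert (D1 : is_series (K := C_AbsRing) (V := C_NormedModule)
         (fun n => u (S n)) (F w - F z)%C).
      { apply is_series_incr_1.
        change (is_series (K := C_AbsRing) (V := C_NormedModule) u (F w - F z + u 0%nat)%C).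
        replace (F w - F z + u 0%nat)%C with (F w - F z)%C; [exact D|].
        unfold u. change ((F w - F z)%C = (F w - F z + (1 * a 0%nat - 1 * a 0%nat))%C). ring. }
      assert (D2 := is_series_minus _ _ _ _ D1 (is_series_scal (w - z)%C _ _ S1)).
      eapply is_series_ext; [|exact D2].
      intros n. unfold u.
      change ((pow_n (K := C_Ring) w (S n) * a (S n) - pow_n (K := C_Ring) z (S n) * a (S n)
        - (w - z) * (pow_n (K := C_Ring) z n * (RtoC (INR n + 1) * a (S n))))%C
        = ((w ^ S n - z ^ S n - (w - z) * (RtoC (INR n + 1) * z ^ n)) * a (S n))%C).
      rewrite (pow_n_Cpow w), (pow_n_Cpow z (S n)), (pow_n_Cpow z n). ring. }
    apply (is_series_C_norm_le _ (fun n => M / r ^ 2 * Cmod (w - z) ^ 2 * b n) _ _ HS).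
    + intros n. rewrite Cmod_mult.
      assert (P := power_taylor_bound w z r n ltac:(lra) ltac:(lra) ltac:(unfold r; lra)).
      set (x := Cmod (w ^ S n - z ^ S n - (w - z) * (RtoC (INR n + 1) * z ^ n))) in *.
      specialize (HM (S n)). set (c := Cmod (a (S n))) in *.
      assert (Hc : 0 <= c) by apply Cmod_ge_0.
      set (d2 := Cmod (w - z) ^ 2) in *.
      assert (Hd2 : 0 <= d2) by apply pow2_ge_0.
      assert (N := pos_INR n).
      assert (Hrn : 0 < rho ^ S n) by (apply pow_lt; lra).
      apply (Rmult_le_reg_l (r ^ 2)); [exact Hr2|].
      apply Rle_trans with ((INR n + 1) * (INR n + 2) * r ^ S n * d2 * c).
      * rewrite <- Rmult_assoc. now apply Rmult_le_compat_r.
      * replace (r ^ 2 * (M / r ^ 2 * d2 * b n)) with (M * d2 * b n) by (field; lra).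
        unfold b. assert (Er : r = q * rho) by (unfold q; field; lra).
        replace (r ^ S n) with (q * q ^ n * rho ^ S n).
        2: { rewrite Er at 1. now rewrite Rpow_mult_distr. }
        replace ((INR n + 1) * (INR n + 2) * (q * q ^ n * rho ^ S n) * d2 * c)
          with ((INR n + 1) * (INR n + 2) * q ^ n * d2 * (q * (c * rho ^ S n))) by ring.
        replace (M * d2 * ((INR n + 1) * (INR n + 2) * q ^ n))
          with ((INR n + 1) * (INR n + 2) * q ^ n * d2 * M) by ring.
        apply Rmult_le_compat_l; [apply Rmult_le_pos; [apply Hb|exact Hd2]|].
        assert (0 <= c * rho ^ S n) by (apply Rmult_le_pos; lra). nra.
    + intros n. rewrite (sum_n_ext _ (fun n => scal (M / r ^ 2 * Cmod (w - z) ^ 2) (b n)))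
        by reflexivity.
      rewrite (sum_n_scal_l (V := R_NormedModule)).
      change (M / r ^ 2 * Cmod (w - z) ^ 2 * sum_n b n <= L * Cmod (w - z) ^ 2).
      unfold L. replace (M / r ^ 2 * Series b * Cmod (w - z) ^ 2)
        with (M / r ^ 2 * Cmod (w - z) ^ 2 * Series b) by ring.
      apply Rmult_le_compat_l.
      * apply Rmult_le_pos; [apply Rdiv_le_0_compat; lra|apply pow2_ge_0].
      * apply sum_n_le_Series; [exact Hb|now apply ex_series_quadratic_geometric].
Qed.

Lemma Cderiv_continuous F z l : Cderiv F z l -> continuous F z.
Proof.
  apply (deriv_along_continuous (U := C_UniformSpace) (fun z => z) F z l), continuous_id.
Qed.

Lemma sum_on_disk_three_derivatives a f :
  sum_on_disk a f -> exists f1 f2 f3,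
    hol_on_disk f f1 /\ hol_on_disk f1 f2 /\ hol_on_disk f2 f3 /\ f1 0%C = a 1%nat.
Proof.
  intros H0.
  destruct (derived_series_sum _ _ H0) as [f1 H1].
  destruct (derived_series_sum _ _ H1) as [f2 H2].
  destruct (derived_series_sum _ _ H2) as [f3 H3].
  destruct (derived_series_sum _ _ H3) as [f4 H4].
  assert (D0 := sum_on_disk_deriv _ _ _ H0 H1). assert (D1 := sum_on_disk_deriv _ _ _ H1 H2).
  assert (D2 := sum_on_disk_deriv _ _ _ H2 H3). assert (D3 := sum_on_disk_deriv _ _ _ H3 H4).
  exists f1, f2, f3. split; [|split; [|split]].
  - intros z Hz. split; [now apply D0|now apply (Cderiv_continuous _ _ (f2 z)), D1].
  - intros z Hz. split; [now apply D1|now apply (Cderiv_continuous _ _ (f3 z)), D2].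
  - intros z Hz. split; [now apply D2|now apply (Cderiv_continuous _ _ (f4 z)), D3].
  - assert (Z := H1 0%C ltac:(unfold disk; rewrite Cmod_0; lra)).
    assert (Z' := is_pseries_0 (K := C_AbsRing) (V := C_NormedModule)
      (fun n => RtoC (INR n + 1) * a (S n))%C).
    assert (E := filterlim_locally_unique _ _ _ Z Z'). 
    rewrite E. simpl. replace (0 + 1) with 1 by ring. apply Cmult_1_l.
Qed.

(** * Disk automorphisms *)

Definition mobius (c u : C) : C := ((u + c) / (1 + Cconj c * u))%C.

Section Mobius.
Variable c : C.
Hypothesis c_disk : disk c.

Lemma mobius_denominator_lower_bound u :
  disk u -> 1 - Cmod c <= Cmod (1 + Cconj c * u) /\ Cmod (1 + Cconj c * u) <= 2.
Proof.
  unfold disk in *. intros Hu. assert (H := Cmod_ge_0 c). assert (H' := Cmod_ge_0 u).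
  assert (E : Cmod (Cconj c * u) <= Cmod c).
  { rewrite Cmod_mult, Cmod_conj. nra. }
  split.
  - assert (T := Cmod_triangle (1 + Cconj c * u) (- (Cconj c * u))).
    replace (1 + Cconj c * u + - (Cconj c * u))%C with (RtoC 1) in T by ring.
    rewrite Cmod_opp, Cmod_1 in T. lra.
  - apply Rle_trans with (1 := Cmod_triangle _ _). rewrite Cmod_1. lra.
Qed.

Lemma mobius_denominator_neq_0 u : disk u -> (1 + Cconj c * u)%C <> 0%C.
Proof.
  intros Hu. apply Cmod_gt_0.
  destruct (mobius_denominator_lower_bound u Hu) as [H _]. unfold disk in c_disk. lra.
Qed.

Lemma mobius_modulus u :
  disk u ->
  1 - Cmod (mobius c u) ^ 2
  = (1 - Cmod u ^ 2) * ((1 - Cmod c ^ 2) / Cmod (1 + Cconj c * u) ^ 2).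
Proof.
  intros Hu. assert (Hn := mobius_denominator_neq_0 u Hu).
  assert (Hp := proj1 (Cmod_gt_0 _) Hn).
  unfold mobius. rewrite Cmod_div by exact Hn.
  set (d := Cmod (1 + Cconj c * u)) in *.
  assert (E : d ^ 2 - Cmod (u + c) ^ 2 = (1 - Cmod u ^ 2) * (1 - Cmod c ^ 2)).
  { unfold d. rewrite !Cmod2_alt. destruct u, c. unfold Re, Im, Cconj, Cmult, Cplus, RtoC. simpl. ring. }
  replace (1 - (Cmod (u + c) / d) ^ 2) with ((d ^ 2 - Cmod (u + c) ^ 2) / d ^ 2) by (field; lra).
  rewrite E. field. lra.
Qed.

Lemma mobius_disk u : disk u -> disk (mobius c u).
Proof.
  intros Hu. assert (E := mobius_modulus u Hu).
  assert (Hp := proj1 (Cmod_gt_0 _) (mobius_denominator_neq_0 u Hu)).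
  unfold disk in *. assert (H := Cmod_ge_0 c). assert (H' := Cmod_ge_0 u).
  assert (0 < (1 - Cmod c ^ 2) / Cmod (1 + Cconj c * u) ^ 2).
  { apply Rdiv_lt_0_compat; [nra|now apply pow_lt]. }
  assert (0 < 1 - Cmod u ^ 2) by nra.
  assert (0 < 1 - Cmod (mobius c u) ^ 2) by (rewrite E; now apply Rmult_lt_0_compat).
  generalize (Cmod_ge_0 (mobius c u)). nra.
Qed.

Lemma one_minus_Cmod2_neq_0 : (1 - Cconj c * c)%C <> 0%C.
Proof.
  replace (1 - Cconj c * c)%C with (RtoC (1 - Cmod c ^ 2)).
  - intros E. apply RtoC_inj in E. unfold disk in c_disk. generalize (Cmod_ge_0 c). nra.
  - rewrite RtoC_minus, Cmod2_conj. ring.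
Qed.

End Mobius.

Lemma mobius_cancel c u : disk c -> disk u -> mobius (- c) (mobius c u) = u.
Proof.
  intros Hc Hu.
  assert (H1 := mobius_denominator_neq_0 c Hc u Hu).
  assert (H2 := one_minus_Cmod2_neq_0 c Hc).
  unfold mobius. rewrite Copp_conj.
  assert (N : (1 + - Cconj c * ((u + c) / (1 + Cconj c * u)))%C
     = ((1 - Cconj c * c) / (1 + Cconj c * u))%C) by (field; exact H1).
  rewrite N.
  field. split; [exact H1|exact H2].
Qed.

Lemma disk_opp c : disk c -> disk (- c).
Proof. unfold disk. now rewrite Cmod_opp. Qed.

Lemma mobius_cancel' c z : disk c -> disk z -> mobius c (mobius (- c) z) = z.
Proof.
  intros Hc Hz. replace c with (- - c)%C at 1 by ring.
  apply mobius_cancel; [now apply disk_opp|exact Hz].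
Qed.

Definition mobius' (c u : C) : C :=
  (RtoC (1 - Cmod c ^ 2) / ((1 + Cconj c * u) * (1 + Cconj c * u)))%C.

Lemma hol_at_mobius c u : disk c -> disk u -> hol_at (mobius c) (mobius' c) u.
Proof.
  intros Hc Hu.
  assert (H := hol_at_div _ _ _ _ u
    (hol_at_plus _ _ _ _ u (hol_at_id u) (hol_at_const c u))
    (hol_at_plus _ _ _ _ u (hol_at_const 1 u) (hol_at_scal (Cconj c) _ _ u (hol_at_id u)))
    (mobius_denominator_neq_0 c Hc u Hu)).
  assert (E : forall w, mobius' c w = (((1 + 0) * (1 + Cconj c * w) - (w + c) * (0 + Cconj c * 1))
     / ((1 + Cconj c * w) * (1 + Cconj c * w)))%C).
  { intros w. unfold mobius'. f_equal. rewrite RtoC_minus, Cmod2_conj. ring. }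
  destruct H as [A B]. split.
  - rewrite E. exact A.
  - apply (continuous_ext (fun w => ((1 + 0) * (1 + Cconj c * w) - (w + c) * (0 + Cconj c * 1))
     / ((1 + Cconj c * w) * (1 + Cconj c * w)))%C); [|exact B].
    intros w. symmetry. apply E.
Qed.

Lemma mobius'_neq_0 c u : disk c -> disk u -> mobius' c u <> 0%C.
Proof.
  intros Hc Hu. assert (H := mobius_denominator_neq_0 c Hc u Hu).
  unfold mobius', Cdiv. apply Cmult_neq_0.
  - intros E. apply RtoC_inj in E. unfold disk in Hc. generalize (Cmod_ge_0 c). nra.
  - apply Cmod_gt_0. rewrite Cmod_inv, Cmod_mult by now apply Cmult_neq_0.
    apply Rinv_0_lt_compat. apply Cmod_gt_0 in H. nra.
Qed.

Definition mobius'' (c u : C) : C :=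
  let d := (1 + Cconj c * u)%C in
  ((0 * (d * d) - RtoC (1 - Cmod c ^ 2) * ((0 + Cconj c * 1) * d + d * (0 + Cconj c * 1)))
   / ((d * d) * (d * d)))%C.

Lemma hol_at_mobius_denominator c u :
  hol_at (fun u => 1 + Cconj c * u)%C (fun _ => 0 + Cconj c * 1)%C u.
Proof. apply hol_at_plus; [apply hol_at_const|apply hol_at_scal, hol_at_id]. Qed.

Lemma hol_at_mobius' c u : disk c -> disk u -> hol_at (mobius' c) (mobius'' c) u.
Proof.
  intros Hc Hu. assert (H := mobius_denominator_neq_0 c Hc u Hu).
  apply (hol_at_div _ _ (fun u => (1 + Cconj c * u) * (1 + Cconj c * u))%C
    (fun u => (0 + Cconj c * 1) * (1 + Cconj c * u) + (1 + Cconj c * u) * (0 + Cconj c * 1))%C);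
    [apply hol_at_const| |now apply Cmult_neq_0].
  apply hol_at_mult; apply hol_at_mobius_denominator.
Qed.

Lemma hol_at_mobius'' c : disk c -> exists m3, forall u, disk u -> hol_at (mobius'' c) m3 u.
Proof.
  intros Hc. eexists. intros u Hu. assert (H := mobius_denominator_neq_0 c Hc u Hu).
  unfold mobius''. apply hol_at_div; [|
    apply hol_at_mult; apply hol_at_mult; apply hol_at_mobius_denominator|
    repeat apply Cmult_neq_0; exact H].
  apply hol_at_minus; [apply hol_at_scal, hol_at_mult; apply hol_at_mobius_denominator|].
  apply hol_at_scal. apply hol_at_plus.
  - apply hol_at_scal, hol_at_mobius_denominator.
  - apply hol_at_mult; [apply hol_at_mobius_denominator|apply hol_at_const].
Qed.

(** * Derivatives of convex maps from one value of the order *)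

Lemma exp_le (x y : R) : x <= y -> exp x <= exp y.
Proof. intros [H| ->]; [left; now apply exp_increasing|lra]. Qed.

(** The growth of the Koebe transform [f o mobius c], whose second coefficient
    has modulus [A], is carried back to [f]. *)
Lemma convex_derivative_growth (f f1 f2 f3 : C -> C) (c : C) :
  hol_on_disk f f1 -> hol_on_disk f1 f2 -> hol_on_disk f2 f3 ->
  injective_on_disk f -> (forall z, disk z -> f1 z <> 0%C) ->
  convex_set (image_of_disk f) -> disk c ->
  let A := Cmod (RtoC (/ 2) * RtoC (1 - Cmod c ^ 2) * (f2 c / f1 c) - Cconj c)%C in
  exists K, 0 < K /\
    forall z, disk z -> Cmod (f1 z) <= K * Rpower (1 - Cmod z) (- (1 + A)).
Proof.
  intros Hf Hf1 Hf2 Hinj H0 Hconv Hc A.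
  assert (D0 : disk 0%C) by (unfold disk; rewrite Cmod_0; lra).
  destruct (hol_at_mobius'' c Hc) as [m3 Hm3].
  pose (T := mobius c). pose (T1 := mobius' c). pose (T2 := mobius'' c).
  assert (HT : forall u, disk u -> disk (T u)) by (intros u Hu; now apply mobius_disk).
  pose (g := fun u => f (T u)). pose (g1 := fun u => (f1 (T u) * T1 u)%C).
  pose (g2 := fun u => ((f2 (T u) * T1 u) * T1 u + f1 (T u) * T2 u)%C).
  assert (Hg : hol_on_disk g g1).
  { intros u Hu. apply (hol_at_comp f f1 T T1); [now apply hol_at_mobius|now apply Hf, HT]. }
  assert (Hft : hol_on_disk (fun u => f1 (T u)) (fun u => f2 (T u) * T1 u)%C).
  { intros u Hu. apply (hol_at_comp f1 f2 T T1); [now apply hol_at_mobius|now apply Hf1, HT]. }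
  assert (Hg1 : hol_on_disk g1 g2).
  { intros u Hu. apply (hol_at_mult (fun u => f1 (T u)) _ T1 T2); [now apply Hft|].
    now apply hol_at_mobius'. }
  assert (Hg2 : exists g3, hol_on_disk g2 g3).
  { eexists. intros u Hu. apply hol_at_plus.
    - apply hol_at_mult; [|now apply hol_at_mobius'].
      apply hol_at_mult; [|now apply hol_at_mobius'].
      apply (hol_at_comp f2 f3 T T1); [now apply hol_at_mobius|now apply Hf2, HT].
    - apply hol_at_mult; [now apply Hft|now apply Hm3]. }
  destruct Hg2 as [g3 Hg2].
  assert (Ginj : injective_on_disk g).
  { intros u v Hu Hv E. apply Hinj in E; [|now apply HT|now apply HT].
    rewrite <- (mobius_cancel c u Hc Hu), <- (mobius_cancel c v Hc Hv). unfold T in E. now rewrite E. }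
  assert (G0 : forall u, disk u -> g1 u <> 0%C).
  { intros u Hu. apply Cmult_neq_0; [now apply H0, HT|now apply mobius'_neq_0]. }
  assert (HS : forall z, disk z -> disk (mobius (- c) z) /\ T (mobius (- c) z) = z).
  { intros z Hz. split; [apply mobius_disk; [now apply disk_opp|exact Hz]|now apply mobius_cancel']. }
  assert (Gim : forall w, image_of_disk g w <-> image_of_disk f w).
  { intros w. split; intros (z & Hz & E).
    - exists (T z). split; [now apply HT|exact E].
    - destruct (HS z Hz) as [S1 S2]. exists (mobius (- c) z). split; [exact S1|].
      unfold g. now rewrite S2. }
  assert (Gconv : convex_set (image_of_disk g)).
  { intros z w t Hz Hw Ht. apply Gim. apply Hconv; [now apply Gim|now apply Gim|exact Ht]. }
  assert (Gcrit := convex_map_criterion g g1 g2 Hg Hg1 Ginj G0 Gconv).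
  assert (Hcm := Cmod_ge_0 c). unfold disk in Hc.
  set (k := 1 - Cmod c ^ 2). assert (Hk : 0 < k) by (unfold k; nra).
  assert (EA : Cmod (g2 0 / g1 0)%C = 2 * A).
  { assert (ET : T 0%C = c) by (unfold T, mobius; field; replace (1 + Cconj c * 0)%C with (RtoC 1) by ring; intros E; apply RtoC_inj in E; lra).
    assert (ET1 : T1 0%C = RtoC k).
    { unfold T1, mobius'. fold k. replace (1 + Cconj c * 0)%C with (RtoC 1) by ring. field. }
    assert (ET2 : T2 0%C = (- (RtoC 2 * RtoC k * Cconj c))%C).
    { unfold T2, mobius''. fold k. replace (1 + Cconj c * 0)%C with (RtoC 1) by ring. field. }
    assert (Hk0 : RtoC k <> 0%C) by (intros E; apply RtoC_inj in E; lra).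
    assert (Hf1c := H0 c Hc).
    unfold g2, g1. rewrite ET, ET1, ET2.
    replace ((f2 c * RtoC k * RtoC k + f1 c * - (RtoC 2 * RtoC k * Cconj c)) / (f1 c * RtoC k))%C
      with (RtoC 2 * (RtoC (/ 2) * RtoC k * (f2 c / f1 c) - Cconj c))%C.
    - rewrite Cmod_mult, Cmod_R, Rabs_pos_eq by lra. reflexivity.
    - rewrite RtoC_inv by lra. field. split; [exact Hk0|exact Hf1c]. }
  assert (HA : 0 <= A) by apply Cmod_ge_0.
  assert (Ggr := derivative_growth g1 g2 g3 A Hg1 Hg2 G0 Gcrit EA).
  (* [4 / (1 - Cmod c)] bounds the distortion of the distance to the circle,
     [4 / k] the inverse of the derivative of the automorphism. *)
  set (q := ln (4 / (1 - Cmod c))).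
  set (L := ln (Cmod (g1 0%C)) + A + (1 + A) * q + ln (4 / k)).
  exists (exp L). split; [apply exp_pos|]. intros z Hz.
  destruct (HS z Hz) as [Su ETu]. set (u := mobius (- c) z) in *.
  assert (Hden := mobius_denominator_lower_bound c Hc u Su).
  assert (Hmod := mobius_modulus c Hc u Su). fold T in Hmod. rewrite ETu in Hmod. fold k in Hmod.
  set (d := Cmod (1 + Cconj c * u)) in *.
  assert (ET1 : Cmod (T1 u) = k / d ^ 2).
  { unfold T1, mobius'. assert (N := mobius_denominator_neq_0 c Hc u Su).
    rewrite Cmod_div, Cmod_R, Cmod_mult by now apply Cmult_neq_0.
    fold k d. rewrite Rabs_pos_eq by lra. do 2 f_equal. ring. }
  specialize (Ggr u Su). unfold g1 at 1 in Ggr. rewrite ETu, Cmod_mult, ET1 in Ggr.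
  assert (Hf1z := proj1 (Cmod_gt_0 _) (H0 z Hz)).
  assert (Hd2 : 0 < d ^ 2) by (apply pow_lt; lra).
  assert (Hkd : k / 4 <= k / d ^ 2).
  { apply Rmult_le_compat_l; [lra|]. apply Rinv_le_contravar; nra. }
  assert (Hz' := Hz). assert (Su' := Su). unfold disk in Hz', Su'.
  assert (Hzm := Cmod_ge_0 z). assert (Hum := Cmod_ge_0 u).
  assert (Hb : 1 - Cmod z <= (1 - Cmod u) * (4 / (1 - Cmod c))).
  { apply Rle_trans with (1 - Cmod z ^ 2); [nra|]. rewrite Hmod.
    apply Rle_trans with (2 * (1 - Cmod u) * (2 / (1 - Cmod c))); [|right; field; lra].
    apply Rmult_le_compat; [nra|apply Rlt_le, Rdiv_lt_0_compat; lra|nra|].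
    apply (Rmult_le_reg_r (d ^ 2 * (1 - Cmod c))); [nra|].
    replace (k / d ^ 2 * (d ^ 2 * (1 - Cmod c))) with (k * (1 - Cmod c)) by (field; lra).
    replace (2 / (1 - Cmod c) * (d ^ 2 * (1 - Cmod c))) with (2 * d ^ 2) by (field; lra).
    unfold k. assert ((1 - Cmod c) * (1 - Cmod c) <= d ^ 2) by (simpl; nra). nra. }
  assert (Hln : ln (1 - Cmod z) <= ln (1 - Cmod u) + q).
  { unfold q. rewrite <- ln_mult; [|lra|apply Rdiv_lt_0_compat; lra].
    apply ln_le; [lra|exact Hb]. }
  assert (Hln2 : ln (Cmod (f1 z)) + - ln (4 / k) <= ln (Cmod (f1 z) * (k / d ^ 2))).
  { rewrite <- ln_Rinv by (apply Rdiv_lt_0_compat; lra).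
    replace (/ (4 / k)) with (k / 4) by (field; lra).
    rewrite <- ln_mult; [|exact Hf1z|lra]. apply ln_le; [apply Rmult_lt_0_compat; lra|].
    apply Rmult_le_compat_l; lra. }
  rewrite <- (exp_ln (Cmod (f1 z))) by exact Hf1z. unfold Rpower. rewrite <- exp_plus.
  apply exp_le. unfold L. nra.
Qed.

(** * Hardy spaces *)

Lemma Cderiv_is_derive (F : C -> C) (z l : C) :
  Cderiv F z l -> is_derive (K := C_AbsRing) (V := C_NormedModule) F z l.
Proof.
  intros (q & Hq & <- & E). split; [apply is_linear_scal_l|].
  intros x Hx. apply (is_filter_lim_locally_unique (V := AbsRing_NormedModule C_AbsRing)) in Hx.
  subst x. intros eps. apply locally_C.
  generalize (filter_and _ _ E (continuous_C_small q z eps Hq (cond_pos eps))).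
  apply filter_imp. intros y [A B].
  change (Cmod ((F y - F z) - (y - z) * q z) <= eps * Cmod (y - z)).
  rewrite A. replace ((y - z) * q y - (y - z) * q z)%C with ((q y - q z) * (y - z))%C by ring.
  rewrite Cmod_mult. apply Rmult_le_compat_r; [apply Cmod_ge_0|lra].
Qed.

Lemma hol_on_disk_C_derive F F1 z : hol_on_disk F F1 -> disk z -> C_derive F z = F1 z.
Proof. intros H Hz. apply is_C_derive_unique, Cderiv_is_derive, H, Hz. Qed.

Lemma C_derive_deriv F F1 F2 z :
  hol_on_disk F F1 -> hol_on_disk F1 F2 -> disk z ->
  is_derive (K := C_AbsRing) (V := C_NormedModule) (C_derive F) z (F2 z).
Proof.
  intros H H1 Hz. apply (is_derive_ext_loc F1).
  - apply locally_C. generalize (locally_Cmod_lt z 1 Hz). apply filter_imp.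
    intros w Hw. symmetry. now apply (hol_on_disk_C_derive F F1).
  - now apply Cderiv_is_derive, H1.
Qed.

Lemma Rpower_pos_nnpow (x p : R) : 0 < x -> nnpow x p = Rpower x p.
Proof. intros H. unfold nnpow. destruct (Req_EM_T x 0); [lra|reflexivity]. Qed.

Lemma nnpow_bounds (x y p : R) : 0 <= x -> x <= y -> 0 < y -> 0 < p ->
  0 <= nnpow x p <= Rpower y p.
Proof.
  intros Hx Hxy Hy Hp. assert (0 < Rpower y p) by apply exp_pos.
  unfold nnpow. destruct (Req_EM_T x 0); [lra|].
  split; [left; apply exp_pos|apply Rpower_le_base; lra].
Qed.

Lemma hardy_mean_circ p F r :
  hardy_mean p F r = RInt (fun th => nnpow (Cmod (F (circ r th))) p) 0 (2 * PI).
Proof.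
  unfold hardy_mean. apply RInt_ext. intros th _. do 3 f_equal.
  unfold circ, cis, Cmult, RtoC. simpl. f_equal; ring.
Qed.

(** Only the means near the boundary matter: the others are bounded by the
    growth estimate. *)
Lemma hardy_bound (F F1 : C -> C) (p B K gam : R) :
  hol_on_disk F F1 -> (forall z, disk z -> z <> 0%C -> F z <> 0%C) -> 0 < p -> 0 < K ->
  0 <= gam ->
  (forall z, disk z -> Cmod (F z) <= K * Rpower (1 - Cmod z) (- gam)) ->
  (forall r, / 2 <= r < 1 ->
    RInt (fun th => Rpower (Cmod (F (circ r th))) p) 0 (2 * PI) <= B) ->
  bound (fun I : R => exists r : R, 0 <= r < 1 /\ I = hardy_mean p F r).
Proof.
  intros HF H0 Hp HK Hgam Hgr HB. assert (HPI := PI_RGT_0).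
  set (M := K * Rpower (/ 2) (- gam)).
  assert (HM : 0 < M) by (apply Rmult_lt_0_compat; [exact HK|apply exp_pos]).
  assert (Hsmall : forall z, Cmod z <= / 2 -> Cmod (F z) <= M).
  { intros z Hz. apply Rle_trans with (1 := Hgr z ltac:(unfold disk; lra)).
    apply Rmult_le_compat_l; [lra|]. unfold Rpower. apply exp_le.
    assert (ln (/ 2) <= ln (1 - Cmod z)) by (apply ln_le; lra). nra. }
  assert (Hcirc : forall r th, 0 < r < 1 -> disk (circ r th) /\ circ r th <> 0%C).
  { intros r th Hr. split.
    - unfold disk. rewrite Cmod_circ; lra.
    - apply Cmod_gt_0. rewrite Cmod_circ; lra. }
  assert (Heq : forall r, 0 < r < 1 -> hardy_mean p F r
      = RInt (fun th => Rpower (Cmod (F (circ r th))) p) 0 (2 * PI)).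
  { intros r Hr. rewrite hardy_mean_circ. apply RInt_ext. intros th _.
    apply Rpower_pos_nnpow, Cmod_gt_0. destruct (Hcirc r th Hr). now apply H0. }
  exists (Rmax B (2 * PI * Rpower M p)). intros I (r & Hr & ->).
  destruct (Rle_lt_dec (/ 2) r) as [Hr2|Hr2].
  { apply Rle_trans with B; [|apply Rmax_l]. rewrite Heq by lra. apply HB. lra. }
  apply Rle_trans with (2 := Rmax_r _ _).
  destruct (Req_dec r 0) as [->|Hr0].
  - rewrite hardy_mean_circ.
    rewrite (RInt_ext _ (fun _ => nnpow (Cmod (F 0%C)) p)).
    + rewrite RInt_circle_const. apply Rmult_le_compat_l; [lra|].
      apply nnpow_bounds; [apply Cmod_ge_0| |exact HM|exact Hp].
      apply Hsmall. rewrite Cmod_0. lra.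
    + intros th _. do 3 f_equal. unfold circ. ring.
  - rewrite Heq by lra. rewrite <- RInt_circle_const. apply RInt_circle_le.
    + intros th. destruct (Hcirc r th ltac:(lra)) as [A A0].
      unfold Rpower. apply (continuous_comp (fun th => p * ln (Cmod (F (circ r th)))) exp);
        [|apply continuous_exp].
      apply (continuous_mult (K := R_AbsRing)); [apply continuous_const|].
      apply (continuous_comp (fun th => Cmod (F (circ r th))) ln).
      * apply (continuous_Cmod (fun th => F (circ r th))), continuous_along_circ,
          (hol_at_continuous F F1), HF, A.
      * apply continuous_ln, Cmod_gt_0. now apply H0.
    + intros th. apply continuous_const.
    + intros th _. destruct (Hcirc r th ltac:(lra)) as [A A0].
      apply Rpower_le_base; [apply Cmod_gt_0; now apply H0| |exact Hp].
      apply Hsmall. rewrite Cmod_circ; lra.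
Qed.

Section ConvexHardy.
Variables f f1 f2 f3 : C -> C.
Hypothesis Hf : hol_on_disk f f1.
Hypothesis Hf1 : hol_on_disk f1 f2.
Hypothesis Hf2 : hol_on_disk f2 f3.
Hypothesis f_inj : injective_on_disk f.
Hypothesis f_convex : convex_set (image_of_disk f).
Hypothesis f_0 : f 0%C = 0%C.
Hypothesis f1_neq_0 : forall z, disk z -> f1 z <> 0%C.

(** Prawitz's argument with [h = f]. The quotient [z f' / f] is completed by its
    limit [1] at the origin. *)
Lemma convex_function_hardy_bound (q K a : R) :
  0 < q -> 0 < K -> 0 < a -> q * a < 1 ->
  (forall z, disk z -> Cmod (f1 z) <= K * Rpower (1 - Cmod z) (- (1 + a))) ->
  bound (fun I : R => exists r : R, 0 <= r < 1 /\ I = hardy_mean q f r).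
Proof.
  intros Hq HK Ha Hqa Hgr.
  assert (D0 : disk 0%C) by (unfold disk; rewrite Cmod_0; lra).
  assert (Hne : forall z, disk z -> z <> 0%C -> f z <> 0%C).
  { intros z Hz Hz0 E. apply Hz0, f_inj; [exact Hz|exact D0|congruence]. }
  assert (Hgf := function_growth f f1 K a Hf f_0 HK Ha Hgr).
  assert (HKa : 0 < K / a) by now apply Rdiv_lt_0_compat.
  pose (D := fun z : C => if excluded_middle_informative (z = RtoC 0) then RtoC 1
                      else (z * f1 z / f z)%C).
  assert (ED : forall z : C, z <> RtoC 0 -> D z = (z * f1 z / f z)%C).
  { intros z Hz. unfold D. now destruct (excluded_middle_informative (z = RtoC 0)). }
  assert (ED0 : D 0%C = 1%C) by (unfold D; now destruct (excluded_middle_informative (RtoC 0 = RtoC 0))).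
  assert (HB : exists B, forall r, / 2 <= r < 1 ->
    RInt (fun th => Rpower (Cmod (f (circ r th))) q) 0 (2 * PI) <= B).
  { eapply (starlike_integral_means f f1 D _ (K / a) a q Hf Hne); try assumption.
    - intros z Hz Hz0. apply (hol_at_ext_loc (fun z => z * f1 z / f z)%C).
      + generalize (locally_neq_0 (U := C_UniformSpace) (fun w => w) z (continuous_id z) Hz0).
        apply filter_imp. intros w Hw. symmetry. now apply ED.
      + apply hol_at_div; [apply hol_at_mult; [apply hol_at_id|now apply Hf1]|now apply Hf|now apply Hne].
    - destruct (Hf 0%C D0) as [(r & Hr & Er & E) Hf1c].
      assert (Hr0 : r (RtoC 0) <> 0%C) by (rewrite Er; now apply f1_neq_0).
      apply (continuous_ext_loc D (fun z => f1 z / r z)%C).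
      + generalize (filter_and _ _ E (filter_and _ _ (locally_neq_0 r (RtoC 0) Hr Hr0)
          (locally_Cmod_lt (RtoC 0) 1 D0))).
        apply filter_imp. intros z [A [Az A1]]. unfold D.
        destruct (excluded_middle_informative _) as [->|Hz0].
        * rewrite Er. cfield. now apply f1_neq_0.
        * assert (Efz : f z = (z * r z)%C).
          { transitivity (f z - f 0%C)%C; [rewrite f_0; ring|]. rewrite A. ring. }
          rewrite Efz. cfield. now split.
      + apply continuous_Cdiv; [exact Hf1c|exact Hr|exact Hr0].
    - intros z Hz Hz0. split; [now apply ED|]. rewrite ED by exact Hz0.
      now apply (convex_map_starlike f f1). }
  destruct HB as [B HB].
  apply (hardy_bound f f1 q B (K / a) a); try assumption. lra.
Qed.

(** Prawitz's argument with [h = z f'], for which [z h' / h = 1 + z f'' / f'].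
    For [r >= 1 / 2] the factor [z] costs at most [2 ^ p]. *)
Lemma convex_derivative_hardy_bound (p K gam : R) :
  0 < p -> 0 < K -> 0 <= gam -> p * gam < 1 ->
  (forall z, disk z -> Cmod (f1 z) <= K * Rpower (1 - Cmod z) (- gam)) ->
  bound (fun I : R => exists r : R, 0 <= r < 1 /\ I = hardy_mean p f1 r).
Proof.
  intros Hp HK Hgam Hpg Hgr.
  assert (D0 : disk 0%C) by (unfold disk; rewrite Cmod_0; lra).
  pose (h := fun z => (z * f1 z)%C).
  pose (h1 := fun z => (1 * f1 z + z * f2 z)%C).
  assert (Hh : hol_on_disk h h1).
  { intros z Hz. apply hol_at_mult; [apply hol_at_id|now apply Hf1]. }
  assert (HB : exists B, forall r, / 2 <= r < 1 ->
    RInt (fun th => Rpower (Cmod (h (circ r th))) p) 0 (2 * PI) <= B).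
  { eassert (HD : forall z, disk z -> hol_at (fun z => 1 + z * (f2 z / f1 z))%C _ z).
    { intros z Hz. apply hol_at_plus; [apply hol_at_const|].
      apply hol_at_mult; [apply hol_at_id|].
      apply hol_at_div; [now apply Hf2|now apply Hf1|now apply f1_neq_0]. }
    eapply (starlike_integral_means h h1 (fun z => 1 + z * (f2 z / f1 z))%C _ K gam p Hh);
      try assumption.
    - intros z Hz Hz0. apply Cmult_neq_0; [exact Hz0|now apply f1_neq_0].
    - intros z Hz _. now apply HD.
    - eapply hol_at_continuous, HD, D0.
    - cbv beta. ring.
    - intros z Hz Hz0. split.
      + unfold h, h1. cbv beta. field. split; [now apply f1_neq_0|exact Hz0].
      + now apply (convex_map_criterion f f1 f2).
    - intros z Hz. unfold h. rewrite Cmod_mult.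
      apply Rle_trans with (2 := Hgr z Hz). unfold disk in Hz.
      generalize (Cmod_ge_0 z) (Cmod_ge_0 (f1 z)). nra. }
  destruct HB as [B HB].
  apply (hardy_bound f1 f2 p (Rpower 2 p * B) K gam); try assumption.
  - intros z Hz _. now apply f1_neq_0.
  - intros r Hr.
    assert (Hcirc : forall th, disk (circ r th)) by (intros th; unfold disk; rewrite Cmod_circ; lra).
    assert (Hpow : forall F F1, hol_on_disk F F1 -> (forall th, F (circ r th) <> 0%C) ->
      forall th, continuous (fun th => Rpower (Cmod (F (circ r th))) p) th).
    { intros F F1 HF HF0 th.
      apply (continuous_comp (fun th => p * ln (Cmod (F (circ r th)))) exp);
        [|apply continuous_exp].
      apply (continuous_mult (K := R_AbsRing)); [apply continuous_const|].
      apply (continuous_comp (fun th => Cmod (F (circ r th))) ln).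
      - apply (continuous_Cmod (fun th => F (circ r th))), continuous_along_circ,
          (hol_at_continuous F F1), HF, Hcirc.
      - now apply continuous_ln, Cmod_gt_0. }
    assert (Hne : forall th, f1 (circ r th) <> 0%C) by (intros th; apply f1_neq_0, Hcirc).
    assert (Hhne : forall th, h (circ r th) <> 0%C).
    { intros th. apply Cmult_neq_0; [|apply Hne]. apply Cmod_gt_0. rewrite Cmod_circ; lra. }
    apply Rle_trans with
      (RInt (fun th => scal (Rpower 2 p) (Rpower (Cmod (h (circ r th))) p)) 0 (2 * PI)).
    + apply RInt_circle_le.
      * apply (Hpow f1 f2 Hf1 Hne).
      * intros th. apply (continuous_scal_r (V := R_NormedModule)), (Hpow h h1 Hh Hhne).
      * intros th _.
        change (Rpower (Cmod (f1 (circ r th))) p <= Rpower 2 p * Rpower (Cmod (h (circ r th))) p).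
        assert (P := proj1 (Cmod_gt_0 _) (Hne th)).
        rewrite Rpower_mult_distr; [|lra|now apply Cmod_gt_0].
        apply Rpower_le_base; [exact P| |exact Hp].
        unfold h. rewrite Cmod_mult, Cmod_circ by lra. nra.
    + rewrite (RInt_scal (V := R_CompleteNormedModule)).
      * apply Rmult_le_compat_l; [left; apply exp_pos|now apply HB].
      * apply ex_RInt_circle, (Hpow h h1 Hh Hhne).
Qed.

End ConvexHardy.

(** * Approximation of the lower order *)

(** The set of moduli is nonempty and bounded below by [0], so that the infimum
    is a finite number. *)
Lemma lower_order_approximation (f : C -> C) :
  0 <= lower_order f /\
  forall e, lower_order f < e -> exists c, disk c /\ Cmod (A_op f c) < e.
Proof.
  unfold lower_order.
  destruct (Glb_Rbar_correct (fun x : R => exists zeta : C, disk zeta /\ x = Cmod (A_op f zeta)))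
    as [Hlb Hglb].
  set (g := Glb_Rbar _) in *.
  assert (D0 : disk 0%C) by (unfold disk; rewrite Cmod_0; lra).
  assert (H0 : Rbar_le 0 g).
  { apply Hglb. intros x (z & _ & ->). apply Cmod_ge_0. }
  assert (H1 : Rbar_le g (Cmod (A_op f 0%C))) by (apply Hlb; now exists 0%C).
  destruct g as [g| |]; try easy. simpl in *. split; [exact H0|].
  intros e He. apply NNPP. intros N.
  assert (H2 : Rbar_le e g); [|simpl in H2; lra].
  apply Hglb. intros x (z & Hz & ->). simpl.
  destruct (Rle_lt_dec e (Cmod (A_op f z))); [assumption|]. exfalso. apply N. now exists z.
Qed.

Lemma Rbar_lt_recip (p x : R) : 0 < p -> 0 <= x -> Rbar_lt p (recip x) -> p * x < 1.
Proof.
  intros Hp Hx. unfold recip. destruct (Req_EM_T x 0) as [->|Hx0]; simpl; intros H; [lra|].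
  apply (Rmult_lt_compat_r x) in H; [|lra]. replace (1 / x * x) with 1 in H by (field; lra). exact H.
Qed.

(** The infimum defining the lower order need not be attained, and the growth
    of [f] is a power only for a positive exponent: an exponent [a] above the
    lower order [b] meets both difficulties. *)
Lemma exponent_room (p s b : R) :
  0 < p -> 0 <= b -> p * (s + b) < 1 -> exists a, b < a /\ p * (s + a) < 1.
Proof.
  intros Hp Hb H. exists (b + (1 - p * (s + b)) / (2 * p)).
  assert (0 < (1 - p * (s + b)) / (2 * p)) by (apply Rdiv_lt_0_compat; lra).
  split; [lra|].
  replace (p * (s + (b + (1 - p * (s + b)) / (2 * p)))) with ((1 + p * (s + b)) / 2)
    by (field; lra). lra.
Qed.

Theorem theorem3 (f : C -> C) (hf : class_C f) :
  (forall p : R, 0 < p -> Rbar_lt (Finite p) (recip (1 + lower_order f)) ->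
     Hardy p (C_derive f)) /\
  (forall q : R, 0 < q -> Rbar_lt (Finite q) (recip (lower_order f)) ->
     Hardy q f).
Proof.
  destruct hf as [(Hhol & Hinj & a & Ha0 & Ha1 & Hsum) Hconv].
  assert (D0 : disk 0%C) by (unfold disk; rewrite Cmod_0; lra).
  destruct (sum_on_disk_three_derivatives a f Hsum) as (f1 & f2 & f3 & Hf & Hf1 & Hf2 & E1).
  assert (F0 : f 0%C = 0%C).
  { transitivity (a 0%nat); [|exact Ha0]. apply (filterlim_locally_unique _ _ _ (Hsum 0%C D0)).
    apply (is_pseries_0 (K := C_AbsRing) (V := C_NormedModule)). }
  assert (Hne : forall z, disk z -> f1 z <> 0%C).
  { apply (injective_derivative_neq_0 f f1 Hf Hinj). rewrite E1, Ha1.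
    intros E. apply RtoC_inj in E. lra. }
  destruct (lower_order_approximation f) as [Hb Happ].
  assert (Hgr : forall a, lower_order f < a -> exists K, 0 < K /\
     forall z, disk z -> Cmod (f1 z) <= K * Rpower (1 - Cmod z) (- (1 + a))).
  { clear a Ha0 Ha1 Hsum E1. intros a Hba. destruct (Happ a Hba) as (c & Hc & HA).
    destruct (convex_derivative_growth f f1 f2 f3 c Hf Hf1 Hf2 Hinj Hne Hconv Hc) as (K & HK & H).
    exists K. split; [exact HK|]. intros z Hz. apply Rle_trans with (1 := H z Hz).
    apply Rmult_le_compat_l; [lra|].
    unfold A_op in HA. rewrite (hol_on_disk_C_derive f f1 c Hf Hc) in HA.
    rewrite (is_C_derive_unique _ _ _ (C_derive_deriv f f1 f2 c Hf Hf1 Hc)) in HA.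
    unfold Rpower. apply exp_le. unfold disk in Hz.
    assert (ln (1 - Cmod z) <= ln 1) by (apply ln_le; [lra|generalize (Cmod_ge_0 z); lra]).
    rewrite ln_1 in *. nra. }
  split.
  - intros p Hp Hlt. apply Rbar_lt_recip in Hlt; [|exact Hp|lra].
    destruct (exponent_room p 1 (lower_order f) Hp Hb Hlt) as (b & Hba & Hpa).
    destruct (Hgr b Hba) as (K & HK & H). split.
    + intros z Hz. eexists. now apply (C_derive_deriv f f1 f2).
    + destruct (convex_derivative_hardy_bound f f1 f2 f3 Hf Hf1 Hf2 Hinj Hconv Hne p K (1 + b)
        Hp HK ltac:(lra) Hpa H) as [M HM].
      exists M. intros I (r & Hr & ->). apply HM. exists r. split; [exact Hr|].
      rewrite !hardy_mean_circ. apply RInt_ext. intros th _. do 2 f_equal.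
      apply hol_on_disk_C_derive; [exact Hf|]. unfold disk. rewrite Cmod_circ; lra.
  - intros q Hq Hlt. apply Rbar_lt_recip in Hlt; [|exact Hq|exact Hb].
    destruct (exponent_room q 0 (lower_order f) Hq Hb ltac:(now rewrite Rplus_0_l))
      as (b & Hba & Hqa).
    rewrite Rplus_0_l in Hqa. destruct (Hgr b Hba) as (K & HK & H). split; [exact Hhol|].
    apply (convex_function_hardy_bound f f1 f2 Hf Hf1 Hinj Hconv F0 Hne q K b); try assumption. lra.
Qed.
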